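(* Let $p\in(0,1)$ be arbitrary. For each $n$, let $L_1^{(n)}\ge L_2^{(n)}\ge\cdots$ be the sizes of the connected components, in decreasing order (padded with zeros), of a bipartite random mapping of size $n$ with partition proportion $p$. Then, as $n\to\infty$, $$n^{-1}\left(L_1^{(n)},L_2^{(n)},\dots\right)\xrightarrow{d}\mathcal{PD}(1/2).$$
   Context: A mapping $f:V\to V$ on a finite set $V$ with bipartition $(S_0,S_1)$ is bipartite if $f(S_0)\subseteq S_1$ and $f(S_1)\subseteq S_0$. Nodes of $S_0$ carry weight $p$ and nodes of $S_1$ carry weight $1-p$. The exponential generating functions (EGFs) $T_0(z),T_1(z)$ of trees rooted in $S_0$, $S_1$ are the unique formal power series with $T_0(z)=pz\exp(T_1(z))$ and $T_1(z)=(1-p)z\exp(T_0(z))$. Let $\rho$ be their common dominant singularity (common radius of convergence). The EGF of connected components is $C(z)=\ln\left(\frac{1}{1-T_0(z)T_1(z)}\right)$ and that of mappings is $M(z)=\exp(C(z))$. Random model: in a bipartite random mapping of size $n$ (with $n$ such that $[z^n]M(z)>0$), let $C_k^{(n)}$ be the number of connected components with exactly $k$ nodes. Let $Z_1,\dots,Z_n$ be independent with $Z_k\sim\operatorname{Po}(\lambda_k)$, $\lambda_k=\rho^k[z^k]C(z)$ (where $[z^k]$ denotes the plain coefficient of $z^k$). The joint law of $(C_1^{(n)},\dots,C_n^{(n)})$ is the law of $(Z_1,\dots,Z_n)$ conditioned on $\sum_{k=1}^n kZ_k=n$. $\mathcal{PD}(\theta)$ is the Poisson–Dirichlet distribution with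 parameter $\theta>0$: the law of the decreasing rearrangement of $(B_1,(1-B_1)B_2,(1-B_1)(1-B_2)B_3,\dots)$ with $B_i$ i.i.d. $\operatorname{Beta}(1,\theta)$. The arrow $\xrightarrow{d}$ denotes convergence in distribution of the sequences (joint convergence of finite-dimensional marginals). *)

(* Defs.v *)
From HB Require Import structures.
From mathcomp Require Import all_boot all_order all_algebra.
From mathcomp Require Import all_classical all_reals all_analysis.

Set Implicit Arguments.
Unset Strict Implicit.
Unset Printing Implicit Defensive.

Import Order.TTheory GRing.Theory Num.Theory.
Import numFieldNormedType.Exports.

Local Open Scope classical_set_scope.
Local Open Scope ring_scope.

Section BipartiteMappings.
Variable n : nat.
Implicit Types (S : {set 'I_n}) (f : {ffun 'I_n -> 'I_n}).

(* The bipartition (S_0, S_1) of 'I_n is encoded by S_0 = S, S_1 = ~: S. *)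
Definition bipartite S f : bool :=
  (f @: S \subset ~: S) && (f @: (~: S) \subset S).

(* Components of the functional graph of f are those of its underlying
   undirected graph; [fconnect f] only follows arcs forward. *)
Definition mapping_edge f : rel 'I_n := [rel x y | (f x == y) || (f y == x)].

Definition mapping_components f : {set {set 'I_n}} :=
  equivalence_partition (connect (mapping_edge f)) [set: 'I_n].

Definition component_sizes f : seq nat :=
  sort geq [seq #|A : {set 'I_n}| | A <- enum (mapping_components f)].

(* 0-based: [component_size f 0] is the size of the largest component. *)
Definition component_size f (j : nat) : nat := nth 0%N (component_sizes f) j.

Variables (R : realType) (p : R).

Definition mapping_weight S : R := p ^+ #|S| * (1 - p) ^+ #|~: S|.

(* n! times the coefficient of z^n in the generating function of mappings
   1 / (1 - T_0 T_1), where T_0 = p z exp T_1 and T_1 = (1 - p) z exp T_0. *)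
Definition total_weight : R :=
  \sum_(x : {set 'I_n} * {ffun 'I_n -> 'I_n} | bipartite x.1 x.2)
    mapping_weight x.1.

(* Expectation of h (f) when the bipartite mapping (S, f) is drawn with
   probability proportional to its weight.  It is the junk value 0 when there
   is no bipartite mapping of size n, which for 0 < p < 1 is only n = 1. *)
Definition mapping_mean (h : {ffun 'I_n -> 'I_n} -> R) : R :=
  \sum_(x : {set 'I_n} * {ffun 'I_n -> 'I_n} | bipartite x.1 x.2)
    mapping_weight x.1 / total_weight * h x.2.

End BipartiteMappings.

Section PoissonDirichlet.
Variable R : realType.

(* The library's [beta_fun], [beta_pdf] only allow integer parameters. *)
Definition real_beta_kernel (a b x : R) : R :=
  x `^ (a - 1) * (1 - x) `^ (b - 1).

Definition real_beta_fun (a b : R) : R :=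
  \int[@lebesgue_measure R]_(x in `]0, 1[) real_beta_kernel a b x.

Definition real_beta_pdf (a b x : R) : R :=
  (real_beta_kernel a b \_ `]0, 1[) x / real_beta_fun a b.

(* v lists all the values of u, with multiplicity, in decreasing order. *)
Definition decreasing_rearrangement (u v : nat -> R) : Prop :=
  nonincreasing_seq v /\
  exists2 s : nat -> nat, bijective s & forall k, v k = u (s k).

Definition stick_breaking (b : nat -> R) (i : nat) : R :=
  b i * \prod_(j < i) (1 - b j).

Variables (d : measure_display) (T : measurableType d) (P : probability T R).

Definition beta_distributed (a b : R) (X : {RV P >-> R}) : Prop :=
  forall A : set R, measurable A ->
    distribution P X A =
    (\int[@lebesgue_measure R]_(x in A) (real_beta_pdf a b x)%:E)%E.

Definition mutually_independent (X : nat -> {RV P >-> R}) : Prop :=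
  forall (s : seq nat) (A : nat -> set R), uniq s ->
    (forall i, measurable (A i)) ->
    P (\bigcap_(i in [set` s]) (X i @^-1` A i)) =
    (\prod_(i <- s) P (X i @^-1` A i))%E.

(* X is a random sequence with law PD(theta), realised by its defining
   construction; every PD(theta) sequence has the law of such an X.  The rearrangement is required almost surely: on the null
   event where some B_i is 0 or 1 a bijective rearrangement may not exist. *)
Definition poisson_dirichlet (theta : R) (X : nat -> {RV P >-> R}) : Prop :=
  exists B : nat -> {RV P >-> R},
    [/\ mutually_independent B,
        forall i, beta_distributed 1 theta (B i) &
        {ae P, forall w,
          decreasing_rearrangement (stick_breaking (B ^~ w)) (X ^~ w)}].

End PoissonDirichlet.

(* Main.v *)
Require Import Defs.
From HB Require Import structures.
From mathcomp Require Import all_boot all_order all_algebra.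
From mathcomp Require Import all_classical all_reals all_analysis.
From mathcomp Require Import measurable_realfun gauss_integral.
From mathcomp Require Import ring lra zify.
Import Order.TTheory GRing.Theory Num.Theory.
Import numFieldNormedType.Exports.
Local Open Scope ring_scope.

Set Implicit Arguments.
Unset Strict Implicit.
Unset Printing Implicit Defensive.

(** Write W_n for the total weight of the bipartite mappings of size n, c_k for
the total weight of the connected ones of size k, and set
  M_n = W_n e^(-kappa n) / n!   and   a_k = k c_k e^(-kappa k) / k!
for a suitable constant kappa (so that e^(-kappa) is the dominant singularity).

The parameter 1/2 comes from one asymptotic fact, [scaled_weight_cvg]:
M_n ~ c n^(-1/2) with c > 0.  Counting the mappings for each bipartition gives
W_n = sum_a C(n,a) p^a (1-p)^(n-a) (n-a)^a a^(n-a); Stirling's formula turns the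
a-th summand of M_n into e^(n (r(a/n) - r(t))) / n up to a factor that depends
smoothly on a/n in ]0, 1[, where r is a strictly concave rate function with
maximum at t.  Laplace's method, carried out as dominated convergence of step
functions, gives the n^(-1/2).

Pick a vertex uniformly at random and look at its component.  The component has
size k with probability a_k M_(n-k) / (n M_n), and once it is deleted a random
bipartite mapping of size n-k is left ([mapping_total_pick]); in particular
n M_n = sum_k a_k M_(n-k).  Compare M with e_n = C(2n,n)/4^n, the coefficients of
(1-z)^(-1/2), which satisfy e * e = 1.  Since M_n / e_n converges, convolving the
recurrence with e shows that the means of the a_k tend to 1/2 ([mean_cvg]), and
summation by parts then shows that the relative size of the picked component has
limiting distribution function 1 - sqrt(1 - x) ([first_pick_cvg]), which is that
of Beta(1,1/2) ([beta_law_cdf]).  Repeating the pick in the remaining mapping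
multiplies such limits ([cell_mean_cvg]): the relative sizes of the components in
the order in which they are picked behave like the stick-breaking sequence.

It remains to pass from that order to the decreasing one.  Cut ]0, 1] into D
cells and record only the cells ds of the first J stick proportions.  These
determine an approximate decreasing sequence [cell_point], whose distance to the
true one is at most J/D plus about the length of the stick left after J breaks,
because decreasing rearrangement does not increase the sup distance
([rearrangement_close]).  So both the mean of g over mappings and its mean over
the Poisson-Dirichlet sequence are close to sums over ds of the same values
g(cell_point ds), weighted by the probabilities of ds, and these probabilities
converge.  The error is controlled by the expected rest of the stick, at most
(2/3)^J ([sum_osc_le]). *)

(** * Decomposing a mapping along one component *)

Lemma bipartiteP n (S : {set 'I_n}) (f : {ffun 'I_n -> 'I_n}) :
  reflect (forall x, (f x \in S) = (x \notin S)) (bipartite S f).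
Proof.
rewrite /bipartite; apply: (iffP andP) => [[/fintype.subsetP h1 /fintype.subsetP h2] x|h].
  case: (boolP (x \in S)) => xS /=.
    by have := h1 _ (imset_f f xS); rewrite inE => /negbTE.
  by apply: h2; apply: imset_f; rewrite inE.
by split; apply/fintype.subsetP => y /imsetP[x xS ->]; move: xS; rewrite ?inE h // => ->.
Qed.

Definition connected_mapping k (f : {ffun 'I_k -> 'I_k}) : bool :=
  [set: 'I_k] \in mapping_components f.

Section ComponentClasses.
Variables (n : nat) (f : {ffun 'I_n -> 'I_n}).

Lemma connect_mapping_edge_sym : connect_sym (mapping_edge f).
Proof. by apply: sym_connect_sym => x y; rewrite /mapping_edge /= orbC. Qed.

Definition component_of (x : 'I_n) : {set 'I_n} :=
  [set y | connect (mapping_edge f) x y].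

Lemma mapping_componentsE :
  mapping_components f = [set component_of x | x : 'I_n].
Proof.
by rewrite /mapping_components /equivalence_partition;
  apply/setP => A; apply/imsetP/imsetP => -[x _ ->]; exists x => //;
  apply/setP => y; rewrite !inE.
Qed.

(** A component is stable under f forwards and backwards, so f restricts both to
the component and to its complement. *)
Lemma component_stable A x : A \in mapping_components f -> (f x \in A) = (x \in A).
Proof.
rewrite mapping_componentsE => /imsetP[y _ ->]; rewrite !inE.
apply/esym/(same_connect_r connect_mapping_edge_sym).
by apply: connect1; rewrite /mapping_edge /= eqxx.
Qed.

Lemma connected_mappingP : connected_mapping f -> mapping_components f = [set [set: 'I_n]].
Proof.
rewrite /connected_mapping mapping_componentsE => /imsetP[x _ /setP xT].
have xy z : connect (mapping_edge f) x z by have := xT z; rewrite !inE.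
have cT z : component_of z = [set: 'I_n].
  by apply/setP => y; rewrite !inE -(same_connect connect_mapping_edge_sym (xy z)) xy.
apply/setP => A; rewrite inE; apply/imsetP/eqP => [[z _ ->]|->]; first exact: cT.
by exists x; rewrite ?cT.
Qed.

Lemma perm_component_sizes :
  perm_eq (component_sizes f) [seq #|A : {set 'I_n}| | A <- enum (mapping_components f)].
Proof. by rewrite /component_sizes; apply/permPl; exact: perm_sort. Qed.

End ComponentClasses.

(** The vertex set is presented as a disjoint union through a bijection i with
inverse j, rather than as a literal 'I_(k + l): the first block has to become an
arbitrary subset A of 'I_n. *)
Section Glue.
Variables (n k l : nat) (i : 'I_k + 'I_l -> 'I_n) (j : 'I_n -> 'I_k + 'I_l).
Hypotheses (ij : cancel i j) (ji : cancel j i).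

Definition glue_set (S1 : {set 'I_k}) (S2 : {set 'I_l}) : {set 'I_n} :=
  [set z | match j z with inl x => x \in S1 | inr y => y \in S2 end].

Definition glue_fun (f1 : {ffun 'I_k -> 'I_k}) (f2 : {ffun 'I_l -> 'I_l}) :
    {ffun 'I_n -> 'I_n} :=
  [ffun z => match j z with inl x => i (inl (f1 x)) | inr y => i (inr (f2 y)) end].

Let i1 x := i (inl x).
Let i2 x := i (inr x).

Let i1_inj : injective i1.
Proof. by move=> x y /(can_inj ij) []. Qed.

Let i2_inj : injective i2.
Proof. by move=> x y /(can_inj ij) []. Qed.

Let i12 x y : i1 x == i2 y = false.
Proof. by apply/eqP => /(can_inj ij). Qed.

Lemma in_glue_set S1 S2 u :
  (i u \in glue_set S1 S2) = match u with inl x => x \in S1 | inr y => y \in S2 end.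
Proof. by rewrite inE ij. Qed.

Lemma glue_funE f1 f2 u : glue_fun f1 f2 (i u) =
  match u with inl x => i (inl (f1 x)) | inr y => i (inr (f2 y)) end.
Proof. by rewrite ffunE ij. Qed.

Lemma glue_setC S1 S2 : ~: glue_set S1 S2 = glue_set (~: S1) (~: S2).
Proof. by apply/setP => z; rewrite !inE; case: (j z) => a; rewrite inE. Qed.

Lemma glue_setE S1 S2 : glue_set S1 S2 = (i1 @: S1) :|: (i2 @: S2).
Proof.
apply/setP => z; rewrite -(ji z) in_glue_set inE.
case: (j z) => a; symmetry.
  rewrite -[i (inl a)]/(i1 a) (mem_imset _ _ i1_inj); apply/orb_idr.
  by case/imsetP => b _ /eqP; rewrite i12.
rewrite -[i (inr a)]/(i2 a) (mem_imset _ _ i2_inj); apply/orb_idl.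
by case/imsetP => b _ /eqP; rewrite eq_sym i12.
Qed.

Lemma card_glue_set S1 S2 : #|glue_set S1 S2| = (#|S1| + #|S2|)%N.
Proof.
rewrite glue_setE cardsU !card_imset //.
rewrite (_ : _ :&: _ = finset.set0) ?cards0 ?subn0 //.
apply/setP => z; rewrite !inE; apply/negP => /andP[/imsetP[a _ ->]].
by case/imsetP => b _ /eqP; rewrite i12.
Qed.

Lemma mapping_weight_glue (R : realType) (p : R) S1 S2 :
  mapping_weight p (glue_set S1 S2) = mapping_weight p S1 * mapping_weight p S2.
Proof. by rewrite /mapping_weight glue_setC !card_glue_set !exprD; ring. Qed.

Lemma bipartite_glue S1 S2 f1 f2 :
  bipartite (glue_set S1 S2) (glue_fun f1 f2) = bipartite S1 f1 && bipartite S2 f2.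
Proof.
apply/bipartiteP/andP => [h|[/bipartiteP h1 /bipartiteP h2] z].
  split; apply/bipartiteP => x.
    by have := h (i (inl x)); rewrite glue_funE !in_glue_set.
  by have := h (i (inr x)); rewrite glue_funE !in_glue_set.
by rewrite -(ji z) in_glue_set glue_funE; case: (j z) => a; rewrite in_glue_set.
Qed.

Section Connect.
Variables (f1 : {ffun 'I_k -> 'I_k}) (f2 : {ffun 'I_l -> 'I_l}).
Let f := glue_fun f1 f2.

Let A := [set z | if j z is inl _ then true else false].

Let clA : fingraph.closed (mapping_edge f) (mem A).
Proof.
move=> y z; rewrite -(ji y) -(ji z) /mapping_edge /= !glue_funE /= !inE !ij.
by case: (j y) => a; case: (j z) => b // /orP[] /eqP /(can_inj ij).
Qed.

Let clA' : fingraph.closed (mapping_edge f) (mem (~: A)).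
Proof. by move=> y z /clA /=; rewrite !inE => ->. Qed.

(** No edge joins the two blocks, so the walks that start in a block are the
images of the walks of the corresponding mapping. *)
Lemma component_of_gluel x :
  component_of f (i1 x) = i1 @: component_of f1 x.
Proof.
have adj : rel_adjunction i1 (mapping_edge f) (mapping_edge f1) (mem A).
  apply: strict_adjunction => //.
  - exact: connect_mapping_edge_sym.
  - apply/fintype.subsetP => z; rewrite inE -{2}(ji z); case: (j z) => // a _.
    exact: codom_f.
  - move=> y z _; rewrite /mapping_edge /= !glue_funE !(inj_eq (can_inj ij)) //.
case: adj => _ h; apply/setP => z; rewrite inE.
apply/idP/imsetP => [xz|[y]].
  have : z \in A by rewrite -(closed_connect clA xz) inE ij.
  rewrite inE; move: xz; rewrite -{1 3}(ji z); case: (j z) => // a xz _.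
  exists a => //; rewrite inE h //; by rewrite inE ij.
by rewrite inE h ?inE ?ij // => ? ->.
Qed.

Lemma component_of_gluer x :
  component_of f (i2 x) = i2 @: component_of f2 x.
Proof.
have adj : rel_adjunction i2 (mapping_edge f) (mapping_edge f2) (mem (~: A)).
  apply: strict_adjunction => //.
  - exact: connect_mapping_edge_sym.
  - apply/fintype.subsetP => z; rewrite !inE -{2}(ji z); case: (j z) => // a _.
    exact: codom_f.
  - move=> y z _; rewrite /mapping_edge /= !glue_funE !(inj_eq (can_inj ij)) //.
case: adj => _ h; apply/setP => z; rewrite inE.
apply/idP/imsetP => [xz|[y]].
  have : z \in ~: A by rewrite -(closed_connect clA' xz) !inE ij.
  rewrite !inE; move: xz; rewrite -{1 3}(ji z); case: (j z) => // a xz _.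
  exists a => //; rewrite inE h //; by rewrite !inE ij.
by rewrite inE h ?inE ?ij // => ? ->.
Qed.

Lemma mapping_components_glue : mapping_components f =
  [set i1 @: B | B : {set 'I_k} in mapping_components f1] :|:
  [set i2 @: B | B : {set 'I_l} in mapping_components f2].
Proof.
apply/setP => B; rewrite !mapping_componentsE; apply/imsetP/setUP.
  case=> z _ ->; rewrite -(ji z); case: (j z) => a; [left|right].
    by rewrite (component_of_gluel a); apply: imset_f; exact: imset_f.
  by rewrite (component_of_gluer a); apply: imset_f; exact: imset_f.
by case=> /imsetP[_ /imsetP[a _ ->] ->]; [exists (i1 a)|exists (i2 a)] => //;
  rewrite ?component_of_gluel ?component_of_gluer.
Qed.

(** Components are nonempty; this makes the two families of image components
disjoint, hence the sizes are concatenated without loss of multiplicity. *)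
Lemma image_components_neq (B : {set 'I_k}) (C : {set 'I_l}) :
  B \in mapping_components f1 -> i1 @: B <> i2 @: C.
Proof.
rewrite mapping_componentsE => /imsetP[x _ ->] /setP /(_ (i1 x)).
rewrite (mem_imset _ _ i1_inj) inE connect0 => /esym/imsetP[y _ /eqP].
by rewrite i12.
Qed.

Lemma perm_component_sizes_glue :
  perm_eq (component_sizes f) (component_sizes f1 ++ component_sizes f2).
Proof.
apply: (perm_trans (perm_component_sizes _)); rewrite perm_sym.
apply: (perm_trans (perm_cat (perm_component_sizes _) (perm_component_sizes _))).
rewrite perm_sym.
have -> : [seq #|B : {set 'I_k}| | B <- enum (mapping_components f1)] =
    [seq #|A : {set 'I_n}| | A <- [seq i1 @: B | B : {set 'I_k} <- enum (mapping_components f1)]].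
  by rewrite -map_comp; apply: eq_map => B /=; rewrite card_imset.
have -> : [seq #|B : {set 'I_l}| | B <- enum (mapping_components f2)] =
    [seq #|A : {set 'I_n}| | A <- [seq i2 @: B | B : {set 'I_l} <- enum (mapping_components f2)]].
  by rewrite -map_comp; apply: eq_map => B /=; rewrite card_imset.
rewrite -map_cat; apply: perm_map; apply: uniq_perm.
- exact: enum_uniq.
- rewrite cat_uniq !map_inj_uniq ?enum_uniq /=; try exact: imset_inj.
  rewrite andbT; apply/hasPn => _ /mapP[C _ ->]; apply/negP => /mapP[B].
  by rewrite mem_enum => /image_components_neq h /esym /h.
move=> B; rewrite mem_enum mapping_components_glue mem_cat inE.
by congr (_ || _); apply/imsetP/mapP => -[C CB ->]; exists C; rewrite ?mem_enum // -mem_enum.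
Qed.

Lemma whole_component_glue :
  (i1 @: [set: 'I_k] \in mapping_components f) = connected_mapping f1.
Proof.
rewrite mapping_components_glue inE /connected_mapping; apply/orP/idP; last first.
  by move=> h; left; exact: imset_f.
case=> /imsetP[B hB]; first by move/(imset_inj i1_inj) ->.
move=> e; exfalso; move: hB; rewrite mapping_componentsE => /imsetP[x _ eB].
move/setP: e => /(_ (i2 x)); rewrite (mem_imset _ _ i2_inj) eB inE connect0.
by case/imsetP => a _ /eqP; rewrite eq_sym i12.
Qed.

Lemma component_sizes_connected : connected_mapping f1 -> component_sizes f1 = [:: k].
Proof.
by move=> /connected_mappingP e; rewrite /component_sizes e enum_set1 /= cardsT card_ord.
Qed.

Lemma component_sizes_glue_connected : connected_mapping f1 ->
  perm_eq (rem k (component_sizes f)) (component_sizes f2).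
Proof.
move=> cf1; have := perm_component_sizes_glue.
rewrite (component_sizes_connected cf1) => h.
have ks : k \in component_sizes f by rewrite (perm_mem h) mem_head.
by move: h; rewrite (permPl (perm_to_rem ks)) /= perm_cons.
Qed.

End Connect.

Notation mapping_pair n := ({set 'I_n} * {ffun 'I_n -> 'I_n})%type.

Definition glue_pair (x : mapping_pair k * mapping_pair l) : mapping_pair n :=
  (glue_set x.1.1 x.2.1, glue_fun x.1.2 x.2.2).

Definition unglue_pair (x : mapping_pair n) : mapping_pair k * mapping_pair l :=
  (([set a | i1 a \in x.1], [ffun a => if j (x.2 (i1 a)) is inl b then b else a]),
   ([set a | i2 a \in x.1], [ffun a => if j (x.2 (i2 a)) is inr b then b else a])).

Lemma glue_pairK : cancel glue_pair unglue_pair.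
Proof.
case=> [[S1 f1] [S2 f2]]; rewrite /glue_pair /unglue_pair /=.
by congr ((_, _), (_, _)); first [apply/setP => a; rewrite inE in_glue_set //
  | apply/ffunP => a; rewrite ffunE glue_funE ij].
Qed.

(** The default branches of [unglue_pair] are never reached when the first block
is a union of components: the mapping then sends each block into itself. *)
Lemma unglue_pairK (x : mapping_pair n) :
  i1 @: [set: 'I_k] \in mapping_components x.2 -> glue_pair (unglue_pair x) = x.
Proof.
case: x => S f /= hA; rewrite /glue_pair /unglue_pair /=.
have st z := component_stable z hA.
have inA u : (i u \in i1 @: [set: 'I_k]) = if u is inl _ then true else false.
  case: u => a; first by apply: imset_f.
  by apply/imsetP => -[b _ /eqP]; rewrite eq_sym i12.
congr (_, _).
  by apply/setP => z; rewrite inE -{2}(ji z); case: (j z) => a; rewrite inE.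
apply/ffunP => z; rewrite -(ji z) glue_funE; set u := j z.
have := st (i u); rewrite -{1 2}(ji (f (i u))) !inA.
by case: u => a; rewrite ffunE /i1 /i2; case E: (j (f _)) => [b|b].
Qed.

End Glue.

Section WeightedSums.
Variables (R : realType) (p : R).

(** Unnormalised expectations, so that the decomposition below holds also for the
sizes without any bipartite mapping. *)
Definition mapping_total n (h : seq nat -> R) : R :=
  \sum_(x : {set 'I_n} * {ffun 'I_n -> 'I_n} | bipartite x.1 x.2)
    mapping_weight p x.1 * h (component_sizes x.2).

Definition connected_weight k : R :=
  \sum_(x : {set 'I_k} * {ffun 'I_k -> 'I_k} |
      bipartite x.1 x.2 && connected_mapping x.2) mapping_weight p x.1.

Lemma card_split_bij n (A : {set 'I_n}) :
  exists (i : 'I_#|A| + 'I_#|~: A| -> 'I_n) (j : 'I_n -> 'I_#|A| + 'I_#|~: A|),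
  [/\ cancel i j, cancel j i & (fun a => i (inl a)) @: [set: 'I_#|A|] = A].
Proof.
pose i (u : 'I_#|A| + 'I_#|~: A|) : 'I_n :=
  match u with inl a => enum_val a | inr b => enum_val b end.
have i_inj : injective i.
  move=> [a|a] [b|b] /=; rewrite /i.
  - by move/enum_val_inj => ->.
  - by move=> e; have := enum_valP b; rewrite -e inE enum_valP.
  - by move=> e; have := enum_valP a; rewrite e inE enum_valP.
  - by move/enum_val_inj => ->.
have [j ij ji] : bijective i.
  by apply: inj_card_bij => //; rewrite card_sum !card_ord cardsC card_ord.
exists i, j; split => //.
apply/setP => z; apply/imsetP/idP => [[a _ ->]|zA]; first exact: enum_valP.
by exists (enum_rank_in zA z); rewrite // /i enum_rankK_in.
Qed.

(** Cutting along A is a weight-preserving bijection onto pairs of a connected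
mapping on A and an arbitrary mapping on the complement, and the removal of the
entry #|A| from the component sizes leaves those of the second mapping. *)
Lemma mapping_total_component n (A : {set 'I_n}) (h : seq nat -> R) :
  (forall s t, perm_eq s t -> h s = h t) ->
  \sum_(x : {set 'I_n} * {ffun 'I_n -> 'I_n} |
      bipartite x.1 x.2 && (A \in mapping_components x.2))
    mapping_weight p x.1 * h (rem #|A| (component_sizes x.2)) =
  connected_weight #|A| * mapping_total (n - #|A|) h.
Proof.
move=> hP; have [i [j [ij ji iA]]] := card_split_bij A.
have -> : (n - #|A|)%N = #|~: A| by have := cardsC A; rewrite card_ord; lia.
have Ain f1 f2 :
    (A \in mapping_components (glue_fun i j f1 f2)) = connected_mapping f1.
  have <- := whole_component_glue ij ji f1 f2.
  by apply: (congr1 (fun B : {set 'I_n} => B \in mapping_components _)).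
rewrite /connected_weight /mapping_total big_distrl /=.
under [RHS]eq_bigr => x _ do rewrite big_distrr /=.
rewrite pair_big /= (reindex_onto (glue_pair i j) (unglue_pair i j)) /=; last first.
  by move=> x /andP[_ xA]; apply: unglue_pairK => //; rewrite iA.
apply: eq_big => [[[S1 f1] [S2 f2]]|[[S1 f1] [S2 f2]]] /=.
  rewrite glue_pairK // eqxx andbT bipartite_glue // Ain.
  by rewrite -andbA [X in _ && X]andbC andbA.
rewrite bipartite_glue // Ain => /andP[/andP[_ c1] _].
rewrite (mapping_weight_glue ij ji) -mulrA; congr (_ * _); congr (_ * _).
apply: hP.
exact: (component_sizes_glue_connected ij ji).
Qed.

Lemma sum_sets_by_card n (F : nat -> R) :
  \sum_(A : {set 'I_n}) F #|A| = \sum_(k < n.+1) 'C(n, k)%:R * F k.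
Proof.
rewrite (partition_big (fun A : {set 'I_n} => inord #|A| : 'I_n.+1) predT) //=.
apply: eq_bigr => k _.
have e (A : {set 'I_n}) : (inord #|A| == k) = (#|A| == k :> nat).
  rewrite -val_eqE /= inordK // ltnS -[X in (_ <= X)%N](card_ord n).
  exact: max_card.
rewrite (eq_bigl _ _ e) (eq_bigr (fun=> F k)) => [|A /eqP -> //].
rewrite sumr_const mulr_natl; congr (_ *+ _).
by have := card_draws 'I_n k; rewrite card_ord cardsE => <-.
Qed.

(** The exponential formula in pointed form: choosing one component of a mapping
is choosing its vertex set, a connected mapping on it and a mapping on the rest.
With Phi carrying a factor k/n this is a size-biased pick. *)
Lemma mapping_total_pick n (Phi : nat -> seq nat -> R) :
  (forall k s t, perm_eq s t -> Phi k s = Phi k t) ->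
  mapping_total n (fun s => \sum_(x <- s) Phi x (rem x s)) =
  \sum_(k < n.+1) 'C(n, k)%:R *
    (connected_weight k * mapping_total (n - k) (Phi k)).
Proof.
move=> PhiP; rewrite -(sum_sets_by_card n
  (fun k => connected_weight k * mapping_total (n - k) (Phi k))) /=.
transitivity (\sum_(A : {set 'I_n})
  \sum_(x : {set 'I_n} * {ffun 'I_n -> 'I_n} |
      bipartite x.1 x.2 && (A \in mapping_components x.2))
    mapping_weight p x.1 * Phi #|A| (rem #|A| (component_sizes x.2))).
  rewrite (exchange_big_dep (fun x => bipartite x.1 x.2)) /=; last first.
    by move=> A x _ /andP[].
  apply: eq_bigr => x bx; rewrite (perm_big _ (perm_component_sizes x.2)) /=.
  rewrite big_map big_enum /= big_distrr /=.
  by apply: eq_bigl => A; rewrite bx.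
by apply: eq_bigr => A _; apply: mapping_total_component => s t; exact: PhiP.
Qed.

Lemma total_weightE n : total_weight n p = mapping_total n (fun=> 1).
Proof. by apply: eq_bigr => x _; rewrite mulr1. Qed.

Lemma card_bipartite n (S : {set 'I_n}) :
  #|[set f : {ffun 'I_n -> 'I_n} | bipartite S f]| =
  (#|~: S| ^ #|S| * #|S| ^ #|~: S|)%N.
Proof.
pose F (x : 'I_n) : pred 'I_n := [pred y | (y \in S) == (x \notin S)].
have -> : #|[set f : {ffun 'I_n -> 'I_n} | bipartite S f]| = #|family F|.
  rewrite cardsE; apply: eq_card => f; rewrite !inE; apply/bipartiteP/familyP => h x.
    by rewrite inE h.
  by have := h x; rewrite inE => /eqP.
rewrite card_family foldrE big_map big_enum /= (bigID (mem S)) /=; congr (_ * _)%N.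
  rewrite (eq_bigr (fun=> #|~: S|)) ?prod_nat_const // => x xS.
  by apply: eq_card => y; rewrite !inE xS /=; case: (y \in S).
rewrite (eq_bigr (fun=> #|S|)) => [|x xS].
  rewrite prod_nat_const; congr (_ ^ _)%N; apply: eq_card => x; by rewrite !inE.
by apply: eq_card => y; rewrite !inE xS /=; case: (y \in S).
Qed.

(** For a given bipartition with a vertices on one side, each of them has n - a
possible images and each other vertex has a. *)
Lemma total_weight_sum n : total_weight n p =
  \sum_(a < n.+1) 'C(n, a)%:R *
    (p ^+ a * (1 - p) ^+ (n - a) * (n - a)%:R ^+ a * a%:R ^+ (n - a)).
Proof.
rewrite -(sum_sets_by_card n (fun a =>
  p ^+ a * (1 - p) ^+ (n - a) * (n - a)%:R ^+ a * a%:R ^+ (n - a))) /total_weight.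
rewrite (eq_bigl (fun x => xpredT x.1 && bipartite x.1 x.2)) //.
rewrite -(pair_big_dep xpredT (fun S f => bipartite S f)
  (fun S f => mapping_weight p S)) /=.
apply: eq_bigr => S _; rewrite sumr_const.
have -> : (n - #|S|)%N = #|~: S| by have := cardsC S; rewrite card_ord; lia.
rewrite (_ : #|_| = #|[set f : {ffun 'I_n -> 'I_n} | bipartite S f]|); last first.
  by rewrite cardsE.
by rewrite card_bipartite -[LHS]mulr_natr natrM !natrX /mapping_weight; ring.
Qed.

Lemma mapping_meanE n (h : seq nat -> R) :
  mapping_mean p (fun f : {ffun 'I_n -> 'I_n} => h (component_sizes f)) =
  mapping_total n h / total_weight n p.
Proof.
by rewrite /mapping_mean /mapping_total big_distrl /=; apply: eq_bigr => x _; ring.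
Qed.

End WeightedSums.

Local Open Scope classical_set_scope.

(** * Limits of sequences *)

Lemma cvg_natV0 (R : realType) : n%:R^-1 @[n --> \oo] --> (0 : R).
Proof.
by apply/gtr0_cvgV0; [near=> n; rewrite ltr0n; near: n; exists 1%N|exact: cvgr_idn].
Unshelve. all: end_near. Qed.

Lemma cvg_sqrt_natV (R : realType) : (Num.sqrt n%:R)^-1 @[n --> \oo] --> (0 : R).
Proof.
have h : (fun n => Num.sqrt (n%:R^-1) : R) @ \oo --> (0 : R).
  rewrite -(sqrtr0 R); apply: continuous_cvg; first exact: sqrt_continuous.
  exact: cvg_natV0.
by apply: cvg_trans h; apply: near_eq_cvg; near=> n; rewrite sqrtrV ?ler0n.
Unshelve. all: end_near. Qed.

Lemma cvg_nat_of_ratio (R : realType) (u : nat -> nat) (c : R) : 0 < c ->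
  (u n)%:R / n%:R @[n --> \oo] --> c -> u n @[n --> \oo] --> \oo.
Proof.
move=> c0 h; apply/cvgnyPge => A.
have c2 : c / 2 < c by lra.
have [N _ hN] : \forall n \near \oo, A%:R / (c / 2) <= n%:R :> R.
  exact: nbhs_infty_ger.
near=> n; have n0 : (0 < n)%N by near: n; exists 1%N.
have h1 : c / 2 < (u n)%:R / n%:R by near: n; move/cvgr_gt: h; exact.
have h2 : A%:R / (c / 2) <= n%:R :> R by apply: hN; near: n; exists N.
rewrite -(ler_nat R); move: h1 h2.
rewrite ltr_pdivlMr ?ltr0n // ler_pdivrMr; last by lra.
by rewrite mulrC => h1 h2; apply: le_trans h2 (ltW h1).
Unshelve. all: end_near. Qed.

Lemma cvg_sum_seq (R : realType) (I : Type) (r : seq I) (f : I -> nat -> R) (l : I -> R) :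
  (forall k, f k n @[n --> \oo] --> l k) ->
  \sum_(k <- r) f k n @[n --> \oo] --> \sum_(k <- r) l k.
Proof.
move=> h; elim: r => [|k r IH].
  by under eq_fun do rewrite big_nil; rewrite big_nil; exact: cvg_cst.
under eq_fun do rewrite big_cons.
by rewrite big_cons; apply: cvgD (h k) IH.
Qed.

Lemma cvgn_bounded (R : realType) (u : nat -> R) (l : R) :
  u n @[n --> \oo] --> l -> exists2 B : R, 0 < B & forall n, `|u n| <= B.
Proof.
move=> ul; have [M [_ hM]] : bounded_fun u by apply: cvg_seq_bounded; apply/cvg_ex; exists l.
exists (`|M| + 1) => [|n]; first by rewrite ltr_wpDl.
by apply: hM => //; apply: (le_lt_trans (ler_norm _)); rewrite ltrDl.
Qed.

(** Regular summation methods map null sequences to null sequences.  All the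
passages to the limit in convolutions below are instances of this. *)
Lemma toeplitz_cvg0 (R : realType) (w : nat -> nat -> R) (eps : nat -> R) (K : R) :
  (forall n k, (k <= n)%N -> 0 <= w n k) ->
  (forall n, \sum_(k < n.+1) w n k <= K) ->
  (forall k, w n k @[n --> \oo] --> 0) -> eps n @[n --> \oo] --> 0 ->
  \sum_(k < n.+1) w n k * eps k @[n --> \oo] --> 0.
Proof.
move=> w0 wK wc epsc; apply/cvgr0Pnorm_le => e e0.
have K0 : 0 <= K by apply: le_trans (wK 0%N); apply: sumr_ge0 => k _; rewrite w0 // -ltnS.
have e'0 : 0 < e / (2 * (K + 1)) by rewrite divr_gt0 // mulr_gt0 // ltr_wpDl.
have /cvgr0Pnorm_le /(_ _ e'0) [N _ hN] := epsc.
have fin : \sum_(k < N) w n k * eps k @[n --> \oo] --> 0.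
  have h (k : 'I_N) : w n k * eps k @[n --> \oo] --> (0 : R).
    by rewrite -[0](mul0r (eps k)); apply: cvgMl; exact: wc.
  have := @cvg_sum_seq R _ (index_enum _) (fun (k : 'I_N) n => w n k * eps k) (fun=> 0) h.
  by rewrite [X in _ --> X -> _]big1.
have e2 : 0 < e / 2 by rewrite divr_gt0.
move/cvgr0Pnorm_le: fin => /(_ _ e2) fin.
near=> n.
have nN : (N <= n.+1)%N by near: n; exists N => // k /= /leqW.
rewrite -(big_mkord xpredT (fun k => w n k * eps k)) (big_cat_nat (leq0n N) nN) //= big_mkord.
rewrite (splitr e); apply: le_trans (ler_normD _ _) _; apply: lerD; first by near: n.
apply: le_trans (ler_norm_sum _ _ _) _.
apply: (@le_trans _ _ (\sum_(N <= k < n.+1) w n k * (e / (2 * (K + 1))))).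
  rewrite big_nat [leRHS]big_nat; apply: ler_sum => k /andP[Nk kn].
  by rewrite normrM ger0_norm ?ler_wpM2l ?w0 //; apply: hN.
rewrite -big_distrl /=.
apply: (@le_trans _ _ (K * (e / (2 * (K + 1))))).
  rewrite ler_pM2r //; apply: le_trans (wK n).
  rewrite -(big_mkord xpredT (w n)) (big_cat_nat (leq0n N) nN) //= lerDr big_nat.
  apply: sumr_ge0 => k /andP[_ kN]; rewrite w0 // -ltnS.
  exact: leq_trans nN.
rewrite mulrA ler_pdivrMr; last by lra.
have -> : e / 2 * (2 * (K + 1)) = K * e + e by field.
by rewrite lerDl ltW.
Unshelve. all: end_near. Qed.

(** * Stirling's formula *)

Section DerivativeTests.
Variable R : realType.
Implicit Types (f df ddf : R -> R) (a b t x : R).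

Lemma ge0_of_derive_ge0 f df : f 0 = 0 ->
  (forall x, 0 <= x -> is_derive x 1 f (df x)) ->
  (forall x, 0 <= x -> 0 <= df x) -> forall x, 0 <= x -> 0 <= f x.
Proof.
move=> f0 fd df0 x x0.
have [||c] := @MVT_segment _ f df 0 x x0.
- by move=> y; rewrite in_itv /= => /andP[/ltW y0 _]; exact: fd.
- apply: derivable_within_continuous => y.
  by rewrite in_itv /= => /andP[y0 _]; have := fd _ y0 => -[].
rewrite in_itv /= => /andP[c0 _]; rewrite f0 !subr0 => ->.
by rewrite mulr_ge0 // df0.
Qed.

Lemma le_max_of_concave f df ddf a b t :
  (forall x, a < x < b -> is_derive x 1 f (df x)) ->
  (forall x, a < x < b -> is_derive x 1 df (ddf x)) ->
  (forall x, a < x < b -> ddf x <= 0) ->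
  a < t < b -> df t = 0 -> forall x, a < x < b -> f x <= f t.
Proof.
move=> fd dfd ddf0 /andP[at_ tb] dft x /andP[ax xb].
have MV (g dg : R -> R) u v : (forall x, a < x < b -> is_derive x 1 g (dg x)) ->
    a < u -> u <= v -> v < b -> exists2 c, u <= c <= v & g v - g u = dg c * (v - u).
  move=> gd au uv vb; have [||c] := @MVT_segment _ g dg u v uv.
  - move=> y; rewrite in_itv /= => /andP[uy yv]; apply: gd.
    by rewrite (lt_trans au uy) (lt_trans yv vb).
  - apply: derivable_within_continuous => y; rewrite in_itv /= => /andP[uy yv].
    by have := gd y; rewrite (lt_le_trans au uy) (le_lt_trans yv vb) => /(_ isT) [].
  by rewrite in_itv /= => uc e; exists c.
have [xt|/ltW tx] := leP x t.
  have [c /andP[xc ct] e] := MV f df x t fd ax xt tb.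
  have [e' /andP[ce et] e''] := MV df ddf c t dfd (lt_le_trans ax xc) ct tb.
  have := ddf0 e'; rewrite (lt_le_trans (lt_le_trans ax xc) ce) (le_lt_trans et tb).
  move=> /(_ isT) n0; rewrite -subr_ge0 e mulr_ge0 ?subr_ge0 //.
  by rewrite -oppr_le0 -[- _]sub0r -{1}dft e'' mulr_le0_ge0 // subr_ge0.
have [c /andP[tc cx] e] := MV f df t x fd at_ tx xb.
have [e' /andP[te ec] e''] := MV df ddf t c dfd at_ tc (le_lt_trans cx xb).
have := ddf0 e'; rewrite (lt_le_trans at_ te) (le_lt_trans (le_trans ec cx) xb).
move=> /(_ isT) n0; rewrite -subr_le0 e mulr_le0_ge0 ?subr_ge0 //.
by rewrite -[df c]subr0 -{1}dft e'' mulr_le0_ge0 // subr_ge0.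
Qed.

(** The lower bound is sharp enough for (x^-1 + 1/2) ln(1 + x) to be at least 1,
which makes [stirling_log] nonincreasing; a bound from the truncated series
x - x^2/2 would fail. *)
Lemma ln1p_ge x : 0 <= x -> 2 * x / (2 + x) <= ln (1 + x).
Proof.
move=> x0; rewrite -subr_ge0.
apply: (@ge0_of_derive_ge0 (fun x => ln (1 + x) - 2 * x / (2 + x))
  (fun x => (1 + x)^-1 - 4 / (2 + x) ^+ 2) _ _ _ _ x0).
- by rewrite addr0 ln1 mulr0 mul0r subr0.
- move=> y y0.
  have p1 : 0 < 1 + y by lra.
  have h : (2 + y) != 0 by rewrite gt_eqF //; lra.
  have d1 := is_derive1_ln p1.
  apply: is_derive_eq; rewrite /GRing.scale /=.
  by field; rewrite h gt_eqF.
- move=> y y0; rewrite subr_ge0 ler_pdivrMr; last by nra.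
  by rewrite ler_pdivlMl; nra.
Qed.

Lemma ln1p_le x : 0 <= x -> ln (1 + x) <= x - x ^+ 2 / 2 + x ^+ 3 / 3.
Proof.
move=> x0; rewrite -subr_ge0.
apply: (@ge0_of_derive_ge0 (fun x => x - x ^+ 2 / 2 + x ^+ 3 / 3 - ln (1 + x))
  (fun x => x ^+ 3 / (1 + x)) _ _ _ _ x0).
- by rewrite addr0 ln1 !expr0n /=; ring.
- move=> y y0.
  have p1 : 0 < 1 + y by lra.
  have d1 := is_derive1_ln p1.
  apply: is_derive_eq; rewrite /GRing.scale /=.
  by field; rewrite gt_eqF.
- by move=> y y0; rewrite divr_ge0 ?exprn_ge0 //; lra.
Qed.

End DerivativeTests.

Section Stirling.
Variable R : realType.

(** The logarithm of n! / (sqrt n (n/e)^n).  Only its convergence matters: the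
value of the limit, ln sqrt(2 pi), disappears in the final constant. *)
Definition stirling_log n : R :=
  ln n`!%:R - (n%:R + 2^-1) * ln n%:R + n%:R.

Lemma stirling_logE n :
  ln n`!%:R = stirling_log n + (n%:R + 2^-1) * ln n%:R - n%:R.
Proof. by rewrite /stirling_log; ring. Qed.

Lemma stirling_log_step n : (0 < n)%N ->
  stirling_log n - stirling_log n.+1 = (n%:R + 2^-1) * ln (1 + n%:R^-1) - 1.
Proof.
move=> n0; have n0R : (0 : R) < n%:R by rewrite ltr0n.
have -> : 1 + n%:R^-1 = n.+1%:R / n%:R :> R.
  by rewrite -natr1; field; rewrite gt_eqF.
rewrite ln_div ?posrE ?ltr0n // /stirling_log factS natrM lnM ?posrE ?ltr0n ?fact_gt0 //.
by rewrite -natr1; field.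
Qed.

(** The upper bound telescopes, so the decreasing sequence [stirling_log] is
bounded below. *)
Lemma stirling_step_bounds (N : R) : 1 <= N ->
  0 <= (N + 2^-1) * ln (1 + N^-1) - 1 <= 2^-1 * (N^-1 - (N + 1)^-1).
Proof.
move=> N1; have h0 : 0 <= N^-1 by rewrite invr_ge0; lra.
have N0 : N != 0 by rewrite gt_eqF //; lra.
have M0 : N + 1 != 0 by rewrite gt_eqF //; lra.
apply/andP; split.
  have := ln1p_ge h0; have -> : 2 * N^-1 / (2 + N^-1) = (N + 2^-1)^-1.
    by field; repeat (apply/andP; split); rewrite ?gt_eqF //; lra.
  rewrite -[_^-1]mul1r ler_pdivrMr; lra.
have := ln1p_le h0 => /(ler_wpM2l (_ : 0 <= N + 2^-1)) => /(_ ltac:(lra)) h.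
rewrite lerBlDl (le_trans h) // -subr_ge0.
have -> : 1 + 2^-1 * (N^-1 - (N + 1)^-1) -
   (N + 2^-1) * (N^-1 - N^-1 ^+ 2 / 2 + N^-1 ^+ 3 / 3) =
   ((N - 1) * (5 * N + 2)) / (12 * N ^+ 3 * (N + 1)).
  by field; rewrite N0 M0.
apply: divr_ge0; first by rewrite mulr_ge0 //; lra.
by rewrite !mulr_ge0 ?exprn_ge0 //; lra.
Qed.

Lemma stirling_log_cvg : exists s : R,
  stirling_log n @[n --> \oo] --> s /\ forall n, (0 < n)%N -> s <= stirling_log n.
Proof.
have step n : 0 <= stirling_log n.+1 - stirling_log n.+2 <=
    2^-1 * (n.+1%:R^-1 - n.+2%:R^-1).
  by rewrite stirling_log_step // -[n.+2%:R]natr1 stirling_step_bounds // ler1n.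
have lb n : stirling_log 1 - 2^-1 + 2^-1 * n.+1%:R^-1 <= stirling_log n.+1.
  elim: n => [|n IH]; first by rewrite invr1; lra.
  have /andP[_] := step n; move: IH.
  by move: (stirling_log n.+1) (stirling_log n.+2) (n.+1%:R^-1) (n.+2%:R^-1) => a b u v; lra.
have ni : nonincreasing_seq (fun n => stirling_log n.+1).
  apply/nonincreasing_seqP => n.
  by have /andP[+ _] := step n; rewrite subr_ge0.
have cv : cvgn (fun n => stirling_log n.+1 : R).
  apply: nonincreasing_is_cvgn => //.
  exists (stirling_log 1 - 2^-1) => _ [n _ <-]; apply: le_trans (lb n).
  by rewrite lerDl mulr_ge0 ?invr_ge0 ?ler0n.
exists (limn (fun n => stirling_log n.+1)); split.
  by rewrite -cvg_shiftS.
by case=> // n _; exact: nonincreasing_cvgn_ge.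
Qed.

End Stirling.

(** * The rate function and its maximum *)

Section Saddle.
Variables (R : realType) (p : R).

(** By Stirling, (1/n) ln of p^(xn) (1-p)^((1-x)n) ((1-x)n)^(xn) (xn)^((1-x)n)
over (xn)! ((1-x)n)! tends to rate x + 1. *)
Definition rate (a : R) : R :=
  a * ln p + (1 - a) * ln (1 - p) + (1 - 2 * a) * (ln a - ln (1 - a)).

Definition drate (a : R) : R :=
  ln p - ln (1 - p) - 2 * (ln a - ln (1 - a)) + (a^-1 - (1 - a)^-1).

Definition curvature (a : R) : R := (a^-1 + (1 - a)^-1) ^+ 2.

Lemma is_derive_logit (a : R) : 0 < a < 1 ->
  is_derive a 1 (fun a => ln a - ln (1 - a)) (a^-1 + (1 - a)^-1).
Proof.
move=> /andP[a0 a1]; have b0 : 0 < 1 - a by lra.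
have d1 := is_derive1_ln a0; have d2 := is_derive1_ln b0.
by apply: is_derive_eq; rewrite /GRing.scale /=; ring.
Qed.

Lemma is_derive_rate (a : R) : 0 < a < 1 -> is_derive a 1 rate (drate a).
Proof.
move=> a01; have d := is_derive_logit a01; move/andP: a01 => [a0 a1].
rewrite /rate; apply: is_derive_eq; rewrite /GRing.scale /= /drate.
have a0' : a != 0 by rewrite gt_eqF.
have b0 : 1 - a != 0 by rewrite gt_eqF //; lra.
by field; rewrite a0' b0.
Qed.

Lemma is_derive_drate (a : R) : 0 < a < 1 ->
  is_derive a 1 drate (- curvature a).
Proof.
move=> a01; have d := is_derive_logit a01; move/andP: a01 => [a0 a1].
have a0' : a != 0 by rewrite gt_eqF.
have b0 : 1 - a != 0 by rewrite gt_eqF //; lra.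
have d1 : is_derive a 1 (fun x => x^-1) (- a ^- 2).
  by have := is_deriveV a0' (is_derive_id a 1); rewrite /GRing.scale /= mulr1.
have d2 : is_derive a 1 (fun x => (1 - x)^-1) ((1 - a) ^- 2).
  have d3 : is_derive a 1 (fun x : R => 1 - x) (-1).
    by apply: is_derive_eq; rewrite /GRing.scale /=; ring.
  have := is_deriveV (f := fun x : R => 1 - x) b0 d3; rewrite /GRing.scale /= => d4.
  by apply: is_derive_eq; ring.
rewrite /drate; apply: is_derive_eq; rewrite /GRing.scale /= /curvature.
by field; rewrite a0' b0.
Qed.

(** The terms 1/a - 1/(1-a) dominate the constant ln p - ln (1-p) near the ends:
with a = 1/(3 + |l|) the derivative is nonnegative at a and nonpositive at
1 - a. *)
Lemma saddle_exists : exists t : R, 0 < t < 1 /\ drate t = 0.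
Proof.
set l := ln p - ln (1 - p).
pose e : R := (3 + `|l|)^-1.
have l0 : 0 <= `|l| by [].
have e0 : 0 < e by rewrite invr_gt0; lra.
have e3 : e <= 3^-1 by rewrite lef_pV2 ?posrE; lra.
have cont : {within `[e, 1 - e], continuous drate}.
  apply: derivable_within_continuous => x; rewrite in_itv /= => /andP[ex xe].
  have : 0 < x < 1 by apply/andP; split; lra.
  by move=> /is_derive_drate [].
have logit1 : ln e - ln (1 - e) <= 0.
  by rewrite subr_le0 ler_ln ?posrE; lra.
have eV : e^-1 = 3 + `|l| by rewrite invrK.
have e1 : (1 - e)^-1 <= 2.
  by rewrite invf_ple ?posrE; lra.
have de : 0 <= drate e.
  rewrite /drate -/l eV; have := ler_norm (- l); rewrite normrN => h; lra.
have de1 : drate (1 - e) <= 0.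
  have ee : 1 - (1 - e) = e by ring.
  rewrite /drate -/l ee eV; have := ler_norm l => h; lra.
have [||t] := @IVT _ drate e (1 - e) 0 _ cont.
- lra.
- by rewrite ge_min le_max de1 de !orbT.
rewrite in_itv /= => /andP[et te] dt; exists t; split => //; apply/andP; split; lra.
Qed.

Section AtSaddle.
Variable t : R.
Hypotheses (t01 : 0 < t < 1) (dt : drate t = 0).

(** Since a (1 - a) <= 1/4, the curvature (a (1 - a))^-2 is at least 16, uniformly
up to the ends of the interval; this gives the global quadratic bound
[rate_le]. *)
Lemma curvature_ge (a : R) : 0 < a < 1 -> 16 <= curvature a.
Proof.
move=> /andP[a0 a1]; have b0 : 0 < 1 - a by lra.
have -> : curvature a = (a * (1 - a)) ^- 2.
  by rewrite /curvature; field; rewrite !gt_eqF.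
have h0 : 0 < a * (1 - a) by rewrite mulr_gt0.
have h : a * (1 - a) <= 4^-1 by have := sqr_ge0 (a - 2^-1); nra.
by rewrite -[16]invrK lef_pV2 ?posrE ?exprn_gt0 ?invr_gt0 //; nra.
Qed.

Lemma curvature_cont : {for t, continuous curvature}.
Proof.
move/andP: t01 => [t0 t1].
rewrite /curvature; apply: continuousM => /=; apply: continuousD.
- by apply: continuousV; [rewrite gt_eqF|exact: cvg_id].
- apply: continuousV; first by rewrite gt_eqF //; lra.
  by apply: continuousB; [exact: cvg_cst|exact: cvg_id].
- by apply: continuousV; [rewrite gt_eqF|exact: cvg_id].
- apply: continuousV; first by rewrite gt_eqF //; lra.
  by apply: continuousB; [exact: cvg_cst|exact: cvg_id].
Qed.

Let is_derive_quad (c a : R) :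
  is_derive a 1 (fun x => c * (x - t) ^+ 2) (c * 2 * (a - t)).
Proof. by apply: is_derive_eq; rewrite /GRing.scale /= ; ring. Qed.

Let is_derive_lin (c a : R) :
  is_derive a 1 (fun x => c * 2 * (x - t)) (c * 2).
Proof. by apply: is_derive_eq; rewrite /GRing.scale /= ; ring. Qed.

(** Where the curvature is at least m, the sum of the rate and of a parabola of
curvature m is concave, with critical point t. *)
Lemma rate_quad_le (m u v : R) : 0 <= u -> v <= 1 -> u < t < v ->
  (forall x, u < x < v -> m <= curvature x) ->
  forall x, u < x < v -> rate x - rate t <= - (m / 2) * (x - t) ^+ 2.
Proof.
move=> u0 v1 utv hm x uxv.
have in01 y : u < y < v -> 0 < y < 1.
  by move=> /andP[uy yv]; rewrite (le_lt_trans u0 uy) (lt_le_trans yv v1).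
have := @le_max_of_concave _ (fun x => rate x + m / 2 * (x - t) ^+ 2)
  (fun x => drate x + m / 2 * 2 * (x - t)) (fun x => - curvature x + m / 2 * 2)
  u v t.
move=> /(_ _ _ _ utv _ x uxv) h.
have : rate x + m / 2 * (x - t) ^+ 2 <= rate t + m / 2 * (t - t) ^+ 2.
  apply: h.
  - by move=> y /in01 /is_derive_rate d; apply: is_deriveD.
  - by move=> y /in01 /is_derive_drate d; apply: is_deriveD.
  - by move=> y /hm; lra.
  - by rewrite dt subrr mulr0 addr0.
by rewrite subrr expr0n /= mulr0 addr0; lra.
Qed.

Lemma rate_quad_ge (m u v : R) : 0 <= u -> v <= 1 -> u < t < v ->
  (forall x, u < x < v -> curvature x <= m) ->
  forall x, u < x < v -> - (m / 2) * (x - t) ^+ 2 <= rate x - rate t.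
Proof.
move=> u0 v1 utv hm x uxv.
have in01 y : u < y < v -> 0 < y < 1.
  by move=> /andP[uy yv]; rewrite (le_lt_trans u0 uy) (lt_le_trans yv v1).
have := @le_max_of_concave _ (fun x => - rate x - m / 2 * (x - t) ^+ 2)
  (fun x => - drate x - m / 2 * 2 * (x - t)) (fun x => curvature x - m / 2 * 2)
  u v t.
move=> /(_ _ _ _ utv _ x uxv) h.
have : - rate x - m / 2 * (x - t) ^+ 2 <= - rate t - m / 2 * (t - t) ^+ 2.
  apply: h.
  - by move=> y /in01 /is_derive_rate d; apply: is_deriveB.
  - move=> y /in01 /is_derive_drate d; apply: is_derive_eq; rewrite /GRing.scale /=; ring.
  - by move=> y /hm; lra.
  - by rewrite dt subrr mulr0 oppr0 addr0.
by rewrite subrr expr0n /= mulr0 subr0; lra.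
Qed.

Lemma rate_le (a : R) : 0 < a < 1 -> rate a - rate t <= - 8 * (a - t) ^+ 2.
Proof.
move=> a01; have := @rate_quad_le 16 0 1 (lexx _) (lexx _) t01 curvature_ge a a01.
by lra.
Qed.

Lemma rate_taylor (e : R) : 0 < e -> exists2 d, 0 < d &
  forall a, `|a - t| < d ->
    `|rate a - rate t + curvature t / 2 * (a - t) ^+ 2| <= e * (a - t) ^+ 2.
Proof.
move=> e0; have /cvgrPdist_le /(_ _ e0) /nbhs_ballP[d /= d0 hd] := curvature_cont.
move/andP: (t01) => [t0 t1].
pose r := Num.min d (Num.min t (1 - t)).
have r0 : 0 < r by rewrite !lt_min d0 t0 /=; lra.
have [rd [rt r1t]] : r <= d /\ r <= t /\ r <= 1 - t.
  by rewrite /r !ge_min !lexx !orbT.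
exists r => // a; rewrite ltr_norml => /andP[a1 a2].
have ain : t - r < a < t + r by apply/andP; split; lra.
have hc x : t - r < x < t + r -> `|curvature t - curvature x| <= e.
  by move=> /andP[x1 x2]; apply: hd; rewrite /ball /= ltr_norml; apply/andP; split; lra.
have tin : t - r < t < t + r by apply/andP; split; lra.
rewrite ler_norml; apply/andP; split.
  have := @rate_quad_ge (curvature t + e) (t - r) (t + r) ltac:(lra) ltac:(lra) tin.
  move=> /(_ _ _ ain) h; have {}h := h ltac:(by move=> x /hc; rewrite ler_norml; lra).
  by have := sqr_ge0 (a - t); nra.
have := @rate_quad_le (curvature t - e) (t - r) (t + r) ltac:(lra) ltac:(lra) tin.
move=> /(_ _ _ ain) h; have {}h := h ltac:(by move=> x /hc; rewrite ler_norml; lra).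
by have := sqr_ge0 (a - t); nra.
Qed.

End AtSaddle.
End Saddle.

(** * Laplace's method for the total weight *)

Section Laplace.
Variables (R : realType) (p : R).
Hypotheses (p_gt0 : 0 < p) (p_lt1 : p < 1).
Variable t : R.
Hypotheses (t01 : 0 < t < 1) (dt : drate p t = 0).

(** e^(- growth) is the dominant singularity of the generating functions. *)
Definition growth : R := rate p t + 1.

Definition scaled_weight n : R :=
  total_weight n p / n`!%:R * expR (- (growth * n%:R)).

(** n times the a-th summand of [scaled_weight n], with the factorials expressed
through [stirling_log]; this is where the saddle appears. *)
Definition peak n a : R :=
  expR (n%:R * (rate p (a%:R / n%:R) - rate p t) - stirling_log R a
        - stirling_log R (n - a) - (ln (a%:R / n%:R) + ln (1 - a%:R / n%:R)) / 2).

Let expX (x : R) k : 0 < x -> x ^+ k = expR (k%:R * ln x).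
Proof. by move=> x0; rewrite expRM_natl lnK. Qed.

Let factE k : (0 < k)%N ->
  k`!%:R = expR (stirling_log R k + (k%:R + 2^-1) * ln k%:R - k%:R) :> R.
Proof. by move=> k0; rewrite -stirling_logE lnK // posrE ltr0n fact_gt0. Qed.

Lemma peakE n a : (0 < a < n)%N ->
  'C(n, a)%:R * (p ^+ a * (1 - p) ^+ (n - a) * (n - a)%:R ^+ a * a%:R ^+ (n - a))
    / n`!%:R * expR (- (growth * n%:R)) = peak n a / n%:R.
Proof.
move=> /andP[a0 an]; have n0 : (0 < n)%N by exact: ltn_trans an.
have b0 : (0 < n - a)%N by rewrite subn_gt0.
have q0 : 0 < 1 - p by rewrite subr_gt0.
have aR : 0 < a%:R :> R by rewrite ltr0n.
have bR : 0 < (n - a)%:R :> R by rewrite ltr0n.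
have nR : 0 < n%:R :> R by rewrite ltr0n.
have nE : n%:R = a%:R + (n - a)%:R :> R by rewrite -natrD subnKC // ltnW.
have -> : 'C(n, a)%:R * (p ^+ a * (1 - p) ^+ (n - a) * (n - a)%:R ^+ a * a%:R ^+ (n - a))
    / n`!%:R = (p ^+ a * (1 - p) ^+ (n - a) * (n - a)%:R ^+ a * a%:R ^+ (n - a))
    / (a`!%:R * (n - a)`!%:R) :> R.
  have := bin_fact (ltnW an) => /(congr1 (fun k => k%:R : R)); rewrite !natrM => <-.
  by field; rewrite !pnatr_eq0 -!lt0n !fact_gt0 bin_gt0 (ltnW an).
rewrite !expX // !factE // -!expRD -expRN -!expRD.
rewrite -[X in _ = _ / X](lnK nR) -expRN /peak -expRD; congr expR.
have e1 : 1 - a%:R / n%:R = (n - a)%:R / n%:R :> R.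
  by rewrite nE; field; rewrite -nE gt_eqF.
have -> : rate p (a%:R / n%:R) = (a%:R * ln p + (n - a)%:R * ln (1 - p) +
   ((n - a)%:R - a%:R) * (ln a%:R - ln (n - a)%:R)) / n%:R.
  rewrite /rate e1 !ln_div ?posrE // nE; field; by rewrite -nE gt_eqF.
rewrite e1 !ln_div ?posrE // /growth.
move: (ln n%:R) (ln (n - a)%:R) (ln a%:R) => L1 L2 L3.
by rewrite nE; field; rewrite -nE gt_eqF.
Qed.

Lemma scaled_weightE n : (0 < n)%N ->
  Num.sqrt n%:R * scaled_weight n = \sum_(1 <= a < n) peak n a / Num.sqrt n%:R.
Proof.
move=> n0; have nR : 0 < n%:R :> R by rewrite ltr0n.
rewrite /scaled_weight total_weight_sum.
pose F a : R := 'C(n, a)%:R *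
  (p ^+ a * (1 - p) ^+ (n - a) * (n - a)%:R ^+ a * a%:R ^+ (n - a)).
have F0 : F 0%N = 0 by rewrite /F subn0 [0 ^+ n]expr0n (gtn_eqF n0) !mulr0.
have Fn : F n = 0 by rewrite /F subnn [0 ^+ n]expr0n (gtn_eqF n0) mulr0 mul0r mulr0.
rewrite -(big_mkord xpredT F) big_nat_recr //= big_ltn //= F0 Fn.
rewrite addr0 add0r big_distrl /= big_distrl /= big_distrr /=.
apply: eq_big_nat => a ha; rewrite peakE //.
rewrite mulrCA; congr (_ * _).
have s0 : 0 < Num.sqrt n%:R :> R by rewrite sqrtr_gt0.
rewrite -{2}(sqr_sqrtr (ler0n R n)); move: (Num.sqrt _) s0 => r r0.
by field; rewrite gt_eqF.
Qed.

(** Near the ends of the range the factor (x (1-x))^(-1/2) of [peak] is unbounded,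
but at most polynomial in n, and there the distance to the saddle is bounded
below: part of the Gaussian decay absorbs it. *)
Lemma neg_ln_frac_le (u : R) : 0 < u < 1 -> exists C : R,
  forall n a, (0 < a <= n)%N -> - ln (a%:R / n%:R) <= C + 4 * (n%:R * (a%:R / n%:R - u) ^+ 2).
Proof.
move=> /andP[u0 u1].
have lnu : ln u <= 0 by apply: ln_le0; exact: ltW.
have u2 : 0 < u / 2 by lra.
have lnu2 : ln (u / 2) <= 0 by apply: ln_le0; lra.
exists (- ln (u / 2) - 2 * ln u) => n a /andP[a0 an].
have nR : 0 < n%:R :> R by rewrite ltr0n (leq_trans a0).
have aR : 1 <= a%:R :> R by rewrite ler1n.
have x0 : 0 < a%:R / n%:R :> R by rewrite divr_gt0 // ltr0n.
set x := a%:R / n%:R in x0 *.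
have q0 : 0 <= n%:R * (x - u) ^+ 2 by rewrite mulr_ge0 ?sqr_ge0 ?ler0n.
have [ux|xu] := leP (u / 2) x.
  have : ln (u / 2) <= ln x by rewrite ler_ln ?posrE.
  by lra.
have lx : - ln n%:R <= ln x.
  rewrite -lnV ?posrE // ler_ln ?posrE ?invr_gt0 //.
  by rewrite -[_^-1]mul1r ler_pM2r ?invr_gt0.
have := @ln_sublinear R (n%:R * u ^+ 2) ltac:(by rewrite mulr_gt0 ?exprn_gt0).
rewrite lnM ?posrE ?exprn_gt0 // lnXn // mulr2n => h.
have : n%:R * u ^+ 2 <= 4 * (n%:R * (x - u) ^+ 2).
  have -> : 4 * (n%:R * (x - u) ^+ 2) = n%:R * (2 * (u - x)) ^+ 2 by ring.
  by rewrite ler_pM2l // ler_sqr ?nnegrE; lra.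
by lra.
Qed.

(** Half of the decay -8 n (x - t)^2 granted by [rate_le] pays for the two
logarithms of [neg_ln_frac_le]. *)
Lemma peak_le : exists2 C : R, 0 < C & forall n a, (0 < a < n)%N ->
  peak n a <= C * expR (- 4 * (n%:R * (a%:R / n%:R - t) ^+ 2)).
Proof.
have [s [_ hs]] := stirling_log_cvg R.
have [C1 h1] := neg_ln_frac_le t01.
have t01' : 0 < 1 - t < 1 by move/andP: t01 => [? ?]; apply/andP; split; lra.
have [C2 h2] := neg_ln_frac_le t01'.
exists (expR (- s - s + (C1 + C2) / 2)); first exact: expR_gt0.
move=> n a /andP[a0 an]; rewrite /peak -expRD ler_expR.
have nR : 0 < n%:R :> R by rewrite ltr0n (ltn_trans a0).
have b0 : (0 < n - a)%N by rewrite subn_gt0.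
have := hs a a0; have := hs (n - a)%N b0.
have := h1 n a; rewrite a0 ltnW // => /(_ isT).
have := h2 n (n - a)%N; rewrite b0 leq_subr => /(_ isT).
have -> : (n - a)%:R / n%:R = 1 - a%:R / n%:R :> R.
  by rewrite natrB 1?ltnW //; field; rewrite gt_eqF.
have -> : 1 - a%:R / n%:R - (1 - t) = - (a%:R / n%:R - t) by ring.
rewrite sqrrN.
have x01 : 0 < (a%:R / n%:R : R) < 1.
  apply/andP; split; last by rewrite ltr_pdivrMr // mul1r ltr_nat.
  by rewrite divr_gt0 // ltr0n.
have := rate_le t01 dt x01; rewrite -(ler_pM2l nR).
set x := a%:R / n%:R; move: (stirling_log R a) (stirling_log R (n - a)).
move: (ln x) (ln (1 - x)) => *; lra.
Qed.

End Laplace.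

Section LaplaceLimit.
Variables (R : realType) (p : R).
Hypotheses (p_gt0 : 0 < p) (p_lt1 : p < 1).
Variable t : R.
Hypotheses (t01 : 0 < t < 1) (dt : drate p t = 0).

Notation peak := (peak p t).
Notation mu := (@lebesgue_measure R).

(** In the variable (a - t n) / sqrt n the summands a and a+1 are 1/sqrt n apart,
so sqrt n times the sum becomes the integral of a step function. *)
Definition bar_start n a : R := (a%:R - t * n%:R) / Num.sqrt n%:R.

Definition bar n a : set R := `[bar_start n a, bar_start n a.+1[.

Definition histogram n x : R := \sum_(1 <= a < n) peak n a * \1_(bar n a) x.

Lemma bar_startS n a : (0 < n)%N -> bar_start n a.+1 = bar_start n a + (Num.sqrt n%:R)^-1.
Proof. by move=> n0; rewrite /bar_start -natr1; ring. Qed.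

Lemma bar_start_sqr n a : (0 < n)%N -> n%:R * (a%:R / n%:R - t) ^+ 2 = bar_start n a ^+ 2.
Proof.
move=> n0; have s0 : 0 < Num.sqrt n%:R :> R by rewrite sqrtr_gt0 ltr0n.
rewrite /bar_start; have e : n%:R = Num.sqrt n%:R ^+ 2 :> R by rewrite sqr_sqrtr.
by rewrite e; move: (Num.sqrt _) s0 => r r0; rewrite sqrtr_sqr ger0_norm ?(ltW r0) //;
   field; rewrite gt_eqF.
Qed.

Lemma measurable_bar n a : measurable (bar n a).
Proof. exact: measurable_itv. Qed.

Lemma bar_inj n a b x : (0 < n)%N -> bar n a x -> bar n b x -> a = b.
Proof.
move=> n0; have s0 : 0 < Num.sqrt n%:R :> R by rewrite sqrtr_gt0 ltr0n.
rewrite /bar /= !in_itv /= /bar_start !ler_pdivrMr // !ltr_pdivlMr // => /andP[h1 h2].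
move=> /andP[h3 h4].
have ab : a%:R < b.+1%:R :> R by lra.
have ba : b%:R < a.+1%:R :> R by lra.
by move: ab ba; rewrite !ltr_nat; lia.
Qed.

Lemma histogramE n m x : (0 < m < n)%N -> bar n m x -> histogram n x = peak n m.
Proof.
move=> mn cx; have n0 : (0 < n)%N by lia.
rewrite /histogram (bigD1_seq m) /= ?mem_index_iota ?iota_uniq //.
rewrite indicE mem_set // mulr1 big1 ?addr0 // => a am.
rewrite indicE memNset ?mulr0 // => ca.
by move: am; rewrite (bar_inj n0 cx ca) eqxx.
Qed.

Lemma histogram_out n x : (forall m, (0 < m < n)%N -> ~ bar n m x) -> histogram n x = 0.
Proof.
move=> h; rewrite /histogram big_nat big1 // => a /h ha.
by rewrite indicE memNset ?mulr0.
Qed.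

Lemma integral_histogram n : (0 < n)%N ->
  (\int[mu]_x (histogram n x)%:E = (Num.sqrt n%:R * scaled_weight p t n)%:E)%E.
Proof.
move=> n0; rewrite scaled_weightE //.
have s0 : 0 < Num.sqrt n%:R :> R by rewrite sqrtr_gt0 ltr0n.
transitivity (\int[mu]_x (\sum_(1 <= a < n) (peak n a)%:E * (\1_(bar n a) x)%:E))%E.
  by apply: eq_integral => x _; rewrite /histogram -sumEFin; apply: eq_bigr.
rewrite ge0_integral_sum //=; last first.
- by move=> a x _; rewrite -EFinM lee_fin mulr_ge0 // expR_ge0.
- move=> a; apply: emeasurable_funM => //; apply/measurable_EFinP.
  by apply: measurable_indic; exact: measurable_bar.
rewrite -sumEFin; apply: eq_bigr => a _.
rewrite ge0_integralZl //=; last first.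
- by rewrite lee_fin expR_ge0.
- by apply/measurable_EFinP; apply: measurable_indic; exact: measurable_bar.
rewrite integral_indic ?setIT //; last exact: measurable_bar.
rewrite EFinM; congr (_ * _)%E.
rewrite /bar; etransitivity; first exact: lebesgue_measure_itv.
rewrite /= lte_fin bar_startS //.
by rewrite ltrDl invr_gt0 s0 -EFinD addrAC subrr add0r.
Qed.

(** A bar has width at most 1, and (x - y)^2 <= 1 implies
-4 y^2 <= 2 - x^2; hence one Gaussian dominates all histograms. *)
Lemma histogram_le : exists2 C : R, 0 < C &
  forall n x, `|histogram n x| <= C * gauss_fun x.
Proof.
have [C C0 hC] := peak_le t01 dt.
exists (C * expR 2); first by rewrite mulr_gt0 ?expR_gt0.
move=> n x.
have rhs0 : 0 <= C * expR 2 * gauss_fun x.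
  by rewrite mulr_ge0 ?mulr_ge0 ?expR_ge0 // ltW.
have [[m [mn cx]]|h] := pselect (exists m, (0 < m < n)%N /\ bar n m x); last first.
  rewrite histogram_out ?normr0 // => m mn cx; by apply: h; exists m.
rewrite (histogramE mn cx) ger0_norm ?expR_ge0 //.
apply: (le_trans (hC n m mn)); rewrite -mulrA ler_pM2l // /gauss_fun -expRD ler_expR.
have n0 : (0 < n)%N by lia.
rewrite bar_start_sqr //; move: cx; rewrite /bar /= in_itv /= bar_startS // => /andP[h1 h2].
have : (Num.sqrt n%:R)^-1 <= 1 :> R.
  rewrite invf_le1 ?sqrtr_gt0 ?ltr0n // -[leLHS]sqrtr1 ler_wsqrtr // ler1n //.
move: (bar_start n m) (Num.sqrt n%:R)^-1 h1 h2 => y s h1 h2 s1.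
have d1 : (x - y) ^+ 2 <= 1 by rewrite -(expr1n _ 2) ler_sqr ?nnegrE; lra.
by have := sqr_ge0 (2 * y - x); have := sqr_ge0 y; nra.
Qed.

Section Pointwise.
Variable x : R.

(** The point x lies in the bar of index m n, the integer part of
t n + x sqrt n. *)
Let z n : R := t * n%:R + x * Num.sqrt n%:R.
Let m n : nat := Num.truncn (z n).
Let y n : R := bar_start n (m n).

Let sqrt_gt0 n : (0 < n)%N -> 0 < Num.sqrt n%:R :> R.
Proof. by move=> n0; rewrite sqrtr_gt0 ltr0n. Qed.

Let frac_cvg : z n / n%:R @[n --> \oo] --> t.
Proof.
have h : (t + x * (Num.sqrt n%:R)^-1) @[n --> \oo] --> t + x * 0.
  by apply: cvgD; [exact: cvg_cst|apply: cvgMr; exact: cvg_sqrt_natV].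
rewrite mulr0 addr0 in h; apply: cvg_trans h; apply: near_eq_cvg.
near=> n; have n0 : (0 < n)%N by near: n; exists 1%N.
have e : n%:R = Num.sqrt n%:R ^+ 2 :> R by rewrite sqr_sqrtr.
rewrite /z; move: (sqrt_gt0 n0); rewrite {3 5}e; move: (Num.sqrt _) => r r0.
by field; rewrite gt_eqF.
Unshelve. all: end_near. Qed.

Let z_ge0 : \forall n \near \oo, 0 <= z n.
Proof.
move/andP: t01 => [t0 _].
near=> n; have n0 : (0 < n)%N by near: n; exists 1%N.
have h : 0 < z n / n%:R by near: n; move/cvgr_gt: frac_cvg; exact.
by move: h; rewrite pmulr_lgt0 ?invr_gt0 ?ltr0n // => /ltW.
Unshelve. all: end_near. Qed.

Let y_near : \forall n \near \oo, `|y n - x| <= (Num.sqrt n%:R)^-1.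
Proof.
near=> n; have n0 : (0 < n)%N by near: n; exists 1%N.
have z0 : 0 <= z n by near: n; exact: z_ge0.
have /andP[h1 h2] := truncn_itv z0; rewrite -/(m n) in h1 h2.
have s0 := sqrt_gt0 n0; rewrite /y /bar_start -(ler_pM2r s0) mulVf ?gt_eqF //.
rewrite -[X in _ * X <= _](ger0_norm (ltW s0)) -normrM mulrBl divfK ?gt_eqF //.
by rewrite -natr1 /z in h1 h2; rewrite ler_norml; apply/andP; split; lra.
Unshelve. all: end_near. Qed.

Let y_cvg : y n @[n --> \oo] --> x.
Proof.
apply/cvgrPdist_le => e e0; near=> n; rewrite distrC.
apply: (@le_trans _ _ (Num.sqrt n%:R)^-1); first by near: n; exact: y_near.
near: n; have /cvgrPdist_le /(_ _ e0) := @cvg_sqrt_natV R.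
by apply: filterS => n; rewrite sub0r normrN ger0_norm ?invr_ge0.
Unshelve. all: end_near. Qed.

Let frac_m : (m n)%:R / n%:R @[n --> \oo] --> t.
Proof.
have h : t + y n * (Num.sqrt n%:R)^-1 @[n --> \oo] --> t + x * 0.
  by apply: cvgD; [exact: cvg_cst|apply: cvgM; [exact: y_cvg|exact: cvg_sqrt_natV]].
rewrite mulr0 addr0 in h; apply: cvg_trans h; apply: near_eq_cvg.
near=> n; have n0 : (0 < n)%N by near: n; exists 1%N.
have e : n%:R = Num.sqrt n%:R ^+ 2 :> R by rewrite sqr_sqrtr.
rewrite /y /bar_start; move: (sqrt_gt0 n0); rewrite {2 5}e.
move: (Num.sqrt _) (m n)%:R => r M r0.
by field; rewrite gt_eqF.
Unshelve. all: end_near. Qed.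

Let m_in : \forall n \near \oo, (0 < m n < n)%N.
Proof.
move/andP: t01 => [t0 t1].
near=> n; have n0 : (0 < n)%N by near: n; exists 1%N.
have h1 : 0 < (m n)%:R / n%:R :> R by near: n; move/cvgr_gt: frac_m; exact.
have h2 : (m n)%:R / n%:R < 1 :> R by near: n; move/cvgr_lt: frac_m; exact.
move: h1 h2; rewrite ltr_pdivrMr ?ltr0n // mul1r ltr_nat pmulr_lgt0 ?invr_gt0 ?ltr0n //.
by move=> -> ->.
Unshelve. all: end_near. Qed.

Let frac_nm : (n - m n)%:R / n%:R @[n --> \oo] --> 1 - t.
Proof.
have h : 1 - (m n)%:R / n%:R @[n --> \oo] --> 1 - t.
  by apply: cvgB; [exact: cvg_cst|exact: frac_m].
apply: cvg_trans h; apply: near_eq_cvg; near=> n.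
have /andP[m0 mn] : (0 < m n < n)%N by near: n; exact: m_in.
rewrite natrB 1?ltnW //; field; rewrite gt_eqF // ltr0n; lia.
Unshelve. all: end_near. Qed.

Let rate_cvg : n%:R * (rate p ((m n)%:R / n%:R) - rate p t) @[n --> \oo] -->
  - (curvature t / 2 * x ^+ 2).
Proof.
have y2 : - (curvature t / 2 * y n ^+ 2) @[n --> \oo] --> - (curvature t / 2 * x ^+ 2).
  apply: cvgN; apply: cvgM; first exact: cvg_cst.
  by under eq_fun do rewrite expr2; rewrite expr2; apply: cvgM; exact: y_cvg.
apply: cvg_sub0 y2; apply/cvgr0Pnorm_le => e e0.
pose B : R := (`|x| + 1) ^+ 2.
have B0 : 0 < B by rewrite exprn_gt0 // ltr_wpDl.
have [d d0 hd] := rate_taylor t01 dt (divr_gt0 e0 B0).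
near=> n; have n0 : (0 < n)%N by near: n; exists 1%N.
have nR : 0 < n%:R :> R by rewrite ltr0n.
change (`|n%:R * (rate p ((m n)%:R / n%:R) - rate p t) -
  - (curvature t / 2 * y n ^+ 2)| <= e).
rewrite opprK {1}/y -bar_start_sqr //.
have h : `|(m n)%:R / n%:R - t| < d.
  by near: n; move/cvgrPdist_lt: frac_m => /(_ _ d0); apply: filterS => k; rewrite distrC.
have {h} := hd _ h; set a := (m n)%:R / n%:R => h.
have -> : n%:R * (rate p a - rate p t) + curvature t / 2 * (n%:R * (a - t) ^+ 2) =
  n%:R * (rate p a - rate p t + curvature t / 2 * (a - t) ^+ 2) by ring.
rewrite normrM gtr0_norm //.
apply: (@le_trans _ _ (e / B * y n ^+ 2)).
  have -> : e / B * y n ^+ 2 = n%:R * (e / B * (a - t) ^+ 2).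
    by rewrite /y -bar_start_sqr // mulrCA.
  by rewrite ler_pM2l.
rewrite mulrAC ler_pdivrMr // ler_pM2l // -real_normK ?num_real // ler_sqr ?nnegrE ?addr_ge0 //.
have : `|y n - x| <= 1.
  by near: n; move/cvgrPdist_le: y_cvg => /(_ _ ltr01); apply: filterS => k; rewrite distrC.
have := lerB_dist (y n) x; lra.
Unshelve. all: end_near. Qed.

Lemma histogram_cvg (s : R) : stirling_log R n @[n --> \oo] --> s ->
  histogram n x @[n --> \oo] -->
    expR (- (curvature t / 2 * x ^+ 2) - s - s - (ln t + ln (1 - t)) / 2).
Proof.
move=> hs; move/andP: (t01) => [t0 t1]; have t1' : 0 < 1 - t by lra.
have h : peak n (m n) @[n --> \oo] -->
    expR (- (curvature t / 2 * x ^+ 2) - s - s - (ln t + ln (1 - t)) / 2).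
  apply: continuous_cvg; first exact: continuous_expR.
  apply: cvgB; first apply: cvgB; first apply: cvgB.
  - exact: rate_cvg.
  - by apply: (cvg_comp m (stirling_log R)) hs; apply: (cvg_nat_of_ratio t0 frac_m).
  - by apply: (cvg_comp (fun n => n - m n)%N (stirling_log R)) hs;
      apply: (cvg_nat_of_ratio t1' frac_nm).
  - apply: cvgMl; apply: cvgD.
      by apply: (cvg_comp _ (@ln R) frac_m); apply: continuous_ln.
    apply: (cvg_comp (fun n => 1 - (m n)%:R / n%:R) (@ln R)); last exact: continuous_ln.
    by apply: cvgB; [exact: cvg_cst|exact: frac_m].
apply: cvg_trans h; apply: near_eq_cvg; near=> n.
have mn : (0 < m n < n)%N by near: n; exact: m_in.
have n0 : (0 < n)%N by lia.
have z0 : 0 <= z n by near: n; exact: z_ge0.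
rewrite (histogramE mn) // /bar /= in_itv /= /bar_start.
have s0 := sqrt_gt0 n0; rewrite ler_pdivrMr // ltr_pdivlMr //.
have /andP[h1 h2] := truncn_itv z0; rewrite -/(m n) in h1 h2.
by rewrite lerBlDl h1 /= ltrBrDl h2.
Unshelve. all: end_near. Qed.

End Pointwise.

(** Dominated convergence of the histograms.  The limit is a Gaussian integral,
whose value is irrelevant: it only has to be finite and positive. *)
Lemma scaled_weight_cvg : exists2 c : R, 0 < c &
  Num.sqrt n%:R * scaled_weight p t n @[n --> \oo] --> c.
Proof.
have [s [hs _]] := stirling_log_cvg R.
pose f (x : R) := expR (- (curvature t / 2 * x ^+ 2) - s - s - (ln t + ln (1 - t)) / 2).
have mf : measurable_fun setT f.
  apply: continuous_measurable_fun => x; rewrite /f; apply: continuous_comp; last exact: continuous_expR.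
  apply: cvgB; last exact: cvg_cst.
  apply: cvgB; last exact: cvg_cst.
  apply: cvgB; last exact: cvg_cst.
  apply: cvgN; apply: cvgM; first exact: cvg_cst.
  by under eq_fun do rewrite expr2; rewrite expr2; apply: cvgM; exact: cvg_id.
have [C C0 hC] := histogram_le.
have mh n : measurable_fun setT (histogram n).
  apply: measurable_sum => a; apply: measurable_funM => //.
  by apply: measurable_indic; exact: measurable_bar.
have hcv : {ae mu, forall x, setT x ->
    (fun n => (histogram n x)%:E) @ \oo --> (EFin \o f) x}.
  apply: aeW => x _; apply: cvg_EFin; first by apply: nearW.
  exact: histogram_cvg.
have hdom : {ae mu, forall x n, setT x -> (`|(histogram n x)%:E| <= (C * gauss_fun x)%:E)%E}.
  by apply: aeW => x n _; rewrite lee_fin; exact: hC.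
have [fi _ cv] := @dominated_convergence _ _ _ mu setT measurableT
  (fun n x => (histogram n x)%:E) (EFin \o f) (fun x => (C * gauss_fun x)%:E)
  (fun n => (measurable_EFinP _ _).2 (mh n)) ((measurable_EFinP _ _).2 mf)
  hcv (integrableZl measurableT C integrableT_gauss) hdom.
have ffin : (\int[mu]_x (f x)%:E)%E \is a fin_num := integrable_fin_num measurableT fi.
have fE : ((fine (\int[mu]_x (f x)%:E))%:E = \int[mu]_x (f x)%:E)%E by rewrite fineK.
exists (fine (\int[mu]_x (f x)%:E)).
  rewrite -lte_fin fE.
  apply: (@lt_le_trans _ _ (\int[mu]_(x in `[0%R, 1%R]) (f 1%R)%:E)%E).
    rewrite integral_cst //=.
    have -> : (mu `[0%R, 1%R] = 1)%E.
      by etransitivity; [exact: lebesgue_measure_itv|rewrite /= lte_fin ltr01 oppr0 adde0].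
    by rewrite mule1 lte_fin expR_gt0.
  apply: (@le_trans _ _ (\int[mu]_(x in `[0%R, 1%R]) (f x)%:E)%E).
    apply: ge0_le_integral => //=.
    - by move=> x _; rewrite lee_fin expR_ge0.
    - by apply/measurable_EFinP; exact: measurable_funTS.
    - move=> x; rewrite in_itv /= => /andP[x0 x1]; rewrite lee_fin ler_expR !lerD2r lerN2.
      apply: ler_wpM2l; last by rewrite ler_sqr ?nnegrE.
      by rewrite divr_ge0 // sqr_ge0.
  apply: ge0_subset_integral => //=.
  - by apply/measurable_EFinP.
  - by move=> x _; rewrite lee_fin expR_ge0.
move: cv; rewrite -fE => /fine_cvg; apply: cvg_trans; apply: near_eq_cvg.
near=> n; have n0 : (0 < n)%N by near: n; exists 1%N.
by rewrite /= integral_histogram.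
Unshelve. all: end_near. Qed.

End LaplaceLimit.

(** * Convolution and the coefficients of (1-z)^(-1/2) *)

Section Convolution.
Variable R : realType.
Implicit Types u v w : nat -> R.

Definition conv u v n : R := \sum_(k < n.+1) u k * v (n - k)%N.

Lemma convC u v n : conv u v n = conv v u n.
Proof.
rewrite /conv (reindex_inj rev_ord_inj) /=; apply: eq_bigr => k _.
by rewrite mulrC; congr (v _ * u _); have := ltn_ord k; lia.
Qed.

Lemma eq_conv u u' v v' n : (forall k, (k <= n)%N -> u k = u' k) ->
  (forall k, (k <= n)%N -> v k = v' k) -> conv u v n = conv u' v' n.
Proof.
by move=> uu vv; apply: eq_bigr => k _; rewrite uu ?vv ?leq_subr // -ltnS.
Qed.

(** The n-th coefficient of a product of power series depends on their
truncations only, so associativity is that of polynomials. *)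
Lemma convA u v w n : conv u (conv v w) n = conv (conv u v) w n.
Proof.
pose P u := \poly_(k < n.+1) u k.
have PE u' k : (k <= n)%N -> (P u')`_k = u' k by move=> kn; rewrite coef_poly ltnS kn.
have PM u' v' k : (k <= n)%N -> (P u' * P v')`_k = conv u' v' k.
  move=> kn; rewrite coefM; apply: eq_bigr => j _; have := ltn_ord j => jk.
  by rewrite !PE //; lia.
transitivity ((P u * (P v * P w))`_n).
  rewrite coefM; apply: eq_bigr => j _; have := ltn_ord j => jk.
  by rewrite PE ?PM //; lia.
rewrite mulrA coefM; apply: eq_bigr => j _; have := ltn_ord j => jk.
by rewrite PE ?PM //; lia.
Qed.

Lemma conv_index_sym u n :
  conv (fun k => k%:R * u k) u n = n%:R / 2 * conv u u n.
Proof.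
suff : 2 * conv (fun k => k%:R * u k) u n = n%:R * conv u u n by lra.
rewrite mulr2n mulrDl mul1r {2}convC /conv -big_split /= big_distrr /=.
apply: eq_bigr => k _; have kn : (k <= n)%N by rewrite -ltnS.
by rewrite natrB //; ring.
Qed.

End Convolution.

Section CentralBinomial.
Variable R : realType.

(** The central binomial numbers C(2n, n) / 4^n. *)
Definition central n : R := \prod_(i < n) ((i%:R + 2^-1) / i.+1%:R).

Lemma central0 : central 0 = 1. Proof. by rewrite /central big_ord0. Qed.

Lemma centralS n : n.+1%:R * central n.+1 = (n%:R + 2^-1) * central n.
Proof. by rewrite /central big_ord_recr /=; field; rewrite gt_eqF. Qed.

Lemma central_gt0 n : 0 < central n.
Proof. by apply: prodr_gt0 => i _; rewrite divr_gt0 // ltr_wpDl ?ler0n ?invr_gt0. Qed.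

Lemma central_le m n : (m <= n)%N -> central n <= central m.
Proof.
move: m n; apply: (homo_leq (fun x => lexx x) (fun _ _ _ h1 h2 => le_trans h2 h1)).
move=> n; rewrite -(ler_pM2l (ltr0Sn R n)) centralS ler_pM2r ?central_gt0 //.
by rewrite -[n.+1%:R]natr1; lra.
Qed.

(** The coefficient form of ((1-z)^(-1/2))^2 = (1-z)^-1.  [centralS] says that
2 (1 - z) E' = E, and [conv_index_sym] that 2 E E' = (E^2)'. *)
Lemma central_conv n : conv central central n = 1.
Proof.
elim: n => [|n IH]; first by rewrite /conv big_ord_recr big_ord0 /= central0 add0r mulr1.
have := conv_index_sym central n.+1; rewrite /conv big_ord_recl /= mul0r mul0r add0r.
rewrite (eq_bigr (fun k : 'I_n.+1 => k%:R * central k * central (n - k) +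
   2^-1 * (central k * central (n - k)))); last first.
  by move=> k _; rewrite centralS subSS; ring.
rewrite big_split /= -big_distrr /= -/(conv central central n).
rewrite -/(conv (fun k => k%:R * central k) central n) conv_index_sym IH.
rewrite -/(conv central central n.+1) -[n.+1%:R]natr1 => h.
have n0 : 0 <= n%:R :> R by [].
have : (n%:R + 1) * (conv central central n.+1 - 1) = 0 :> R by lra.
by move/eqP; rewrite mulf_eq0 gt_eqF /= ?subr_eq0 ?ltr_wpDl // => /eqP.
Qed.

Lemma central_sum n : \sum_(k < n) central k = 2 * n%:R * central n.
Proof.
elim: n => [|n IH]; first by rewrite big_ord0 mulr0 mul0r.
by rewrite big_ord_recr /= IH -[RHS]mulrA centralS; field.
Qed.

(** The sequence n e_n^2 increases while (n + 1/2) e_n^2 decreases. *)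
Lemma central_cvg : exists2 c : R, 0 < c & Num.sqrt n%:R * central n @[n --> \oo] --> c.
Proof.
pose u n : R := n%:R * central n ^+ 2.
have sq n : n.+1%:R ^+ 2 * central n.+1 ^+ 2 = (n%:R + 2^-1) ^+ 2 * central n ^+ 2.
  by rewrite -!exprMn centralS.
have u_nd : nondecreasing_seq u.
  apply/nondecreasing_seqP => n; rewrite /u -(ler_pM2l (ltr0Sn R n)).
  rewrite [leRHS]mulrA -expr2 sq [leLHS]mulrA ler_pM2r ?exprn_gt0 ?central_gt0 //.
  by rewrite -[n.+1%:R]natr1; have := ler0n R n; nra.
have ub n : (n%:R + 2^-1) * central n ^+ 2 <= 2^-1.
  elim: n => [|n IH]; first by rewrite central0 add0r expr1n mulr1.
  apply: le_trans IH; rewrite -(ler_pM2l (exprn_gt0 2 (ltr0Sn R n))).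
  rewrite [leLHS]mulrCA sq [leLHS]mulrA [leRHS]mulrA ler_pM2r ?exprn_gt0 ?central_gt0 //.
  by rewrite -[n.+1%:R]natr1; have := ler0n R n; nra.
have u_cv : cvgn u.
  apply: nondecreasing_is_cvgn => //; exists 2^-1 => _ [n _ <-].
  apply: le_trans (ub n); rewrite ler_pM2r ?exprn_gt0 ?central_gt0 //.
  by rewrite lerDl invr_ge0.
have l0 : 0 < limn u.
  apply: (@lt_le_trans _ _ (u 1%N)); last exact: nondecreasing_cvgn_le.
  by rewrite /u mul1r exprn_gt0 ?central_gt0.
exists (Num.sqrt (limn u)); first by rewrite sqrtr_gt0.
have h : Num.sqrt (u n) @[n --> \oo] --> Num.sqrt (limn u).
  by apply: continuous_cvg; [exact: sqrt_continuous|exact: u_cv].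
apply: cvg_trans h; apply: near_eq_cvg; apply: nearW => n.
by rewrite /u sqrtrM ?ler0n // sqrtr_sqr ger0_norm // ltW // central_gt0.
Qed.

End CentralBinomial.

(** * Cells of the unit interval *)

(** The cell of the ratio k/n in the division of [0, 1] into D cells.  The last
cell also contains the ratio 1, which occurs: the first component picked may be
everything. *)
Definition pick_cell (D k n : nat) : nat := minn (D * k %/ n) D.-1.

(** The least k with d n <= D k, a rounded-up quotient. *)
Definition cell_start (D d n : nat) : nat := (d * n + D.-1) %/ D.

Lemma cell_start_gt D d n k : (0 < D)%N -> (k < cell_start D d n)%N = (D * k < d * n)%N.
Proof.
move=> D0; rewrite /cell_start leq_divRL // mulnC mulnS; lia.
Qed.

Lemma cell_start_le D d n : (d <= D)%N -> (cell_start D d n <= n)%N.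
Proof.
case: D => [|D] dD; first by rewrite /cell_start divn0.
rewrite /cell_start -ltnS ltn_divLR //= mulSn mulnC; nia.
Qed.

Lemma pick_cell_ge D k n d : (0 < n)%N -> (d < D)%N ->
  (d <= pick_cell D k n)%N = (d * n <= D * k)%N.
Proof.
move=> n0 dD; rewrite /pick_cell leq_min leq_divRL //; case: leqP => //=; lia.
Qed.

Lemma pick_cell_lt D k n : (0 < D)%N -> (pick_cell D k n < D)%N.
Proof. by rewrite /pick_cell => D0; rewrite gtn_min; lia. Qed.

Lemma cell_start_cvg (R : realType) D d : (0 < D)%N ->
  (cell_start D d n)%:R / n%:R @[n --> \oo] --> (d%:R / D%:R : R).
Proof.
move=> D0; have D0R : 0 < D%:R :> R by rewrite ltr0n.
apply/cvgrPdist_le => e e0.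
have /cvgr0Pnorm_le /(_ _ e0) h := @cvg_natV0 R.
near=> n; have n0 : (0 < n)%N by near: n; exists 1%N.
have n0R : 0 < n%:R :> R by rewrite ltr0n.
have h1 : n%:R^-1 <= e by rewrite -[leLHS]ger0_norm ?invr_ge0 //; near: n.
apply: le_trans h1; rewrite distrC.
have k1 : (cell_start D d n * D <= d * n + D.-1)%N by exact: leq_divM.
have k2 : (d * n + D.-1 < (cell_start D d n).+1 * D)%N by exact: ltn_ceil.
have {}k1 : (cell_start D d n)%:R * D%:R <= d%:R * n%:R + D%:R :> R.
  by rewrite -!natrM -natrD ler_nat (leq_trans k1) // leq_add2l leq_pred.
have {}k2 : d%:R * n%:R <= (cell_start D d n)%:R * D%:R + D%:R :> R.
  by rewrite -!natrM -natrD ler_nat; lia.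
have -> : (cell_start D d n)%:R / n%:R - d%:R / D%:R =
    ((cell_start D d n)%:R * D%:R - d%:R * n%:R) / D%:R / n%:R :> R.
  by field; rewrite !gt_eqF.
rewrite normrM normfV normr_nat -[leRHS]mul1r ler_pM2r ?invr_gt0 //.
rewrite normrM normfV normr_nat ler_pdivrMr // mul1r ler_norml.
by rewrite lerBrDl lerBlDl; apply/andP; split; lra.
Unshelve. all: end_near. Qed.

(** * The law of the first pick *)

(** The argument uses only the recurrence n M_n = sum_k a_k M_(n-k) between
nonnegative sequences and the decay M_n ~ c n^(-1/2). *)
Section FirstPick.
Variables (R : realType) (M a : nat -> R) (c : R).
Hypotheses (M0 : M 0%N = 1) (M_ge0 : forall n, 0 <= M n) (a_ge0 : forall n, 0 <= a n).
Hypothesis (M_rec : forall n, n%:R * M n = \sum_(k < n.+1) a k * M (n - k)%N).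
Hypotheses (c_gt0 : 0 < c) (M_cvg : Num.sqrt n%:R * M n @[n --> \oo] --> c).

Notation e := (@central R).

Let cvg_sqrt0 (u : nat -> R) (l : R) :
  Num.sqrt n%:R * u n @[n --> \oo] --> l -> u n @[n --> \oo] --> 0.
Proof.
move=> h; have h0 : Num.sqrt n%:R * u n * (Num.sqrt n%:R)^-1 @[n --> \oo] --> (0 : R).
  by rewrite -(mulr0 l); apply: cvgM => //; exact: cvg_sqrt_natV.
apply: cvg_trans h0; apply: near_eq_cvg; near=> n.
have n0 : (0 < n)%N by near: n; exists 1%N.
by rewrite mulrAC divff ?mul1r // sqrtr_eq0 -ltNge ltr0n.
Unshelve. all: end_near. Qed.

Lemma ratio_cvg : exists2 l : R, 0 < l & M n / e n @[n --> \oo] --> l.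
Proof.
have [g g0 hg] := central_cvg R.
exists (c / g); first by rewrite divr_gt0.
have h : (Num.sqrt n%:R * M n) / (Num.sqrt n%:R * e n) @[n --> \oo] --> c / g.
  by apply: cvgM => //; apply: cvgV => //; rewrite gt_eqF.
apply: cvg_trans h; apply: near_eq_cvg; near=> n.
have n0 : (0 < n)%N by near: n; exists 1%N.
rewrite invfM mulrACA divff ?mul1r // sqrtr_eq0 -ltNge ltr0n //.
Unshelve. all: end_near. Qed.

Let natV_cvg0 : n%:R^-1 @[n --> \oo] --> (0 : R) := @cvg_natV0 R.

Let e_cvg0 : e n @[n --> \oo] --> 0.
Proof. by have [g _ /cvg_sqrt0] := central_cvg R. Qed.

Let shift_cvg (u : nat -> R) (l : R) k :
  u n @[n --> \oo] --> l -> u (n - k)%N @[n --> \oo] --> l.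
Proof. by move=> h; rewrite -(cvg_shiftn k); under eq_fun do rewrite addnK. Qed.

Let M_cvg0 : M n @[n --> \oo] --> 0.
Proof. exact: cvg_sqrt0 M_cvg. Qed.

(** The summand a_n M_0 of the recurrence gives a_n <= n M_n. *)
Let pick_shift_cvg0 k : a (n - k)%N / n%:R @[n --> \oo] --> 0.
Proof.
have h n : 0 <= a (n - k)%N / n%:R <= M (n - k)%N.
  rewrite divr_ge0 //=.
  case: n => [|n]; first by rewrite invr0 mulr0.
  rewrite ler_pdivrMr //; apply: (@le_trans _ _ ((n.+1 - k)%:R * M (n.+1 - k)%N)).
    rewrite M_rec big_ord_recr /= subnn M0 mulr1 lerDr.
    by apply: sumr_ge0 => j _; rewrite mulr_ge0.
  by rewrite mulrC ler_wpM2l // ler_nat leq_subr.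
apply: (squeeze_cvgr (nearW _ h)); first exact: cvg_cst.
exact: shift_cvg.
Qed.

Let pick_cvg0 : a n / n%:R @[n --> \oo] --> 0.
Proof. by under eq_fun do rewrite -[X in a X]subn0; exact: pick_shift_cvg0. Qed.

(** With A, E, V = M E and z M' the generating functions, A V = (z M') E.
As M_n ~ l e_n and E^2 = (1-z)^-1, the coefficients of V tend to l and those of
(z M') E are equivalent to n l / 2.  Since the weights a_k are nonnegative, l can
be pulled out of the convolution of a and V, which leaves the sum of the a_k. *)
Lemma mean_cvg : (\sum_(k < n.+1) a k) / n%:R @[n --> \oo] --> (2^-1 : R).
Proof.
have [l l0 hl] := ratio_cvg.
pose eps n := M n / e n - l.
have eps0 : eps n @[n --> \oo] --> 0.
  by rewrite -(subrr l); apply: cvgB => //; exact: cvg_cst.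
have ME n : M n = e n * (l + eps n).
  by rewrite /eps addrC subrK mulrCA divff ?mulr1 // gt_eqF ?central_gt0.
have v_cvg : conv M e n @[n --> \oo] --> l.
  have h0 : \sum_(k < n.+1) (e k * e (n - k)%N) * eps k @[n --> \oo] --> 0.
    apply: (@toeplitz_cvg0 _ (fun n k => e k * e (n - k)%N) _ 1) => //.
    - by move=> n k _; rewrite mulr_ge0 // ltW // central_gt0.
    - by move=> n; rewrite -/(conv e e n) central_conv.
    - by move=> k; rewrite -(mulr0 (e k)); apply: cvgMr; exact: shift_cvg.
  have h1 : l + \sum_(k < n.+1) (e k * e (n - k)%N) * eps k @[n --> \oo] --> l + 0.
    by apply: cvgD h0; exact: cvg_cst.
  rewrite addr0 in h1; apply: cvg_trans h1; apply: near_eq_cvg; apply: nearW => n.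
  rewrite -[X in X + _]mulr1 -(central_conv R n) /conv big_distrr -big_split /=.
  by apply: eq_bigr => k _; rewrite ME; ring.
have w_cvg : conv (fun k => k%:R * M k) e n / n%:R @[n --> \oo] --> l / 2.
  have h0 : \sum_(k < n.+1) (n%:R^-1 * (k%:R * (e k * e (n - k)%N))) * eps k
      @[n --> \oo] --> 0.
    apply: (@toeplitz_cvg0 _ (fun n k => n%:R^-1 * (k%:R * (e k * e (n - k)%N))) _ 1) => //.
    - by move=> n k _; rewrite !mulr_ge0 // ltW // central_gt0.
    - move=> n; rewrite -[leRHS](central_conv R n); apply: ler_sum => k _.
      have kn : (k <= n)%N by rewrite -ltnS.
      rewrite [leLHS]mulrA ler_piMl //; first by rewrite mulr_ge0 // ltW // central_gt0.
      case: n k kn => [|n] k kn; first by rewrite invr0 mul0r.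
      by rewrite mulrC ler_pdivrMr ?mul1r ?ler_nat.
    - move=> k; rewrite -(mul0r (k%:R * (e k * 0))); apply: cvgM => //.
      by apply: cvgMr; apply: cvgMr; exact: shift_cvg.
  have h1 : l / 2 + \sum_(k < n.+1) (n%:R^-1 * (k%:R * (e k * e (n - k)%N))) * eps k
      @[n --> \oo] --> l / 2 + 0.
    by apply: cvgD h0; exact: cvg_cst.
  rewrite addr0 in h1; apply: cvg_trans h1; apply: near_eq_cvg; near=> n.
  have n0 : (n%:R : R) != 0 by rewrite pnatr_eq0 -lt0n; near: n; exists 1%N.
  have -> : l / 2 = \sum_(k < n.+1) n%:R^-1 * (k%:R * (e k * e (n - k)%N)) * l.
    have := conv_index_sym e n; rewrite central_conv mulr1 => h.
    rewrite -big_distrl -big_distrr /=.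
    rewrite (eq_bigr (fun k : 'I_n.+1 => k%:R * e k * e (n - k)%N)) => [|k _]; last by ring.
    by rewrite -/(conv (fun k => k%:R * e k) e n) h; field.
  rewrite -big_split /= /conv big_distrl /=; apply: eq_bigr => k _; rewrite ME; ring.
(* The recurrence is A M = z M'. *)
have av n : conv a (conv M e) n = conv (fun k => k%:R * M k) e n.
  by rewrite convA; apply: eq_conv => // k _; rewrite M_rec.
have v_gt0 n : 0 < conv M e n.
  rewrite /conv big_ord_recl /= M0 mul1r ltr_pwDl ?central_gt0 //.
  by apply: sumr_ge0 => k _; rewrite mulr_ge0 // ltW ?central_gt0.
(* The coefficients of V are bounded away from 0, so the means of a_k are
   bounded; this is what allows V to be replaced by its limit. *)
have [B hB] : exists B : R, forall n, (\sum_(k < n.+1) a k) / n%:R <= B.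
  have [B1 B10 hB1] : exists2 B, 0 < B & forall n, `|(conv M e n)^-1| <= B.
    by apply: (cvgn_bounded (l := l^-1)); apply: cvgV => //; rewrite gt_eqF.
  have [B2 _ hB2] := cvgn_bounded w_cvg; exists (B1 * B2) => n.
  apply: (@le_trans _ _ (B1 * (conv (fun k => k%:R * M k) e n / n%:R))); last first.
    by rewrite ler_pM2l //; apply: le_trans (ler_norm _) _; exact: hB2.
  rewrite mulrA ler_wpM2r ?invr_ge0 // -av /conv big_distrr /=.
  apply: ler_sum => k _; rewrite mulrCA ler_peMr //.
  have := hB1 (n - k)%N; rewrite ger0_norm ?invr_ge0 ?(ltW (v_gt0 _)) //.
  by rewrite -[X in X <= _]mul1r ler_pdivrMr.
have a_cvg0 k : a (n - k)%N / n%:R @[n --> \oo] --> 0 by exact: pick_shift_cvg0.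
have h0 : \sum_(k < n.+1) (a (n - k)%N / n%:R) * (conv M e k - l) @[n --> \oo] --> 0.
  apply: (@toeplitz_cvg0 R (fun n k => a (n - k)%N / n%:R) (fun k => conv M e k - l) B).
  - by move=> n k _; rewrite divr_ge0.
  - move=> n; rewrite -big_distrl /=; apply: le_trans (hB n); rewrite le_eqVlt; apply/orP; left.
    apply/eqP; congr (_ / _); rewrite (reindex_inj rev_ord_inj) /=.
    by apply: eq_bigr => k _; congr a; have := ltn_ord k; lia.
  - exact: a_cvg0.
  - by rewrite -(subrr l); apply: cvgB => //; exact: cvg_cst.
have h1 : (conv (fun k => k%:R * M k) e n / n%:R -
    \sum_(k < n.+1) (a (n - k)%N / n%:R) * (conv M e k - l)) / l @[n --> \oo] -->
    (l / 2 - 0) / l.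
  by apply: cvgMl; apply: cvgB.
have -> : 2^-1 = (l / 2 - 0) / l by field; rewrite gt_eqF.
apply: cvg_trans h1; apply: near_eq_cvg; near=> n.
have n0 : (n%:R : R) != 0 by rewrite pnatr_eq0 -lt0n; near: n; exists 1%N.
rewrite -av convC /conv big_distrl -sumrB /= !big_distrl /= [RHS](reindex_inj rev_ord_inj) /=.
apply: eq_bigr => k _; rewrite subSS; field.
by rewrite n0 gt_eqF.
Unshelve. all: end_near. Qed.

(** Summation by parts against a nondecreasing weight. *)
Lemma abel_le (al g : nat -> R) (tau : R) K :
  (forall k, (k <= K)%N -> `|\sum_(j < k) al j| <= tau) ->
  (forall k, 0 <= g k) -> (forall k, (k < K)%N -> g k <= g k.+1) ->
  `|\sum_(k < K) al k * g k| <= 2 * tau * g K.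
Proof.
move=> hal g0 gm.
have tau0 : 0 <= tau by apply: le_trans (hal 0%N (leq0n _)).
have H k : (k <= K)%N ->
    `|\sum_(j < k) al j * g j - (\sum_(j < k) al j) * g k| <= tau * g k.
  elim: k => [|k IH] kK.
    by rewrite !big_ord0 mul0r subrr normr0 mulr_ge0.
  rewrite !big_ord_recr /=.
  have := IH (ltnW kK); have := hal _ kK; rewrite big_ord_recr /=.
  move: (\sum_(j < k) al j * g j) (\sum_(j < k) al j) => U T hT hU.
  have -> : U + al k * g k - (T + al k) * g k.+1 =
    (U - T * g k) - (T + al k) * (g k.+1 - g k) by ring.
  apply: le_trans (ler_normB _ _) _; rewrite normrM (ger0_norm (_ : 0 <= g k.+1 - g k)).
    by have := gm k kK; nra.
  by rewrite subr_ge0 gm.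
have := H K (leqnn K); have := hal K (leqnn K).
move: (\sum_(j < K) al j * g j) (\sum_(j < K) al j) => U T hT hU.
have -> : U = (U - T * g K) + T * g K by ring.
apply: le_trans (ler_normD _ _) _; rewrite normrM (ger0_norm (g0 K)).
by have := g0 K; nra.
Qed.

Section FirstPickLimit.
Variables (K : nat -> nat) (x : R).
Hypotheses (K_le : forall n, (K n <= n)%N) (x_ge0 : 0 <= x) (x_lt1 : x < 1).
Hypothesis K_cvg : (K n)%:R / n%:R @[n --> \oo] --> x.

Let m n := (n - K n)%N.

Let m_cvg : (m n)%:R / n%:R @[n --> \oo] --> 1 - x.
Proof.
have h : 1 - (K n)%:R / n%:R @[n --> \oo] --> 1 - x.
  by apply: cvgB => //; exact: cvg_cst.
apply: cvg_trans h; apply: near_eq_cvg; near=> n.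
have n0 : (n%:R : R) != 0 by rewrite pnatr_eq0 -lt0n; near: n; exists 1%N.
by rewrite /m natrB //; field.
Unshelve. all: end_near. Qed.

Let m_infty : m n @[n --> \oo] --> \oo.
Proof. by apply: cvg_nat_of_ratio m_cvg; rewrite subr_gt0. Qed.

Let y := Num.sqrt (1 - x).

Let y_gt0 : 0 < y. Proof. by rewrite sqrtr_gt0 subr_gt0. Qed.

Let sqrt_ratio : Num.sqrt (m n)%:R / Num.sqrt n%:R @[n --> \oo] --> y.
Proof.
have h : Num.sqrt ((m n)%:R / n%:R) @[n --> \oo] --> y.
  by apply: continuous_cvg; [exact: sqrt_continuous|exact: m_cvg].
apply: cvg_trans h; apply: near_eq_cvg; apply: nearW => n.
by rewrite sqrtrM // sqrtrV.
Qed.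

Let e_ratio : e (m n) / e n @[n --> \oo] --> y^-1.
Proof.
have [g g0 hg] := central_cvg R.
have h : (Num.sqrt (m n)%:R * e (m n)) / (Num.sqrt n%:R * e n) *
    (Num.sqrt (m n)%:R / Num.sqrt n%:R)^-1 @[n --> \oo] --> g / g * y^-1.
  apply: cvgM; last by apply: cvgV => //; rewrite gt_eqF.
  apply: cvgM; last by apply: cvgV => //; rewrite gt_eqF.
  exact: (cvg_comp m (fun n => Num.sqrt n%:R * e n) m_infty hg).
rewrite divff ?gt_eqF // mul1r in h.
apply: cvg_trans h; apply: near_eq_cvg; near=> n.
have n0 : (0 < n)%N by near: n; exists 1%N.
have m0 : (0 < m n)%N by near: n; exact: (cvgnyPgt _).1.
have s0 : Num.sqrt n%:R != 0 :> R by rewrite sqrtr_eq0 -ltNge ltr0n.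
have s1 : Num.sqrt (m n)%:R != 0 :> R by rewrite sqrtr_eq0 -ltNge ltr0n.
by field; rewrite s0 s1 gt_eqF ?central_gt0.
Unshelve. all: end_near. Qed.

(** Up to a factor 1/2, the numerator in [first_pick_cvg] when M is replaced by e
and every a_k by its mean value 1/2. *)
Let sum_centralE n :
  \sum_(k < K n) e (n - k)%N = (2 * n%:R + 1) * e n - (2 * (m n)%:R + 1) * e (m n).
Proof.
have S j : \sum_(k < j.+1) e k = (2 * j%:R + 1) * e j.
  by rewrite big_ord_recr /= central_sum; ring.
rewrite -!S -!(big_mkord xpredT e) (big_cat_nat (n := (m n).+1)) //=; last first.
  by rewrite ltnS leq_subr.
rewrite addrAC subrr add0r -[(m n).+1]add0n big_addn.
have -> : (n.+1 - (m n).+1 = K n)%N by rewrite /m; have := K_le n; lia.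
rewrite big_mkord (reindex_inj rev_ord_inj) /=; apply: eq_bigr => k _.
by congr e; rewrite /m; have := ltn_ord k; have := K_le n; lia.
Qed.

Let sum_central_cvg :
  (\sum_(k < K n) e (n - k)%N) / (n%:R * e n) @[n --> \oo] --> 2 * (1 - y).
Proof.
have h : (2 + n%:R^-1) - (2 * ((m n)%:R / n%:R) + n%:R^-1) * (e (m n) / e n)
    @[n --> \oo] --> (2 + 0) - (2 * (1 - x) + 0) * y^-1.
  apply: cvgB; first by apply: cvgD => //; exact: cvg_cst.
  by apply: cvgM => //; apply: cvgD => //; apply: cvgMr.
have -> : 2 * (1 - y) = (2 + 0) - (2 * (1 - x) + 0) * y^-1.
  have -> : 1 - x = y ^+ 2 by rewrite sqr_sqrtr // subr_ge0 ltW.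
  by field; rewrite gt_eqF.
apply: cvg_trans h; apply: near_eq_cvg; near=> n.
have n0 : (n%:R : R) != 0 by rewrite pnatr_eq0 -lt0n; near: n; exists 1%N.
rewrite sum_centralE.
by field; rewrite n0 gt_eqF ?central_gt0.
Unshelve. all: end_near. Qed.

(** The partial sums of a_k - 1/2 are o(n) by [mean_cvg], and the weights
e_(n-k) are monotone in k and stay within a constant of e_n, as k < K n keeps
n - k of order n. *)
Let defect_cvg :
  (\sum_(k < K n) (a k - 2^-1) * e (n - k)%N) / (n%:R * e n) @[n --> \oo] --> 0.
Proof.
have mean0 : (\sum_(k < n) (a k - 2^-1)) / n%:R @[n --> \oo] --> 0.
  have h : (\sum_(k < n.+1) a k) / n%:R - a n / n%:R - 2^-1 @[n --> \oo] --> (2^-1 - 0 - 2^-1 : R).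
    apply: cvgB; last exact: cvg_cst.
    apply: cvgB; first exact: mean_cvg.
    exact: pick_cvg0.
  rewrite subr0 subrr in h; apply: cvg_trans h; apply: near_eq_cvg; near=> n.
  have n0 : (n%:R : R) != 0 by rewrite pnatr_eq0 -lt0n; near: n; exists 1%N.
  by rewrite big_ord_recr /= sumrB sumr_const card_ord -mulr_natr; field.
apply/cvgr0Pnorm_le => d d0.
have [B B0 hB] := cvgn_bounded e_ratio.
pose d' := d / (4 * B); have d'0 : 0 < d' by rewrite divr_gt0 ?mulr_gt0.
have /cvgr0Pnorm_le /(_ _ d'0) [N _ hN] := mean0.
pose C : R := \sum_(j < N) `|\sum_(k < j) (a k - 2^-1)|.
have C0 : 0 <= C by exact: sumr_ge0.
have tau n j : (j <= n)%N -> `|\sum_(k < j) (a k - 2^-1)| <= d' * n%:R + C.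
  move=> jn; have [Nj|jN] := leqP N j.
    case: j => [|j] in jn Nj *.
      by rewrite big_ord0 normr0; apply: addr_ge0 => //; apply: mulr_ge0 => //; exact: ltW.
    have := hN j.+1 Nj; rewrite normrM normfV normr_nat ler_pdivrMr // => h.
    apply: (le_trans h); apply: (@le_trans _ _ (d' * n%:R)).
      by rewrite ler_pM2l // ler_nat.
    by rewrite lerDl.
  apply: (@le_trans _ _ C); last by rewrite lerDr mulr_ge0 // ltW.
  by rewrite /C (bigD1 (Ordinal jN)) //= lerDl sumr_ge0.
have Cn : C * n%:R^-1 @[n --> \oo] --> (0 : R) by rewrite -(mulr0 C); apply: cvgMr.
move/cvgr0Pnorm_le: Cn => /(_ _ d'0) Cn.
near=> n.
have n0 : (0 : R) < n%:R by rewrite ltr0n; near: n; exists 1%N.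
have e0 := @central_gt0 R n.
rewrite normrM normfV (ger0_norm (ltW (mulr_gt0 n0 e0))) ler_pdivrMr ?mulr_gt0 //.
apply: (le_trans (@abel_le (fun k => a k - 2^-1) (fun k => e (n - k)%N) _ _ _ _ _)).
- by move=> k kK; apply: (tau n); apply: leq_trans kK (K_le n).
- by move=> k; rewrite ltW ?central_gt0.
- by move=> k _; apply: central_le; exact: leq_sub2l.
rewrite -/(m n).
have h1 : C <= d' * n%:R.
  have : `|C * n%:R^-1| <= d' by near: n.
  by rewrite ger0_norm ?ler_pdivrMr // mulr_ge0 ?invr_ge0 ?ler0n.
have h2 : e (m n) <= B * e n.
  have := hB n; rewrite ger0_norm ?ler_pdivrMr //.
  by rewrite divr_ge0 ?ltW ?central_gt0.
apply: (@le_trans _ _ (2 * (d' * n%:R + d' * n%:R) * (B * e n))).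
  apply: ler_pM => //.
  - by apply: mulr_ge0 => //; apply: addr_ge0 => //; apply: mulr_ge0 => //; exact: ltW.
  - by rewrite ltW ?central_gt0.
  - by rewrite ler_pM2l // lerD2l.
rewrite le_eqVlt; apply/orP; left; apply/eqP; rewrite /d'; field.
by rewrite gt_eqF.
Unshelve. all: end_near. Qed.

(** All the indices n - k tend to infinity together, so M_(n-k) may be replaced
by l e_(n-k) uniformly. *)
Lemma first_pick_cvg :
  (\sum_(k < K n) a k * M (n - k)%N) / (n%:R * M n) @[n --> \oo] --> 1 - Num.sqrt (1 - x).
Proof.
have B_cvg : (\sum_(k < K n) a k * e (n - k)%N) / (n%:R * e n) @[n --> \oo] --> 1 - y.
  have h : (\sum_(k < K n) (a k - 2^-1) * e (n - k)%N) / (n%:R * e n) +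
      2^-1 * ((\sum_(k < K n) e (n - k)%N) / (n%:R * e n)) @[n --> \oo] -->
      0 + 2^-1 * (2 * (1 - y)).
    by apply: cvgD; [exact: defect_cvg|apply: cvgMr; exact: sum_central_cvg].
  have e1 : 0 + 2^-1 * (2 * (1 - y)) = 1 - y by field.
  rewrite e1 in h; apply: cvg_trans h; apply: near_eq_cvg; apply: nearW => n.
  rewrite mulrA -mulrDl; congr (_ / _); rewrite big_distrr -big_split /=.
  by apply: eq_bigr => k _; ring.
have [l l0 hl] := ratio_cvg.
have D_cvg : (\sum_(k < K n) a k * M (n - k)%N) / (n%:R * e n) @[n --> \oo] --> l * (1 - y).
  have lB : l * ((\sum_(k < K n) a k * e (n - k)%N) / (n%:R * e n)) @[n --> \oo] --> l * (1 - y).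
    by apply: cvgMr.
  apply: cvg_sub0 lB; apply/cvgr0Pnorm_le => d d0.
  have [B B0 hB] := cvgn_bounded B_cvg.
  have dB : 0 < d / B by rewrite divr_gt0.
  have /cvgrPdist_le /(_ _ dB) [N _ hN] := hl.
  near=> n.
  have n0 : (0 : R) < n%:R by rewrite ltr0n; near: n; exists 1%N.
  have Nm : (N <= m n)%N by near: n; exact: (cvgnyPge _).1.
  have e0 := @central_gt0 R n.
  change (`|(\sum_(k < K n) a k * M (n - k)%N) / (n%:R * e n) -
    l * ((\sum_(k < K n) a k * e (n - k)%N) / (n%:R * e n))| <= d).
  rewrite mulrA -mulrBl big_distrr /= -sumrB normrM normfV.
  rewrite (ger0_norm (ltW (mulr_gt0 n0 e0))) ler_pdivrMr ?mulr_gt0 //.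
  apply: le_trans (ler_norm_sum _ _ _) _.
  apply: (@le_trans _ _ (\sum_(k < K n) d / B * (a k * e (n - k)%N))).
    apply: ler_sum => k _; have kK := ltn_ord k.
    have ek := @central_gt0 R (n - k).
    have -> : a k * M (n - k)%N - l * (a k * e (n - k)%N) =
        (a k * e (n - k)%N) * (M (n - k)%N / e (n - k)%N - l).
      by field; rewrite gt_eqF.
    have ae : 0 <= a k * e (n - k)%N by rewrite mulr_ge0 // ltW.
    rewrite normrM ger0_norm // mulrC ler_wpM2r // distrC; apply: hN => /=.
    exact: leq_trans Nm (leq_sub2l n (ltnW kK)).
  rewrite -big_distrr /=.
  have := hB n; rewrite ger0_norm; last first.
    rewrite divr_ge0 ?mulr_ge0 ?(ltW e0) //; apply: sumr_ge0 => k _.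
    by rewrite mulr_ge0 // ltW // central_gt0.
  rewrite ler_pdivrMr ?mulr_gt0 // -(ler_pM2l dB) => h.
  by apply: le_trans h _; rewrite mulrA divfK // gt_eqF.
  Unshelve. all: end_near.
have h : (\sum_(k < K n) a k * M (n - k)%N) / (n%:R * e n) * (M n / e n)^-1
   @[n --> \oo] --> l * (1 - y) * l^-1.
  by apply: cvgM => //; apply: cvgV => //; rewrite gt_eqF.
have -> : 1 - Num.sqrt (1 - x) = l * (1 - y) * l^-1.
  by rewrite -/y; field; rewrite gt_eqF.
apply: cvg_trans h; apply: near_eq_cvg; apply: nearW => n.
rewrite invf_div -mulrA; congr (_ * _); rewrite !invfM -mulrA; congr (_ * _).
by rewrite mulrA mulVf ?mul1r // gt_eqF ?central_gt0.
Qed.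

End FirstPickLimit.

Definition pick n k : R := a k * M (n - k)%N / (n%:R * M n).

Lemma pick_ge0 n k : 0 <= pick n k.
Proof. by rewrite /pick divr_ge0 ?mulr_ge0. Qed.

Lemma near_weight_gt0 : \forall n \near \oo, 0 < n%:R * M n.
Proof.
near=> n; have n0 : (0 < n)%N by near: n; exists 1%N.
have h : 0 < Num.sqrt n%:R * M n by near: n; move/cvgr_gt: M_cvg; exact.
by move: h; rewrite !pmulr_rgt0 ?sqrtr_gt0 ?ltr0n.
Unshelve. all: end_near. Qed.

Lemma sum_pick n : 0 < n%:R * M n -> \sum_(k < n.+1) pick n k = 1.
Proof. by move=> h; rewrite -big_distrl /= -M_rec divff // gt_eqF. Qed.

Lemma sum_pick_le n : \sum_(k < n.+1) pick n k <= 1.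
Proof.
rewrite -big_distrl /= -M_rec; have [->|h] := eqVneq (n%:R * M n) 0.
  by rewrite mul0r.
by rewrite divff.
Qed.

(** The mass that Beta(1,1/2) gives to the d-th cell. *)
Definition cell_prob D d : R := Num.sqrt (1 - d%:R / D%:R) - Num.sqrt (1 - d.+1%:R / D%:R).

Lemma pick_below_cvg D d : (d < D)%N ->
  \sum_(k < cell_start D d n) pick n k @[n --> \oo] --> 1 - Num.sqrt (1 - d%:R / D%:R).
Proof.
move=> dD; have D0 : (0 < D)%N by lia.
have D0R : 0 < D%:R :> R by rewrite ltr0n.
under eq_fun do rewrite -big_distrl /=.
apply: first_pick_cvg.
- by move=> n; apply: cell_start_le; exact: ltnW.
- by rewrite divr_ge0.
- by rewrite ltr_pdivrMr // mul1r ltr_nat.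
- exact: cell_start_cvg.
Qed.

Lemma sum_pick_below n d (f : nat -> R) D : (0 < D)%N -> (d <= D)%N ->
  \sum_(k < n.+1 | (D * k < d * n)%N) f k = \sum_(k < cell_start D d n) f k.
Proof.
move=> D0 dD; rewrite (big_ord_widen n.+1 f); last by rewrite leqW // cell_start_le.
by apply: eq_bigl => k; rewrite cell_start_gt.
Qed.

(** [first_pick_cvg] needs x < 1; for the last cell the upper limit is replaced by
the full sum, which is 1. *)
Lemma cell_cvg D d : (d < D)%N ->
  \sum_(k < n.+1 | pick_cell D k n == d) pick n k @[n --> \oo] --> cell_prob D d.
Proof.
move=> dD; have D0 : (0 < D)%N by lia.
have D0R : 0 < D%:R :> R by rewrite ltr0n.
pose G n := if (d.+1 < D)%N then \sum_(k < cell_start D d.+1 n) pick n k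
   else \sum_(k < n.+1) pick n k.
have Gc : G n @[n --> \oo] --> 1 - Num.sqrt (1 - d.+1%:R / D%:R).
  rewrite /G; case: ltnP => dD1; first exact: pick_below_cvg.
  have -> : d.+1 = D by lia.
  rewrite divff ?gt_eqF // subrr sqrtr0 subr0.
  have h : (fun=> 1 : R) @ \oo --> (1 : R) by exact: cvg_cst.
  apply: cvg_trans h; apply: near_eq_cvg; near=> n.
  by rewrite sum_pick //; near: n; exact: near_weight_gt0.
have -> : cell_prob D d = (1 - Num.sqrt (1 - d.+1%:R / D%:R)) - (1 - Num.sqrt (1 - d%:R / D%:R)).
  by rewrite /cell_prob; ring.
apply: cvg_trans (cvgB Gc (pick_below_cvg dD)); apply: near_eq_cvg; near=> n.
have n0 : (0 < n)%N by near: n; exists 1%N.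
change (G n - \sum_(k < cell_start D d n) pick n k =
  \sum_(k < n.+1 | pick_cell D k n == d) pick n k).
apply/eqP; rewrite subr_eq; apply/eqP.
have -> : G n = \sum_(k < n.+1 | (pick_cell D k n <= d)%N) pick n k.
  rewrite /G; case: ltnP => dD1.
    rewrite -sum_pick_below //; apply: eq_bigl => k.
    by rewrite -[RHS]negbK -ltnNge pick_cell_ge // -ltnNge.
  by apply: eq_bigl => k; have := pick_cell_lt k n D0; lia.
rewrite -sum_pick_below // 1?ltnW // (bigID (fun k : 'I_n.+1 => pick_cell D k n == d)) /=.
congr (_ + _); apply: eq_bigl => k; first by lia.
by have := pick_cell_ge k n0 dD; lia.
Unshelve. all: end_near. Qed.

(** The limiting distribution function is continuous at 1, so picks that leave a
bounded number j of vertices have vanishing probability.  This discards the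
sizes of the remaining mapping for which no asymptotics hold. *)
Lemma pick_diag_cvg0 j : pick n (n - j) @[n --> \oo] --> (0 : R).
Proof.
apply/cvgr0Pnorm_le => e e0.
pose D := (Num.truncn (4 / e ^+ 2)).+1.
have D0R : 0 < D%:R :> R by rewrite ltr0n.
have De : Num.sqrt (D%:R^-1) <= e / 2.
  rewrite -[leRHS]ger0_norm ?divr_ge0 ?(ltW e0) // -sqrtr_sqr ler_wsqrtr //.
  have : 4 / e ^+ 2 < D%:R by exact: truncnS_gt.
  rewrite ltr_pdivrMr ?exprn_gt0 // => h.
  by rewrite -[leLHS]mul1r ler_pdivrMr //; nra.
have st := @pick_below_cvg D D.-1 (leqnn _).
have e2 : 0 < e / 2 by rewrite divr_gt0.
move/cvgrPdist_le: (st) => /(_ _ e2) h.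
have minf : (n - cell_start D D.-1 n)%N @[n --> \oo] --> \oo.
  have hc := @cell_start_cvg R D D.-1 isT.
  have h1 : 1 - (cell_start D D.-1 n)%:R / n%:R @[n --> \oo] --> 1 - (D.-1%:R / D%:R : R).
    by apply: cvgB => //; exact: cvg_cst.
  have p : 0 < 1 - (D.-1%:R / D%:R : R) by rewrite subr_gt0 ltr_pdivrMr // mul1r ltr_nat.
  apply: (cvg_nat_of_ratio p); apply: cvg_trans h1; apply: near_eq_cvg; near=> n.
  have n0 : (n%:R : R) != 0 by rewrite pnatr_eq0 -lt0n; near: n; exists 1%N.
  by rewrite natrB ?cell_start_le ?leq_pred //; field.
near=> n; have jn : (j <= n - cell_start D D.-1 n)%N by near: n; exact: (cvgnyPge _).1.
have n0 : (0 < n)%N by near: n; exists 1%N.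
have nM : 0 < n%:R * M n by near: n; exact: near_weight_gt0.
have hn : `|1 - Num.sqrt (1 - D.-1%:R / D%:R) - \sum_(k < cell_start D D.-1 n) pick n k| <= e / 2.
  by near: n.
rewrite ger0_norm ?pick_ge0 //.
have cs : (cell_start D D.-1 n <= n.+1)%N by rewrite leqW // cell_start_le // leq_pred.
have : pick n (n - j) + \sum_(k < cell_start D D.-1 n) pick n k <= 1.
  rewrite -(sum_pick nM) (big_ord_widen n.+1 _ cs).
  have nj : (n - j < n.+1)%N by rewrite ltnS leq_subr.
  rewrite [leRHS](bigD1 (Ordinal nj)) //= lerD2l.
  rewrite [leRHS](bigID (fun k : 'I_n.+1 => (k < cell_start D D.-1 n)%N)) /=.
  rewrite -[leLHS]addr0; apply: lerD; last by apply: sumr_ge0 => k _; exact: pick_ge0.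
  rewrite le_eqVlt; apply/orP; left; apply/eqP; apply: eq_bigl => k.
  rewrite -val_eqE /=; case: ltnP => kc; rewrite ?andbF ?andbT //.
  have := cell_start_le n (leq_pred D); move: kc jn; clear; set u := cell_start _ _ _.
  by move=> kc jn un; apply/esym/eqP; lia.
have e1 : 1 - D.-1%:R / D%:R = D%:R^-1 :> R.
  have De' : D%:R = D.-1%:R + 1 :> R by rewrite natr1.
  rewrite De'; field; by rewrite -De' gt_eqF.
rewrite e1 in hn; move: hn; rewrite ler_norml => /andP[h1 h2].
move: De h1 h2; move: (Num.sqrt _) (pick n (n - j)) => *; lra.
Unshelve. all: end_near. Qed.

End FirstPick.

(** * Size-biased picks of components *)

Lemma perm_rem (T : eqType) (x : T) s s' : perm_eq s s' -> perm_eq (rem x s) (rem x s').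
Proof.
move=> ss; case: (boolP (x \in s)) => xs.
  have xs' : x \in s' by rewrite -(perm_mem ss).
  by rewrite -(perm_cons x) -(permPl (perm_to_rem xs)) -(permPr (perm_to_rem xs')).
by rewrite !rem_id // -(perm_mem ss).
Qed.

Lemma sumn_rem (s : seq nat) x : x \in s -> sumn s = (x + sumn (rem x s))%N.
Proof. by move=> /perm_to_rem /perm_sumn ->. Qed.

Lemma sum_tuple_cons (R : realType) D J (F : J.+1.-tuple 'I_D -> R) :
  \sum_(ds : J.+1.-tuple 'I_D) F ds =
  \sum_(d < D) \sum_(ds : J.-tuple 'I_D) F [tuple of d :: ds].
Proof.
rewrite pair_big /= (reindex (fun x : 'I_D * J.-tuple 'I_D => [tuple of x.1 :: x.2])) //.
exists (fun ds : J.+1.-tuple 'I_D => (thead ds, [tuple of behead ds])) => x _.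
  by case: x => d ds; congr pair; apply: val_inj.
by rewrite -tuple_eta.
Qed.

Section CellLaw.
Variables (R : realType) (D : nat).

(** The probability that successive size-biased picks without replacement from
the sizes s have relative sizes in the cells ds, each size being taken relative
to what is left. *)
Fixpoint cell_law (ds s : seq nat) : R :=
  if ds is d :: ds' then
    \sum_(x <- s) (pick_cell D x (sumn s) == d)%:R * (x%:R / (sumn s)%:R) * cell_law ds' (rem x s)
  else 1.

Lemma perm_cell_law ds s s' : perm_eq s s' -> cell_law ds s = cell_law ds s'.
Proof.
elim: ds s s' => //= d ds IH s s' ss; rewrite (perm_big _ ss) (perm_sumn ss) /=.
by apply: eq_bigr => x _; rewrite (IH _ _ (perm_rem x ss)).
Qed.

Lemma cell_law_ge0 ds s : 0 <= cell_law ds s.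
Proof. by elim: ds s => //= d ds IH s; apply: sumr_ge0 => x _; rewrite !mulr_ge0. Qed.

Lemma sum_fractions_le (s : seq nat) (F : nat -> R) : (forall x, F x <= 1) ->
  \sum_(x <- s) x%:R / (sumn s)%:R * F x <= 1.
Proof.
move=> F1; apply: (@le_trans _ _ (\sum_(x <- s) x%:R / (sumn s)%:R)).
  by apply: ler_sum => x _; rewrite ler_piMr.
rewrite -big_distrl /= -natr_sum -sumnE.
by have [->|h] := eqVneq (sumn s)%:R (0 : R); rewrite ?mul0r // divff.
Qed.

(** Only an inequality holds: when the components are exhausted before J picks,
the remaining mass is lost. *)
Lemma sum_cell_law_le J s : \sum_(ds : J.-tuple 'I_D) cell_law (map val ds) s <= 1.
Proof.
elim: J s => [|J IH] s.
  by rewrite (bigD1 [tuple]) //= big1 ?addr0 // => ds /eqP []; apply: val_inj; rewrite tuple0.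
rewrite sum_tuple_cons.
rewrite /=; under eq_bigr => d _ do rewrite exchange_big /=.
rewrite exchange_big /=.
apply: (le_trans _ (sum_fractions_le s
  (F := fun x => \sum_(ds : J.-tuple 'I_D) cell_law (map val ds) (rem x s)) (fun x => IH _))).
apply: ler_sum => x _; rewrite big_distrr exchange_big /=; apply: ler_sum => ds _.
rewrite -big_distrl -big_distrl /= -mulrA ler_piMl ?mulr_ge0 ?cell_law_ge0 //.
rewrite -natr_sum -[1]/(1%:R) ler_nat.
case: (ltnP (pick_cell D x (sumn s)) D) => h; last first.
  by rewrite big1 // => d _; case: eqP => // e; have := ltn_ord d; lia.
rewrite (bigD1 (Ordinal h)) //= eqxx big1 // => d dh.
by case: eqP => // e; case/eqP: dh; apply: val_inj.
Qed.

Lemma cell_law_le1 ds s : cell_law ds s <= 1.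
Proof.
elim: ds s => //= d ds IH s; apply: (le_trans _ (sum_fractions_le s (F := fun x => cell_law ds (rem x s)) (fun x => IH _))).
apply: ler_sum => x _; rewrite -mulrA ler_piMl ?mulr_ge0 ?cell_law_ge0 //.
by case: (_ == _).
Qed.

End CellLaw.

Lemma sumn_component_sizes n (f : {ffun 'I_n -> 'I_n}) : sumn (component_sizes f) = n.
Proof.
rewrite (perm_sumn (perm_component_sizes f)) sumnE big_map big_enum /=.
have part : finset.partition (mapping_components f) [set: 'I_n]%SET.
  apply: equivalence_partitionP => x y z _ _ _; split=> [|xy]; first exact: connect0.
  exact: (same_connect (connect_mapping_edge_sym f)).
by rewrite -(card_partition part) cardsT card_ord.
Qed.

Section MappingCells.
Variables (R : realType) (p : R).
Hypotheses (p_gt0 : 0 < p) (p_lt1 : p < 1).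
Variable t : R.
Hypotheses (t01 : 0 < t < 1) (dt : drate p t = 0).

Lemma mapping_weight_ge0 n (S : {set 'I_n}) : 0 <= mapping_weight p S.
Proof. by rewrite /mapping_weight mulr_ge0 ?exprn_ge0 ?subr_ge0 // ltW. Qed.

Lemma total_weight_ge0 n : 0 <= total_weight n p.
Proof. by apply: sumr_ge0 => x _; exact: mapping_weight_ge0. Qed.

Lemma connected_weight_ge0 n : 0 <= connected_weight p n.
Proof. by apply: sumr_ge0 => x _; exact: mapping_weight_ge0. Qed.

Lemma mapping_total_le n (h : seq nat -> R) : (forall s, `|h s| <= 1) ->
  `|mapping_total p n h| <= total_weight n p.
Proof.
move=> h1; apply: le_trans (ler_norm_sum _ _ _) _; apply: ler_sum => x _.
by rewrite normrM ger0_norm ?mapping_weight_ge0 // ler_piMr ?mapping_weight_ge0.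
Qed.

(** The factor k is that of the size bias. *)
Definition scaled_connected k : R :=
  k%:R * (connected_weight p k / k`!%:R * expR (- (growth p t * k%:R))).

Notation M := (scaled_weight p t).
Notation a := scaled_connected.

Lemma scaled_weight_ge0 n : 0 <= M n.
Proof. by rewrite /scaled_weight !mulr_ge0 ?total_weight_ge0 ?expR_ge0 ?invr_ge0. Qed.

Lemma scaled_connected_ge0 n : 0 <= a n.
Proof. by rewrite /scaled_connected !mulr_ge0 ?connected_weight_ge0 ?expR_ge0 ?invr_ge0. Qed.

Lemma scaled_weight0 : M 0%N = 1.
Proof.
rewrite /scaled_weight total_weight_sum big_ord_recr big_ord0 /=.
by rewrite bin0 !expr0 mulr0 oppr0 expR0 fact0 invr1 add0r !mulr1.
Qed.

Lemma scaled_pick n k : (k <= n)%N ->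
  'C(n, k)%:R * (connected_weight p k * total_weight (n - k) p) * k%:R
    / n`!%:R * expR (- (growth p t * n%:R)) = a k * M (n - k).
Proof.
move=> kn; rewrite /scaled_connected /scaled_weight.
have -> : expR (- (growth p t * n%:R)) =
    expR (- (growth p t * k%:R)) * expR (- (growth p t * (n - k)%:R)).
  by rewrite -expRD; congr expR; rewrite natrB //; ring.
have := bin_fact kn => /(congr1 (fun k => k%:R : R)); rewrite !natrM => <-.
by field; rewrite !pnatr_eq0 -!lt0n !fact_gt0 bin_gt0 kn.
Qed.

Lemma eq_mapping_total n (h h' : seq nat -> R) :
  (forall f : {ffun 'I_n -> 'I_n}, h (component_sizes f) = h' (component_sizes f)) ->
  mapping_total p n h = mapping_total p n h'.
Proof. by move=> hh; apply: eq_bigr => x _; rewrite hh. Qed.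

Lemma mapping_totalZ n (h : seq nat -> R) (c : R) :
  mapping_total p n (fun s => c * h s) = c * mapping_total p n h.
Proof. by rewrite /mapping_total big_distrr /=; apply: eq_bigr => x _; ring. Qed.

(** [mapping_total_pick] for the weight k: the sizes of the components add up
to n. *)
Lemma scaled_weight_rec n : n%:R * M n = \sum_(k < n.+1) a k * M (n - k)%N.
Proof.
have : n%:R * total_weight n p =
    \sum_(k < n.+1) 'C(n, k)%:R * (connected_weight p k * total_weight (n - k) p) * k%:R.
  rewrite total_weightE -mapping_totalZ.
  rewrite (@eq_mapping_total _ _ (fun s => \sum_(x <- s) x%:R)).
    rewrite (@mapping_total_pick R p n (fun x _ => x%:R)) //; apply: eq_bigr => k _.
    rewrite -!mulrA; congr (_ * (_ * _)); rewrite total_weightE mulrC -mapping_totalZ.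
    by apply: eq_bigr => x _; rewrite mulr1.
  by move=> f /=; rewrite mulr1 -natr_sum -sumnE sumn_component_sizes.
move=> h; rewrite /scaled_weight mulrA mulrA h !big_distrl /=.
by apply: eq_bigr => k _; rewrite scaled_pick // -ltnS.
Qed.

Variable D : nat.

Definition cell_mean ds n : R := mapping_total p n (cell_law R D ds) / total_weight n p.

(** After the first pick, what is left is again a random mapping, of the smaller
size n - k. *)
Lemma cell_mean_rec d ds n : cell_mean (d :: ds) n =
  \sum_(k < n.+1) (pick_cell D k n == d)%:R * pick M a n k * cell_mean ds (n - k).
Proof.
rewrite /cell_mean.
rewrite (@eq_mapping_total _ _ (fun s => \sum_(x <- s)
  (pick_cell D x n == d)%:R * (x%:R / n%:R) * cell_law R D ds (rem x s))); last first.
  by move=> f /=; rewrite sumn_component_sizes.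
rewrite (@mapping_total_pick R p n (fun x r =>
  (pick_cell D x n == d)%:R * (x%:R / n%:R) * cell_law R D ds r)); last first.
  by move=> k s s' ss; rewrite (perm_cell_law R D ds ss).
rewrite big_distrl /=; apply: eq_bigr => k _.
have kn : (k <= n)%N by rewrite -ltnS.
rewrite mapping_totalZ /pick -scaled_pick //.
set T := mapping_total _ _ _; set Wk := total_weight (n - k) p.
(* The division by the total weight is harmless even if it vanishes, as for
   size 1: then T vanishes too. *)
have TW : T = T / Wk * Wk.
  have [W0|W0] := eqVneq Wk 0; last by rewrite divfK.
  rewrite W0 mulr0; apply/eqP; rewrite -normr_le0 -W0; apply: mapping_total_le => s.
  by rewrite ger0_norm ?cell_law_ge0 // cell_law_le1.
rewrite {1}TW /scaled_weight; move: (T / Wk) => th.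
have [->|n0] := eqVneq (n%:R : R) 0; first by rewrite invr0 !(mul0r, mulr0, invr0).
have [W0|W0] := eqVneq (total_weight n p) 0.
  by rewrite W0 !(mul0r, mulr0, invr0).
have f0 : n`!%:R != 0 :> R by rewrite pnatr_eq0 -lt0n fact_gt0.
have e0 := gt_eqF (expR_gt0 (- (growth p t * n%:R))).
by field; rewrite ?n0 ?W0 ?f0 ?e0.
Qed.

(** Induction on the number of picks: the mean for the remaining size is within
o(1) of its limit, except for bounded remaining sizes, which have vanishing
probability by [pick_diag_cvg0]. *)
Lemma cell_mean_cvg ds : all (fun d => d < D)%N ds ->
  cell_mean ds n @[n --> \oo] --> \prod_(d <- ds) cell_prob R D d.
Proof.
have [c c0 Mc] := scaled_weight_cvg p_gt0 p_lt1 t01 dt.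
have Mgt := near_weight_gt0 c0 Mc.
elim: ds => [_|d ds IH /= /andP[dD /IH {}IH]].
  rewrite big_nil; have h : (fun=> 1 : R) @ \oo --> (1 : R) by exact: cvg_cst.
  apply: cvg_trans h; apply: near_eq_cvg; near=> n.
  have : 0 < n%:R * M n by near: n.
  rewrite /cell_mean (_ : mapping_total _ _ _ = total_weight n p); last by rewrite total_weightE.
  rewrite /scaled_weight => h; rewrite divff //; apply/eqP => W0.
  by move: h; rewrite W0 !(mul0r, mulr0) ltxx.
rewrite big_cons; set L := \prod_(_ <- _) _ in IH *.
have main := cell_cvg scaled_weight0 scaled_weight_ge0 scaled_connected_ge0 scaled_weight_rec c0 Mc dD.
have eps0 : cell_mean ds n - L @[n --> \oo] --> 0.
  by rewrite -(subrr L); apply: cvgB => //; exact: cvg_cst.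
have err : \sum_(j < n.+1) ((pick_cell D (n - j) n == d)%:R * pick M a n (n - j)) *
    (cell_mean ds j - L) @[n --> \oo] --> 0.
  apply: (@toeplitz_cvg0 R (fun n j => (pick_cell D (n - j) n == d)%:R * pick M a n (n - j))
    (fun j => cell_mean ds j - L) 1) => //.
  - by move=> n j _; rewrite mulr_ge0 // pick_ge0 //; [exact: scaled_weight_ge0|exact: scaled_connected_ge0].
  - move=> n; apply: le_trans (sum_pick_le scaled_weight_rec n).
    rewrite [leRHS](reindex_inj rev_ord_inj) /=; apply: ler_sum => j _; rewrite subSS.
    rewrite ler_piMl ?pick_ge0 //; [exact: scaled_weight_ge0|exact: scaled_connected_ge0|].
    by case: (_ == _).
  - move=> j; apply: squeeze_cvgr (cvg_cst 0)
      (pick_diag_cvg0 scaled_weight0 scaled_weight_ge0 scaled_connected_ge0 scaled_weight_rec c0 Mc j).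
    apply: nearW => n; rewrite mulr_ge0 ?pick_ge0 //=; [|exact: scaled_weight_ge0|exact: scaled_connected_ge0].
    rewrite ler_piMl ?pick_ge0 //; [exact: scaled_weight_ge0|exact: scaled_connected_ge0|].
    by case: (_ == _).
have h : (\sum_(k < n.+1 | pick_cell D k n == d) pick M a n k) * L +
   \sum_(j < n.+1) ((pick_cell D (n - j) n == d)%:R * pick M a n (n - j)) *
    (cell_mean ds j - L) @[n --> \oo] --> cell_prob R D d * L + 0.
  by apply: cvgD err; apply: cvgMl.
rewrite addr0 in h; apply: cvg_trans h; apply: near_eq_cvg; apply: nearW => n.
rewrite cell_mean_rec [X in _ + X](reindex_inj rev_ord_inj) big_mkcond big_distrl /= -big_split /=.
apply: eq_bigr => k _; rewrite subSS.
have -> : (n - (n - k) = k)%N by have := ltn_ord k; lia.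
by case: (pick_cell D k n == d) => /=; ring.
Unshelve. all: end_near. Qed.

End MappingCells.

(** * Decreasing rearrangements and stick breaking *)

Section Rearrangement.
Variable R : realType.
Implicit Types (u v X Y : nat -> R).

(** If Y j exceeded X j by more than eta, then j + 1 entries of u would be larger
than X j, while at most j entries are. *)
Lemma rearrangement_le u v X Y (eta : R) j :
  decreasing_rearrangement u X -> decreasing_rearrangement v Y ->
  (forall i, `|u i - v i| <= eta) -> Y j - X j <= eta.
Proof.
move=> [dX [s [s' sK s'K] Xs]] [dY [r [r' rK r'K] Yr]] uv.
rewrite leNgt; apply/negP => lt.
have big k : (k <= j)%N -> X j < u (r k).
  move=> kj; have := uv (r k); rewrite ler_norml => /andP[h _].
  have := dY k j kj; rewrite (Yr k); lra.
have pos k : (k <= j)%N -> (s' (r k) < j)%N.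
  move=> kj; rewrite ltnNge; apply/negP => js.
  have := dX _ _ js; rewrite [X (s' _)]Xs s'K leNgt => /negP; apply; exact: big.
pose f (k : 'I_j.+1) : 'I_j := Ordinal (pos k (ltn_ord k)).
have f_inj : injective f.
  move=> a b /(congr1 val) /= /(congr1 s); rewrite !s'K => /(congr1 r').
  by rewrite !rK => ?; exact: val_inj.
by have := leq_card f f_inj; rewrite !card_ord ltnn.
Qed.

Lemma rearrangement_close u v X Y (eta : R) j :
  decreasing_rearrangement u X -> decreasing_rearrangement v Y ->
  (forall i, `|u i - v i| <= eta) -> `|X j - Y j| <= eta.
Proof.
move=> uX vY uv; have := rearrangement_le j uX vY uv.
have := @rearrangement_le _ _ _ _ eta j vY uX (fun i => _ : `|v i - u i| <= eta).
move=> /(_ ltac:(by move=> i; rewrite distrC)) h1 h2.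
by rewrite ler_norml; apply/andP; split; lra.
Qed.

Lemma rearrangement_bounds u X (lo hi : R) j : decreasing_rearrangement u X ->
  (forall i, lo <= u i <= hi) -> lo <= X j <= hi.
Proof. by move=> [_ [s _ ->]]. Qed.

(** The sequences are padded with a default value, so the permutation of the
indices is extended by the identity. *)
Lemma perm_eq_bij (T : eqType) (x0 : T) (s s' : seq T) : perm_eq s' s ->
  exists2 r : nat -> nat, bijective r & forall k, nth x0 s' k = nth x0 s (r k).
Proof.
move=> /(perm_iotaP x0)[Is pI ->].
have sI : size Is = size s by rewrite (perm_size pI) size_iota.
have uI : uniq Is by rewrite (perm_uniq pI) iota_uniq.
have mI i : (i \in Is) = (i < size s)%N by rewrite (perm_mem pI) mem_iota.
exists (fun k => if (k < size s)%N then nth 0%N Is k else k).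
  exists (fun i => if (i < size s)%N then index i Is else i) => k /=.
    case: (ltnP k (size s)) => ks; last by rewrite ltnNge ks.
    by rewrite -mI mem_nth ?sI // index_uniq ?sI.
  case: (ltnP k (size s)) => ks; last by rewrite ltnNge ks.
  by rewrite -sI index_mem mI ks nth_index // mI.
move=> k; case: ifP => ks; first by rewrite (nth_map 0%N) // sI.
by rewrite !nth_default ?size_map ?sI // leqNgt ks.
Qed.

Lemma sort_rearrangement (s : seq R) : all (>= 0) s ->
  decreasing_rearrangement (nth 0 s) (nth 0 (sort >=%R s)).
Proof.
move=> s0; split; last by apply: perm_eq_bij; rewrite perm_sort.
have so : sorted >=%R (sort >=%R s) by apply: sort_sorted => x y; exact: le_total.
move=> i j ij; have [js|js] := ltnP j (size (sort >=%R s)).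
  by apply: (sorted_leq_nth _ _ _ so) => //; rewrite ?inE ?(leq_ltn_trans ij js) //;
     [move=> x y z /= h1 h2; exact: le_trans h2 h1 | exact: lexx].
rewrite [leLHS]nth_default //; have [is_|is_] := ltnP i (size (sort >=%R s)).
  have := mem_nth 0 is_; rewrite mem_sort; exact: (allP s0).
by rewrite nth_default.
Qed.

Lemma component_size_rearrangement n (f : {ffun 'I_n -> 'I_n}) (s : seq nat) (c : R) :
  0 <= c -> perm_eq (component_sizes f) s ->
  decreasing_rearrangement (fun i => (nth 0%N s i)%:R * c)
    (fun j => (component_size f j)%:R * c).
Proof.
move=> c0 ps; split; last first.
  have [r rb h] := perm_eq_bij 0%N ps; exists r => // k.
  by rewrite /component_size h.
have so : sorted geq (component_sizes f) by apply: sort_sorted => x y; exact: leq_total.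
move=> i j ij; rewrite ler_wpM2r // ler_nat /component_size.
have [js|js] := ltnP j (size (component_sizes f)); last by rewrite nth_default.
by apply: (sorted_leq_nth _ _ _ so) => //; rewrite ?inE ?(leq_ltn_trans ij js) //;
  [move=> x y z /= h1 h2; exact: leq_trans h2 h1|move=> x; exact: leqnn].
Qed.

End Rearrangement.

Section Sticks.
Variable R : realType.
Implicit Types (b : nat -> R).

(** What is left of the stick after i breaks. *)
Definition stick_rest b i : R := \prod_(j < i) (1 - b j).

Lemma stick_rest_bounds b i : (forall j, 0 <= b j <= 1) -> 0 <= stick_rest b i <= 1.
Proof.
move=> b01; rewrite /stick_rest; elim: i => [|i /andP[IH1 IH2]].
  by rewrite big_ord0 ler01 lexx.
by rewrite big_ord_recr /=; have /andP[b0 b1] := b01 i; apply/andP; split; nra.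
Qed.

Lemma stick_bounds b i : (forall j, 0 <= b j <= 1) ->
  0 <= stick_breaking b i <= stick_rest b i.
Proof.
move=> b01; rewrite /stick_breaking -/(stick_rest b i).
have /andP[r0 r1] := stick_rest_bounds i b01; have /andP[b0 b1] := b01 i.
by apply/andP; split; nra.
Qed.

Lemma stick_rest_le b i j : (forall j, 0 <= b j <= 1) -> (i <= j)%N ->
  stick_rest b j <= stick_rest b i.
Proof.
move=> b01; move: i j; apply: (homo_leq (fun x => lexx x) (fun _ _ _ h1 h2 => le_trans h2 h1)).
move=> i; rewrite /stick_rest big_ord_recr /= -/(stick_rest b i).
by have /andP[r0 r1] := stick_rest_bounds i b01; have /andP[b0 b1] := b01 i; nra.
Qed.

Lemma stick_rest_close b b' (e : R) i : (forall j, 0 <= b j <= 1) ->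
  (forall j, 0 <= b' j <= 1) -> (forall j, (j < i)%N -> `|b j - b' j| <= e) ->
  `|stick_rest b i - stick_rest b' i| <= i%:R * e.
Proof.
move=> b01 b01' be; elim: i be => [|i IH] be.
  by rewrite /stick_rest !big_ord0 subrr normr0 mul0r.
have {}IH := IH (fun j ji => be j (ltnW ji)); have := be i (ltnSn i).
rewrite /stick_rest !big_ord_recr /= -!/(stick_rest _ i) -natr1.
have /andP[r0 r1] := stick_rest_bounds i b01'; have /andP[b0 b1] := b01 i.
move: IH; move: (stick_rest b i) (stick_rest b' i) r0 r1 => r r' r0 r1.
rewrite !ler_norml => /andP[h1 h2] /andP[h3 h4].
apply/andP; split; nra.
Qed.

Lemma stick_close b b' (e : R) i : (forall j, 0 <= b j <= 1) ->
  (forall j, 0 <= b' j <= 1) -> (forall j, (j <= i)%N -> `|b j - b' j| <= e) ->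
  `|stick_breaking b i - stick_breaking b' i| <= i.+1%:R * e.
Proof.
move=> b01 b01' be; rewrite /stick_breaking -!/(stick_rest _ i) -natr1.
have := stick_rest_close b01 b01' (fun j ji => be j (ltnW ji)); have := be i (leqnn i).
have /andP[r0 r1] := stick_rest_bounds i b01'; have /andP[b0 b1] := b01 i.
move: (stick_rest b i) (stick_rest b' i) r0 r1 => r r' r0 r1.
rewrite !ler_norml => /andP[h1 h2] /andP[h3 h4].
apply/andP; split; nra.
Qed.

End Sticks.

Section CellPoints.
Variables (R : realType) (D : nat).
Hypothesis D_gt0 : (0 < D)%N.

(** Left ends of the cells are used as approximate proportions. *)
Definition cell_fraction (ds : seq nat) (i : nat) : R := (nth 0%N ds i)%:R / D%:R.

(** The approximate decreasing sequence: the first pieces of the stick, broken at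
the left ends of the cells, in decreasing order and then 0. *)
Definition cell_point (ds : seq nat) : nat -> R :=
  nth 0 (sort >=%R (mkseq (stick_breaking (cell_fraction ds)) (size ds))).

Definition cell_error (ds : seq nat) : R :=
  (size ds)%:R / D%:R + stick_rest (cell_fraction ds) (size ds).

Lemma cell_fraction_bounds ds i : all (fun d => d < D)%N ds -> 0 <= cell_fraction ds i <= 1.
Proof.
move=> dsD; rewrite /cell_fraction divr_ge0 //= ler_pdivrMr ?ltr0n // mul1r ler_nat.
have [h|h] := ltnP i (size ds); last by rewrite nth_default.
by apply: ltnW; apply: (allP dsD); exact: mem_nth.
Qed.

Lemma cell_point_rearrangement ds : all (fun d => d < D)%N ds ->
  decreasing_rearrangement
    (fun i => if (i < size ds)%N then stick_breaking (cell_fraction ds) i else 0)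
    (cell_point ds).
Proof.
move=> dsD; have := @sort_rearrangement R (mkseq (stick_breaking (cell_fraction ds)) (size ds)).
have -> : nth 0 (mkseq (stick_breaking (cell_fraction ds)) (size ds)) =
   (fun i => if (i < size ds)%N then stick_breaking (cell_fraction ds) i else 0).
  apply/funext => i; case: ltnP => h; first by rewrite nth_mkseq.
  by rewrite nth_default // size_mkseq.
apply; apply/allP => _ /mapP[i _ ->] /=.
by have /andP[] := stick_bounds i (fun j => cell_fraction_bounds j dsD).
Qed.

(** The first pieces are known up to J/D and every later piece is smaller than
the stick left; one bound then serves for all indices of the rearrangement. *)
Lemma cell_point_close ds (u b X : nat -> R) j : all (fun d => d < D)%N ds ->
  decreasing_rearrangement u X -> (forall i, 0 <= b i <= 1) ->
  (forall i, (i < size ds)%N -> `|b i - cell_fraction ds i| <= D%:R^-1) ->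
  (forall i, (i < size ds)%N -> u i = stick_breaking b i) ->
  (forall i, (size ds <= i)%N -> 0 <= u i <= stick_rest b (size ds)) ->
  `|X j - cell_point ds j| <= cell_error ds.
Proof.
move=> dsD uX b01 bd uh ut.
have c01 i := cell_fraction_bounds i dsD.
apply: (rearrangement_close _ uX (cell_point_rearrangement dsD)) => i.
have /andP[r0 r1] := stick_rest_bounds (size ds) c01.
rewrite /cell_error; case: ltnP => h.
  rewrite uh //; apply: le_trans (stick_close b01 c01 (fun j ji => bd j (leq_ltn_trans ji h))) _.
  by rewrite -[leLHS]addr0 lerD // ler_wpM2r ?invr_ge0 // ler_nat.
have /andP[u0 u1] := ut i h; rewrite subr0 ger0_norm // (le_trans u1) //.
by have := stick_rest_close b01 c01 bd; rewrite ler_norml => /andP[_]; lra.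
Qed.

Lemma cell_point_bounds ds j : all (fun d => d < D)%N ds -> 0 <= cell_point ds j <= 1.
Proof.
move=> dsD; apply: (rearrangement_bounds _ (cell_point_rearrangement dsD)) => i.
have c01 i' := cell_fraction_bounds i' dsD.
case: ifP => _; last by rewrite lexx ler01.
have /andP[s0 s1] := stick_bounds i c01; have /andP[_ r1] := stick_rest_bounds i c01.
by rewrite s0 (le_trans s1).
Qed.

Lemma pick_cell_close k n : (0 < n)%N -> (k <= n)%N ->
  `|k%:R / n%:R - (pick_cell D k n)%:R / D%:R| <= D%:R^-1 :> R.
Proof.
move=> n0 kn; have D0R : 0 < D%:R :> R by rewrite ltr0n.
have n0R : 0 < n%:R :> R by rewrite ltr0n.
have dD := pick_cell_lt k n D_gt0; set d := pick_cell D k n in dD *.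
have h1 : (d * n <= D * k)%N by rewrite -(pick_cell_ge k n0 dD).
have h2 : (D * k <= d.+1 * n)%N.
  case: (ltnP d.+1 D) => hD; last by rewrite (_ : d.+1 = D) ?leq_mul2l ?kn ?orbT //; lia.
  by have := pick_cell_ge k n0 hD; rewrite -/d ltnn => /esym/negbT; rewrite -ltnNge => /ltnW.
have {}h1 : d%:R * n%:R <= D%:R * k%:R :> R by rewrite -!natrM ler_nat.
have {}h2 : D%:R * k%:R <= (d%:R + 1) * n%:R :> R by rewrite natr1 -!natrM ler_nat.
have -> : k%:R / n%:R - d%:R / D%:R = (D%:R * k%:R - d%:R * n%:R) / n%:R / D%:R :> R.
  by field; rewrite !gt_eqF.
rewrite ger0_norm; last by rewrite !divr_ge0 // subr_ge0.
by rewrite -[leRHS]mul1r ler_pM2r ?invr_gt0 // ler_pdivrMr //; lra.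
Qed.

Lemma stick_rest_shift (b : nat -> R) x i :
  stick_rest (fun i => if i is i'.+1 then b i' else x) i.+1 = (1 - x) * stick_rest b i.
Proof. by rewrite /stick_rest big_ord_recl. Qed.

Lemma stick_shift (b : nat -> R) x i :
  stick_breaking (fun i => if i is i'.+1 then b i' else x) i.+1 =
  (1 - x) * stick_breaking b i.
Proof.
by have := stick_rest_shift b x i; rewrite /stick_breaking /stick_rest => ->; ring.
Qed.

Lemma nth_le_sumn (s : seq nat) i : (nth 0%N s i <= sumn s)%N.
Proof.
elim: s i => [|x s IH] [|i] //=; first exact: leq_addr.
by rewrite (leq_trans (IH i)) // leq_addl.
Qed.

(** A positive probability of ds is witnessed by an order s' of the component
sizes whose first terms follow a stick breaking with proportions in the cells
ds.  This puts the mappings in the situation of [cell_point_close]. *)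
Lemma cell_law_path ds s : cell_law R D ds s != 0 ->
  exists (s' : seq nat) (b : nat -> R),
  [/\ perm_eq s s', forall i, 0 <= b i <= 1,
    forall i, (i < size ds)%N -> `|b i - cell_fraction ds i| <= D%:R^-1,
    forall i, (i < size ds)%N -> (nth 0%N s' i)%:R = (sumn s)%:R * stick_breaking b i &
    forall i, (size ds <= i)%N -> (nth 0%N s' i)%:R <= (sumn s)%:R * stick_rest b (size ds)].
Proof.
elim: ds s => [|d ds IH] s /=.
  move=> _; exists s, (fun=> 0); split => // i; first by rewrite lexx ler01.
  by move=> _; rewrite /stick_rest big_ord0 mulr1 ler_nat nth_le_sumn.
move=> nz; have [x xs] : exists2 x, x \in s & (pick_cell D x (sumn s) == d)%:R *
    (x%:R / (sumn s)%:R) * cell_law R D ds (rem x s) != 0 :> R.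
  apply/not_exists2P => h; move/negP: nz; apply; rewrite big_seq big1 // => x xs.
  by case: (h x) => // /negP; rewrite negbK => /eqP.
rewrite !mulf_eq0 !negb_or => /andP[/andP[dx /andP[x0 n0]]] /IH[r [b [pr b01 bd bh bt]]].
have {}dx : pick_cell D x (sumn s) = d by apply/eqP; move: dx; case: (pick_cell D x (sumn s) == d); rewrite ?eqxx.
have sE := sumn_rem xs.
have n0' : (0 < sumn s)%N by rewrite lt0n; apply: contra_neq n0 => ->; rewrite invr0.
have xn : (x <= sumn s)%N by rewrite sE leq_addr.
have n0R : 0 < (sumn s)%:R :> R by rewrite ltr0n.
have rE : (sumn (rem x s))%:R = (sumn s)%:R * (1 - x%:R / (sumn s)%:R) :> R.
  rewrite mulrBr mulr1 mulrCA divff ?mulr1 ?gt_eqF //.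
  by rewrite sE natrD addrAC subrr add0r.
exists (x :: r), (fun i => if i is i'.+1 then b i' else x%:R / (sumn s)%:R); split.
- by rewrite (permPl (perm_to_rem xs)) perm_cons.
- by case=> [|i] //=; rewrite divr_ge0 //= ler_pdivrMr // mul1r ler_nat.
- case=> [|i] /= hi; last exact: bd.
  by rewrite /cell_fraction /= -dx; exact: pick_cell_close.
- case=> [|i] /= hi.
    by rewrite /stick_breaking big_ord0 mulr1 mulrCA divff ?mulr1 // gt_eqF.
  by rewrite stick_shift bh // rE -mulrA.
- case=> [|i] //= hi; rewrite stick_rest_shift [leRHS]mulrA -rE; exact: bt.
Qed.

End CellPoints.

(** * The law Beta(1,1/2) *)

Section BetaLaw.
Variable R : realType.
Notation mu := (@lebesgue_measure R).
Notation pdf := (real_beta_pdf 1 (2^-1 : R)).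
Notation Z := (real_beta_fun 1 (2^-1 : R)).

Lemma beta_pdfE (x : R) : 0 < x < 1 -> pdf x = (Num.sqrt (1 - x))^-1 / Z.
Proof.
move=> /andP[x0 x1]; rewrite /real_beta_pdf /real_beta_kernel patchE mem_set; last first.
  by rewrite /= in_itv /= x0.
rewrite subrr powRr0 mul1r; congr (_ / _).
have -> : 2^-1 - 1 = - (2^-1) :> R by field.
by rewrite powRN powR12_sqrt // subr_ge0 ltW.
Qed.

Lemma beta_pdf_out (x : R) : ~ (0 < x < 1) -> pdf x = 0.
Proof.
by move=> x01; rewrite /real_beta_pdf patchE memNset ?mul0r //=.
Qed.

(** The primitive is -2 sqrt(1 - y); the interval stays away from 1, where the
density is unbounded. *)
Lemma integral_beta_pdf (x : R) : 0 < x < 1 ->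
  (\int[mu]_(y in `]0%R, x]) (pdf y)%:E = ((2 * (1 - Num.sqrt (1 - x))) / Z)%:E)%E.
Proof.
move=> /andP[x0 x1].
have c1 : {within `[0, x], continuous (fun y : R => (Num.sqrt (1 - y))^-1 / Z)}.
  apply: continuous_in_subspaceT => y; rewrite inE /= in_itv /= => /andP[y0 yx].
  apply: cvgMl; apply: cvgV.
    by rewrite sqrtr_eq0 -ltNge subr_gt0; lra.
  apply: continuous_comp; last exact: sqrt_continuous.
  by apply: cvgB; [exact: cvg_cst|exact: cvg_id].
transitivity (\int[mu]_(y in `]0%R, x]) ((Num.sqrt (1 - y))^-1 / Z)%:E)%E.
  apply: eq_integral => y; rewrite inE /= in_itv /= => /andP[y0 yx]; rewrite beta_pdfE //.
  by rewrite y0 /=; lra.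
rewrite integral_itv_obnd_cbnd; last first.
  apply/measurable_EFinP; apply: (@measurable_funS _ _ _ _ `[0, x]) => //.
    by move=> y /=; rewrite !in_itv /= => /andP[/ltW -> ->].
  by apply: subspace_continuous_measurable_fun.
pose F (y : R) := - (2 * Num.sqrt (1 - y)) / Z.
have Fc y : {for y, continuous F}.
  apply: cvgMl; apply: cvgN; apply: cvgMr.
  apply: continuous_comp; last exact: sqrt_continuous.
  by apply: cvgB; [exact: cvg_cst|exact: cvg_id].
have Fd (y : R) : y < 1 -> is_derive y 1 F ((Num.sqrt (1 - y))^-1 / Z).
  move=> y1; have y1' : 0 < 1 - y by lra.
  have d1 := is_derive1_sqrt y1'.
  rewrite /F; apply: is_derive_eq; rewrite /GRing.scale /=.
  by rewrite invfM; move: (Num.sqrt _)^-1 Z^-1 => u v; field.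
etransitivity.
  apply: (@continuous_FTC2 _ (fun y => (Num.sqrt (1 - y))^-1 / Z) F _ _ x0 c1).
    split.
    - by move=> y; rewrite in_itv /= => /andP[y0 yx]; have [] := Fd y (lt_trans yx x1).
    - by apply: cvg_at_right_filter; exact: Fc.
    - by apply: cvg_at_left_filter; exact: Fc.
  move=> y; rewrite in_itv /= => /andP[y0 yx].
  by rewrite derive1E; have [_ ->] := Fd y (lt_trans yx x1).
by rewrite -EFinB /F subr0 sqrtr1 -mulrBl; congr (_ / _)%:E; ring.
Qed.

Variables (d : measure_display) (T : measurableType d) (P : probability T R).
Variables (B : {RV P >-> R}) (hB : beta_distributed 1 (2^-1 : R) B).

Notation law A := (P (B @^-1` A)).

Lemma beta_lawE (A : set R) : measurable A -> law A = (\int[mu]_(x in A) (pdf x)%:E)%E.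
Proof. by move=> mA; rewrite -hB. Qed.

Lemma beta_law_out (A : set R) : measurable A -> A `&` `]0, 1[ = set0 -> law A = 0%E.
Proof.
move=> mA A0; rewrite beta_lawE // integral0_eq // => x Ax.
rewrite beta_pdf_out // => x01.
by have : (A `&` `]0, 1[) x by []; rewrite A0.
Qed.

Lemma measurable_preimage_beta (A : set R) : measurable A -> measurable (B @^-1` A).
Proof. by move=> mA; exact: measurable_funPTI. Qed.

Lemma beta_law01 : law `]0, 1[ = 1%E.
Proof.
have m1 : measurable (`]0, 1[ : set R) by exact: measurable_itv.
have := probability_setC P (measurable_preimage_beta m1).
have f : law `]0, 1[ \is a fin_num by exact: fin_num_measure (measurable_preimage_beta m1).
rewrite preimage_setC [X in X = _ -> _](beta_law_out (measurableC m1)) ?setICl //.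
rewrite -(fineK f) -EFinB => -[h]; congr EFin; lra.
Qed.

(** Instead of evaluating the improper integral Z = int (1-x)^(-1/2), its value is
read off from the total mass 1 of the law of B, by continuity from below along
]0, 1 - 1/(n+2)]. *)
Lemma beta_norm : Z = 2.
Proof.
pose A n : set R := `]0, 1 - n.+2%:R^-1].
have cA : (\bigcup_n (B @^-1` A n)) = B @^-1` `]0, 1[.
  apply/seteqP; split => w /=.
    move=> [n _]; rewrite /A /= !in_itv /= => /andP[-> h] /=.
    by apply: le_lt_trans h _; rewrite ltrBlDr ltrDl invr_gt0.
  rewrite in_itv /= => /andP[b0 b1].
  exists (Num.truncn ((1 - B w)^-1)) => //; rewrite /A /= in_itv /= b0 /=.
  rewrite lerBrDr addrC -lerBrDr -[leRHS]invrK lef_pV2 ?posrE ?invr_gt0 ?subr_gt0 //.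
  by apply/ltW/(lt_trans (truncnS_gt _)); rewrite ltr_nat.
have mA n : measurable (B @^-1` A n) by apply: measurable_preimage_beta; exact: measurable_itv.
have nd : nondecreasing_seq (fun n => B @^-1` A n).
  move=> n m nm; apply/subsetPset => w; rewrite /A /= !in_itv /= => /andP[-> h] /=.
  by apply: le_trans h _; rewrite lerD2l lerN2 lef_pV2 ?posrE // ler_nat ltnS.
have mU : measurable (\bigcup_n (B @^-1` A n)) by apply: bigcup_measurable.
have cv : P (B @^-1` A n) @[n --> \oo] --> 1%E.
  have -> : 1%E = P (\bigcup_n (B @^-1` A n)) by rewrite cA; exact/esym/beta_law01.
  exact: (nondecreasing_cvg_mu mA mU nd).
have e n : P (B @^-1` A n) = ((2 * (1 - Num.sqrt (n.+2%:R^-1))) / Z)%:E.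
  rewrite beta_lawE; last exact: measurable_itv.
  rewrite integral_beta_pdf; first by have -> : 1 - (1 - n.+2%:R^-1) = n.+2%:R^-1 :> R by ring.
  by rewrite subr_gt0 invf_lt1 // ltr1n /= ltrBlDr ltrDl invr_gt0.
move: cv; under eq_fun do rewrite e.
move=> /fine_cvg /= h1.
have h2 : (2 * (1 - Num.sqrt (n.+2%:R^-1))) / Z @[n --> \oo] --> (2 * (1 - Num.sqrt 0)) / Z.
  apply: cvgMl; apply: cvgMr; apply: cvgB; first exact: cvg_cst.
  apply: continuous_cvg; first exact: sqrt_continuous.
  have := @cvg_natV0 R; rewrite -(cvg_shiftn 2).
  by under eq_fun do rewrite addn2.
have : 1 = (2 * (1 - Num.sqrt 0)) / Z :> R by apply: (cvg_unique _ h1 h2).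
rewrite sqrtr0 subr0 mulr1 => e1.
have Z0 : Z != 0 by apply/eqP => Z0; move: e1; rewrite Z0 invr0 mulr0 => /eqP; rewrite oner_eq0.
by move/(congr1 ( *%R^~ Z)): e1; rewrite mul1r divfK.
Qed.

Lemma beta_law_cdf (x : R) : 0 <= x <= 1 -> law `]0, x] = (1 - Num.sqrt (1 - x))%:E.
Proof.
move=> /andP[]; rewrite le_eqVlt => /predU1P[<- _|x0].
  by rewrite set_itvoc0 preimage_set0 measure0 subr0 sqrtr1 subrr.
rewrite le_eqVlt => /predU1P[->|x1].
  rewrite subrr sqrtr0 subr0; apply/eqP; rewrite eq_le; apply/andP; split.
    by apply: probability_le1; apply: measurable_preimage_beta; exact: measurable_itv.
  rewrite -beta_law01; apply: le_measure; rewrite ?inE; try by apply: measurable_preimage_beta; exact: measurable_itv.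
  by move=> w /=; rewrite !in_itv /= => /andP[-> /ltW].
rewrite beta_lawE; last exact: measurable_itv.
by rewrite integral_beta_pdf ?x0 // beta_norm; congr EFin; field.
Qed.

Lemma beta_law_itv (x y : R) : 0 <= x -> x <= y -> y <= 1 ->
  law `]x, y] = (Num.sqrt (1 - x) - Num.sqrt (1 - y))%:E.
Proof.
move=> x0 xy y1.
have mP u v : measurable (B @^-1` `]u, v]) by apply: measurable_preimage_beta; exact: measurable_itv.
have U : B @^-1` `]0, y] = (B @^-1` `]0, x]) `|` (B @^-1` `]x, y]).
  apply/seteqP; split => w /=; rewrite !in_itv /=.
    by move=> /andP[w0 wy]; case: (leP (B w) x) => wx; [left; rewrite w0|right].
  by move=> [/andP[w0 wx]|/andP[xw wy]]; [rewrite w0 (le_trans wx)|rewrite (le_lt_trans x0)].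
have Fx : P (B @^-1` `]0, x]) = (1 - Num.sqrt (1 - x))%:E.
  by apply: beta_law_cdf; rewrite x0 (le_trans xy).
have Fy : P (B @^-1` `]0, y]) = (1 - Num.sqrt (1 - y))%:E.
  by apply: beta_law_cdf; rewrite y1 (le_trans x0).
have h : (P (B @^-1` `]0%R, x]) + P (B @^-1` `]x, y]))%E = (1 - Num.sqrt (1 - y))%:E.
  rewrite -Fy U measureU //.
  apply/seteqP; split => w //=; rewrite !in_itv /= => -[/andP[_ wx] /andP[xw _]].
  by move: xw; rewrite ltNge wx.
rewrite Fx in h.
have f : law `]x, y] \is a fin_num by exact: fin_num_measure (mP _ _).
by move: h; rewrite -(fineK f) -EFinD => -[h]; congr EFin; lra.
Qed.

End BetaLaw.

(** * Continuity and measurability of the test function *)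

Section UniformContinuity.
Variables (R : realType) (m : nat) (g : 'rV[R]_m -> R).
Hypothesis g_cont : continuous g.

(** Compactness of the unit cube.  Letting the second point range over the whole
space spares a bound on the random sequences that will take its place. *)
Lemma uniformly_continuous_box (e : R) : 0 < e -> exists2 del : R, 0 < del &
  forall x y : 'rV[R]_m, (forall j, 0 <= x ord0 j <= 1) ->
    (forall j, `|x ord0 j - y ord0 j| <= del) -> `|g y - g x| <= e.
Proof.
move=> e0.
have cbox : compact [set v : 'rV[R]_m | forall i, (`[0, 1] : set R) (v ord0 i)].
  by apply: (@rV_compact R m (fun=> `[0, 1])) => i; exact: segment_compact.
have /compact_near_coveringP cov := cbox.
have e2 : 0 < e / 2 by rewrite divr_gt0.
have : \forall del \near 0^'+, [set v : 'rV[R]_m | forall i, (`[0, 1] : set R) (v ord0 i)] `<=`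
    (fun x => forall y : 'rV[R]_m, (forall j, `|x ord0 j - y ord0 j| <= del) -> `|g y - g x| <= e).
  apply: cov => x _.
  have /cvgrPdist_le /(_ _ e2) /nbhs_ballP[r /= r0 hr] := @g_cont x.
  have r2 : 0 < r / 2 by rewrite divr_gt0.
  exists (ball x (r / 2), [set del : R | del < r / 2]) => /=.
    by split; [exact: nbhsx_ballx|exact: nbhs_right_lt].
  move=> [x' del] /= [[_ bx'] dr] y xy.
  have h1 : `|g x - g x'| <= e / 2.
    apply: hr; split=> // i j; apply: le_ball (bx' i j); lra.
  have h2 : `|g x - g y| <= e / 2.
    apply: hr; split=> // i j; rewrite [i]ord1; have := bx' ord0 j; rewrite /ball /= => h.
    have -> : x ord0 j - y ord0 j = (x ord0 j - x' ord0 j) + (x' ord0 j - y ord0 j) by ring.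
    by apply: le_lt_trans (ler_normD _ _) _; have := xy j; lra.
  have -> : g y - g x' = (g x - g x') - (g x - g y) by ring.
  by apply: le_trans (ler_normB _ _) _; lra.
move=> near_del; near (0 : R)^'+ => del.
exists del => [//|x y x01 xy].
have : [set v : 'rV[R]_m | forall i, (`[0, 1] : set R) (v ord0 i)] `<=`
    (fun x => forall y : 'rV[R]_m, (forall j, `|x ord0 j - y ord0 j| <= del) -> `|g y - g x| <= e).
  by near: del.
by apply=> // i /=; rewrite in_itv.
Unshelve. all: end_near. Qed.

Lemma measurable_of_countable_range d (T : measurableType d) (I : countType)
    (phi : T -> I) (f : I -> R) :
  (forall z, measurable (phi @^-1` [set z])) -> measurable_fun setT (f \o phi).
Proof.
move=> mphi _ Y mY; rewrite setTI.
have -> : (f \o phi) @^-1` Y =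
    \bigcup_(z in [set: I]) (if pselect (Y (f z)) then phi @^-1` [set z] else set0).
  apply/seteqP; split => w /=.
    by move=> Yw; exists (phi w) => //; case: pselect.
  by move=> [z _]; case: pselect => // Yz /= ->.
apply: countable_bigcupT_measurable; first exact: countableP.
by move=> z; case: (pselect (Y (f z))) => [Yz|nYz]; [exact: mphi|exact: measurable0].
Qed.

(** g is applied to a vector of random variables.  Rounding the coordinates to
multiples of 1/(N+1) gives functions with countable range, whose measurability is
elementary, and which converge by continuity of g. *)
Lemma measurable_row d (T : measurableType d) (X : nat -> T -> R) :
  (forall j, measurable_fun setT (X j)) ->
  measurable_fun setT (fun w => g (\row_(j < m) X j w)).
Proof.
move=> mX.
pose phi N w : 'rV[int]_m := \row_(j < m) Num.floor (N.+1%:R * X j w).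
pose h N w := g (\row_(j < m) ((phi N w ord0 j)%:~R / N.+1%:R)).
apply: (@measurable_fun_cvg _ _ _ _ h).
  move=> N; apply: (@measurable_of_countable_range _ _ _ (phi N)
    (fun z => g (\row_(j < m) ((z ord0 j)%:~R / N.+1%:R)))) => z.
  have -> : phi N @^-1` [set z] = \bigcap_(j in [set: 'I_m])
      (X j @^-1` `[(z ord0 j)%:~R / N.+1%:R, (z ord0 j + 1)%:~R / N.+1%:R[).
    apply/seteqP; split => w /=.
      move=> <- j _ /=; rewrite mxE in_itv /= ler_pdivrMr // ltr_pdivlMr // mulrC.
      by rewrite floor_le floorD1_gt.
    move=> hw; apply/rowP => j; rewrite mxE; apply: floor_def.
    have := hw j I; rewrite /= in_itv /= ler_pdivrMr // ltr_pdivlMr // mulrC.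
    by [].
  apply: fin_bigcap_measurable; first exact: finite_finset.
  by move=> j _; rewrite -[X in measurable X]setTI; apply: mX => //; exact: measurable_itv.
move=> w _; apply: continuous_cvg; first exact: g_cont.
apply/cvg_ballP => e e0; near=> N; split => // i j; rewrite [i]ord1 !mxE /ball /=.
have N0 : 0 < N.+1%:R :> R by [].
have f1 := floor_le (N.+1%:R * X j w); have f2 := floorD1_gt (N.+1%:R * X j w).
have -> : X j w - (Num.floor (N.+1%:R * X j w))%:~R / N.+1%:R =
   (N.+1%:R * X j w - (Num.floor (N.+1%:R * X j w))%:~R) / N.+1%:R.
  by field.
rewrite ger0_norm; last by rewrite divr_ge0 // subr_ge0.
rewrite ltr_pdivrMr //; apply: (@lt_le_trans _ _ 1).
  by rewrite ltrBlDl; rewrite intrD in f2.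
rewrite -ler_pdivrMl // mulr1; apply: (@le_trans _ _ N%:R); last by rewrite ler_nat.
by near: N; exact: nbhs_infty_ger.
Unshelve. all: end_near. Qed.

End UniformContinuity.

(** * The Poisson-Dirichlet side *)

Section CellSets.
Variables (R : realType) (D : nat).
Hypothesis D_gt0 : (0 < D)%N.

(** Half-open cells: they partition ]0, 1], and the proportions are almost surely
in ]0, 1[. *)
Definition cell_set (k : nat) : set R := `](k%:R / D%:R), (k.+1%:R / D%:R)].

Let D0R : 0 < D%:R :> R. Proof. by rewrite ltr0n. Qed.

Lemma cell_set_cover (b : R) : 0 < b < 1 -> exists k : 'I_D, cell_set k b.
Proof.
move=> /andP[b0 b1].
have ex : exists k, b <= k.+1%:R / D%:R.
  by exists D.-1; rewrite prednK // divff ?gt_eqF // ltW.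
have kD : (ex_minn ex < D)%N.
  case: ex_minnP => k _ /(_ D.-1); rewrite prednK // divff ?gt_eqF // ltW //.
  by move=> /(_ isT); lia.
exists (Ordinal kD); rewrite /cell_set /= in_itv /=; case: ex_minnP => k -> kmin.
rewrite andbT; case: k kmin => [|k] kmin; first by rewrite mul0r.
by rewrite ltNge; apply/negP => /kmin; rewrite ltnn.
Qed.

Lemma cell_set_inj k l (b : R) : cell_set k b -> cell_set l b -> k = l.
Proof.
rewrite /cell_set /= !in_itv /= !ltr_pdivrMr // !ler_pdivlMr // => /andP[h1 h2] /andP[h3 h4].
have kl : k%:R < l.+1%:R :> R by apply: lt_le_trans h4.
have lk : l%:R < k.+1%:R :> R by apply: lt_le_trans h2.
by move: kl lk; rewrite !ltr_nat; lia.
Qed.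

Lemma cell_set_close k (b : R) : cell_set k b -> `|b - k%:R / D%:R| <= D%:R^-1.
Proof.
rewrite /cell_set /= in_itv /= => /andP[h1 h2].
rewrite ger0_norm; last by rewrite subr_ge0 ltW.
by rewrite lerBlDl (le_trans h2) // -[k.+1%:R]natr1 mulrDl mul1r.
Qed.

End CellSets.

Section Approximation.
Variables (R : realType) (m : nat) (g : 'rV[R]_m -> R) (K e del : R).
Hypotheses (g_cont : continuous g) (g_bound : forall v, `|g v| <= K) (e_ge0 : 0 <= e).
Hypothesis g_unif : forall x y : 'rV[R]_m, (forall j, 0 <= x ord0 j <= 1) ->
    (forall j, `|x ord0 j - y ord0 j| <= del) -> `|g y - g x| <= e.
Variables (D : nat).
Hypothesis D_gt0 : (0 < D)%N.

Definition cell_value (ds : seq nat) : R := g (\row_(j < m) cell_point R D ds j).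

(** Bound for the distance of g to [cell_value] on the cells ds: the modulus of
continuity if the cells determine the sequence within del, and the trivial bound
otherwise. *)
Definition cell_osc (ds : seq nat) : R := if cell_error R D ds <= del then e else 2 * K.

Lemma bound_ge0 : 0 <= K.
Proof. by apply: le_trans (g_bound 0). Qed.

Lemma cell_osc_ge0 ds : 0 <= cell_osc ds.
Proof. by rewrite /cell_osc; case: ifP => // _; rewrite mulr_ge0 // bound_ge0. Qed.

Lemma cell_value_close ds (X : nat -> R) : all (fun k => k < D)%N ds ->
  (forall j, `|X j - cell_point R D ds j| <= cell_error R D ds) ->
  `|g (\row_(j < m) X j) - cell_value ds| <= cell_osc ds.
Proof.
move=> dsD hX; rewrite /cell_osc; case: ifP => h.
  apply: g_unif => j; rewrite !mxE; first exact: cell_point_bounds.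
  by rewrite distrC (le_trans (hX j)).
by apply: le_trans (ler_normB _ _) _; have := g_bound (\row_(j < m) X j);
  have := g_bound (\row_(j < m) cell_point R D ds j); rewrite -/(cell_value ds); lra.
Qed.

Lemma all_map_ord J (ds : J.-tuple 'I_D) : all (fun k => k < D)%N (map val ds).
Proof. by apply/allP => _ /mapP[k _ ->]; exact: ltn_ord. Qed.

Section PD.
Variables (d : measure_display) (T : measurableType d) (P : probability T R).
Variables (X : nat -> {RV P >-> R}) (X_PD : poisson_dirichlet (2^-1 : R) X).

(** The event that the first proportions lie in the cells ds. *)
Let beta_cells (B : nat -> {RV P >-> R}) (ds : seq nat) : set T :=
  \bigcap_(i in [set` iota 0 (size ds)]) (B i @^-1` @cell_set R D (nth 0%N ds i)).

Let cells_weight (ds : seq nat) : R := \prod_(k <- ds) cell_prob R D k.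

Let measurable_beta_cells B ds : measurable (beta_cells B ds).
Proof.
apply: fin_bigcap_measurable; first exact: finite_seq.
by move=> i _; apply: measurable_preimage_beta; exact: measurable_itv.
Qed.

Let probability_beta_cells B ds : mutually_independent B ->
  (forall i, beta_distributed 1 (2^-1 : R) (B i)) -> all (fun k => k < D)%N ds ->
  P (beta_cells B ds) = (cells_weight ds)%:E.
Proof.
move=> indB lawB dsD; rewrite /beta_cells.
rewrite (indB (iota 0 (size ds)) (fun i => @cell_set R D (nth 0%N ds i))) ?iota_uniq //; last first.
  by move=> i; exact: measurable_itv.
rewrite /cells_weight (big_nth 0%N) -prodEFin /index_iota subn0.
rewrite big_seq [RHS]big_seq; apply: eq_bigr => i; rewrite mem_iota add0n => /andP[_ ids].
have kD : (nth 0%N ds i < D)%N by apply: (allP dsD); exact: mem_nth.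
have D0R : 0 < D%:R :> R by rewrite ltr0n.
apply: (beta_law_itv (lawB i)).
- by rewrite divr_ge0.
- by rewrite ler_pM2r ?invr_gt0 // ler_nat.
- by rewrite ler_pdivrMr // mul1r ler_nat.
Qed.

Let beta_cells_cover (B : nat -> {RV P >-> R}) J w : (forall i, 0 < B i w < 1) ->
  exists ds : J.-tuple 'I_D, beta_cells B (map val ds) w.
Proof.
move=> b01; have /choice[k hk] := fun i => cell_set_cover D_gt0 (b01 i).
exists [tuple k i | i < J] => i /=; rewrite size_map size_tuple ?card_ord mem_iota add0n => /andP[_ iJ].
rewrite (nth_map (k 0%N)) ?size_tuple ?card_ord //.
have := nth_mktuple (fun i : 'I_J => k i) (k 0%N) (Ordinal iJ) => /= ->; exact: hk.
Qed.

Let beta_cells_inj (B : nat -> {RV P >-> R}) J (ds ds' : J.-tuple 'I_D) w :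
  beta_cells B (map val ds) w -> beta_cells B (map val ds') w -> ds = ds'.
Proof.
move=> h h'; apply: eq_from_tnth => i.
have iJ : (i : nat) \in iota 0 J by rewrite mem_iota /=.
have := h (i : nat); have := h' (i : nat); rewrite /= !size_map !size_tuple => /(_ iJ) h1 /(_ iJ) h2.
move: h1 h2; rewrite !(nth_map (tnth ds i)) ?size_tuple // -!tnth_nth => h1 h2.
by apply: val_inj; apply: (cell_set_inj D_gt0 h2 h1).
Qed.

(** Almost surely exactly one event [beta_cells] occurs, and on it g is within
[cell_osc] of [cell_value]; independence gives the probabilities. *)
Lemma expectation_cells J :
  'E_P[fun w => g (\row_(j < m) X j w)]%E \is a fin_num /\
  `|fine ('E_P[fun w => g (\row_(j < m) X j w)]%E) -
    \sum_(ds : J.-tuple 'I_D) cell_value (map val ds) * \prod_(k <- map val ds) cell_prob R D k|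
  <= \sum_(ds : J.-tuple 'I_D) cell_osc (map val ds) * \prod_(k <- map val ds) cell_prob R D k.
Proof.
have [B [indB lawB aeX]] := X_PD.
rewrite unlock; pose h w := g (\row_(j < m) X j w).
have mh : measurable_fun setT h by apply: (measurable_row g_cont (X := fun j w => X j w)).
have bdd (f : T -> R) (C : R) : measurable_fun setT f -> (forall w, `|f w| <= C) ->
    P.-integrable setT (EFin \o f).
  move=> mf fC; apply: measurable_bounded_integrable => //.
    by apply: le_lt_trans (probability_le1 P measurableT) _; rewrite ltry.
  by exists C; split; [exact: num_real|move=> M CM w _; exact: le_trans (fC w) (ltW CM)].
have ih : P.-integrable setT (EFin \o h) by apply: (bdd _ K) => // w; exact: g_bound.
(* Both sums over cells are expectations of the simple function with value
   c ds on the event ds. *)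
have comb (c : seq nat -> R) :
    P.-integrable setT (EFin \o (fun w => \sum_(ds : J.-tuple 'I_D) c (map val ds) * \1_(beta_cells B (map val ds)) w)) /\
    (\int[P]_w (\sum_(ds : J.-tuple 'I_D) c (map val ds) * \1_(beta_cells B (map val ds)) w)%:E =
     (\sum_(ds : J.-tuple 'I_D) c (map val ds) * \prod_(k <- map val ds) cell_prob R D k)%:E)%E.
  have ii (ds : J.-tuple 'I_D) : P.-integrable setT
      (fun w => ((c (map val ds))%:E * (\1_(beta_cells B (map val ds)) w)%:E)%E).
    apply: integrableZl => //; exact: integrable_indic.
  have E w : ((\sum_(ds : J.-tuple 'I_D) c (map val ds) * \1_(beta_cells B (map val ds)) w)%:E =
      \sum_(ds : J.-tuple 'I_D) ((c (map val ds))%:E * (\1_(beta_cells B (map val ds)) w)%:E))%E.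
    by rewrite -sumEFin; apply: eq_bigr.
  split.
    apply: (eq_integrable measurableT (fun w => \sum_(ds : J.-tuple 'I_D)
       ((c (map val ds))%:E * (\1_(beta_cells B (map val ds)) w)%:E)%E)).
      by move=> w _; rewrite /= E.
    exact: integrable_sum.
  under eq_integral => w _ do rewrite E.
  rewrite integral_sum // -sumEFin; apply: eq_bigr => ds _.
  rewrite integralZl //; last exact: integrable_indic.
  rewrite integral_indic // setIT EFinM; congr (_ * _)%E.
  by apply: probability_beta_cells => //; exact: all_map_ord.
have [i1 e1] := comb cell_value; have [i2 e2] := comb cell_osc.
have fE : (\int[P]_w (h w)%:E)%E \is a fin_num := integrable_fin_num measurableT ih.
split=> //.
rewrite -lee_fin -e2 -[X in (X <= _)%E]/(`|(fine (\int[P]_w (h w)%:E) - _)%:E|)%E EFinB fineK // -e1.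
rewrite -integralB_EFin //.
apply: le_trans (le_abse_integral _ _ _) _ => //.
  by apply: emeasurable_funB; [exact: measurable_int ih|exact: measurable_int i1].
apply: ae_ge0_le_integral => //.
- apply: measurableT_comp => //.
  by apply: emeasurable_funB; [exact: measurable_int ih|exact: measurable_int i1].
- by move=> w _; rewrite lee_fin; apply: sumr_ge0 => ds _; rewrite mulr_ge0 // cell_osc_ge0.
- exact: measurable_int i2.
have aeB : {ae P, forall w, forall i, 0 < B i w < 1}.
  apply: ae_foralln => i.
  exists (B i @^-1` (~` `]0, 1[)); split.
  - by apply: measurable_preimage_beta; apply: measurableC; exact: measurable_itv.
  - apply: (beta_law_out (lawB i)); last by rewrite setICl.
    by apply: measurableC; exact: measurable_itv.
  - by move=> w /= nb; rewrite in_itv /=.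
apply: filterS2 aeB aeX => w b01 rX _.
have [ds0 hds0] := beta_cells_cover J b01.
have one (c : seq nat -> R) : \sum_(ds : J.-tuple 'I_D) c (map val ds) * \1_(beta_cells B (map val ds)) w
    = c (map val ds0).
  rewrite (bigD1 ds0) //= indicE mem_set // mulr1 big1 ?addr0 // => ds dsn.
  rewrite indicE memNset ?mulr0 // => hds.
  by move/eqP: dsn; apply; exact: beta_cells_inj hds hds0.
rewrite /= !one lee_fin; apply: (@cell_value_close _ (fun j => X j w)); first exact: all_map_ord.
move=> j; apply: (@cell_point_close _ _ D_gt0 _ _ (B ^~ w) (X ^~ w) j (all_map_ord ds0) rX).
- by move=> i; have /andP[/ltW -> /ltW ->] := b01 i.
- move=> i iJ; apply: (cell_set_close (k := nth 0%N (map val ds0) i)) => //.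
  by apply: hds0; rewrite /= mem_iota.
- by [].
- move=> i iJ; have b01' k : 0 <= B k w <= 1 by have /andP[/ltW -> /ltW ->] := b01 k.
  have /andP[-> s1] := stick_bounds i b01' => /=.
  by apply: le_trans s1 _; apply: stick_rest_le.
Qed.

End PD.
End Approximation.

(** * Sums over the cells *)

Section CellSums.
Variables (R : realType) (D : nat).
Hypothesis D_gt0 : (0 < D)%N.

Lemma sum_tuple_prod J (F : nat -> R) :
  \sum_(ds : J.-tuple 'I_D) \prod_(k <- map val ds) F k = (\sum_(k < D) F k) ^+ J.
Proof.
elim: J => [|J IH].
  rewrite (bigD1 [tuple]) //= big_nil big1 ?addr0 // => ds /eqP [].
  by apply: val_inj; rewrite tuple0.
rewrite sum_tuple_cons exprS -IH big_distrl /=; apply: eq_bigr => k _.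
by rewrite big_distrr /=; apply: eq_bigr => ds _; rewrite big_cons.
Qed.

Let s k : R := Num.sqrt (1 - k%:R / D%:R).
Let D0R : 0 < D%:R :> R. Proof. by rewrite ltr0n. Qed.

Lemma cell_prob_ge0 k : 0 <= cell_prob R D k.
Proof.
by rewrite /cell_prob subr_ge0 ler_wsqrtr // lerD2l lerN2 ler_pM2r ?invr_gt0 // ler_nat.
Qed.

Let s0 : s 0%N = 1. Proof. by rewrite /s mul0r subr0 sqrtr1. Qed.

Let sD : s D = 0. Proof. by rewrite /s divff ?gt_eqF // subrr sqrtr0. Qed.

Let s_sqr k : (k <= D)%N -> s k ^+ 2 = 1 - k%:R / D%:R.
Proof. by move=> kD; rewrite sqr_sqrtr // subr_ge0 ler_pdivrMr // mul1r ler_nat. Qed.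

Lemma sum_cell_prob : \sum_(k < D) cell_prob R D k = 1.
Proof.
have H n : \sum_(k < n) cell_prob R D k = 1 - s n.
  elim: n => [|n IH]; first by rewrite big_ord0 s0 subrr.
  by rewrite big_ord_recr /= IH /cell_prob -/(s n) -/(s n.+1); ring.
by rewrite H sD subr0.
Qed.

(** The mean of 1 - B is int_0^1 (1-x)^(1/2) dx / 2 = 1/3; the left ends of the
cells overestimate 1 - B by at most 1/D. *)
Lemma mean_rest_le : \sum_(k < D) cell_prob R D k * (1 - k%:R / D%:R) <= 3^-1 + D%:R^-1.
Proof.
(* In the variable s = sqrt(1 - x) the mean is the integral of s^2, which gives
   the first term; the second one pays for the left ends. *)
have H n : (n <= D)%N -> \sum_(k < n) cell_prob R D k * (1 - k%:R / D%:R) <=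
    (1 - s n ^+ 3) / 3 + (1 - s n) / D%:R.
  elim: n => [|n IH] nD; first by rewrite big_ord0 s0 expr1n subrr !mul0r addr0.
  rewrite big_ord_recr /= -(s_sqr (ltnW nD)) /cell_prob -/(s n) -/(s n.+1).
  have := IH (ltnW nD); set S := \sum_(_ < _) _.
  have b0 : 0 <= s n.+1 by exact: sqrtr_ge0.
  have ba : s n.+1 <= s n by rewrite -subr_ge0; exact: cell_prob_ge0.
  have dV : D%:R^-1 = s n ^+ 2 - s n.+1 ^+ 2.
    by rewrite !s_sqr // 1?ltnW // -[n.+1%:R]natr1; field; rewrite gt_eqF.
  rewrite dV; move: (s n) (s n.+1) b0 ba S => a b b0 ba S h; rewrite -subr_ge0.
  have h2 : 0 <= (a - b) ^+ 2 * (a + 2 * b) / 3 by rewrite divr_ge0 // mulr_ge0 ?sqr_ge0 //; lra.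
  apply: le_trans (_ : 0 <= (1 - a ^+ 3) / 3 + (1 - a) * (a ^+ 2 - b ^+ 2) - S + (a - b) ^+ 2 * (a + 2 * b) / 3) _.
    by apply: addr_ge0 => //; rewrite subr_ge0.
  by rewrite le_eqVlt; apply/orP; left; apply/eqP; field.
apply: le_trans (H D (leqnn _)) _; rewrite sD expr0n /= !subr0 mul1r mul1r //.
Qed.

Lemma stick_rest_cells ds : stick_rest (cell_fraction R D ds) (size ds) =
  \prod_(k <- ds) (1 - k%:R / D%:R).
Proof. by rewrite /stick_rest (big_nth 0%N) big_mkord. Qed.

(** Markov's inequality: the cells ds are bad only if the rest of the stick is at
least del/2, and the mean of the rest is a product over the J breaks. *)
Lemma sum_osc_le J (K e del : R) : 0 <= K -> 0 < del -> 0 <= e -> J%:R / D%:R <= del / 2 ->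
  \sum_(ds : J.-tuple 'I_D) cell_osc K e del D (map val ds) *
      \prod_(k <- map val ds) cell_prob R D k
  <= e + 2 * K * (2 / del) * (3^-1 + D%:R^-1) ^+ J.
Proof.
move=> K0 del0 e0 JD.
have P0 (ds : seq nat) : 0 <= \prod_(k <- ds) cell_prob R D k.
  by apply: prodr_ge0 => k _; exact: cell_prob_ge0.
apply: (@le_trans _ _ (\sum_(ds : J.-tuple 'I_D)
    (e * \prod_(k <- map val ds) cell_prob R D k + 2 * K * (2 / del) *
     \prod_(k <- map val ds) (cell_prob R D k * (1 - k%:R / D%:R))))).
  apply: ler_sum => ds _; rewrite big_split /= mulrCA -stick_rest_cells.
  rewrite [X in _ <= X + _]mulrC -mulrDr [leLHS]mulrC ler_wpM2l //.
  have r0 : 0 <= stick_rest (cell_fraction R D (map val ds)) (size (map val ds)).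
    have /andP[] // := stick_rest_bounds (size (map val ds))
      (fun i => cell_fraction_bounds R D_gt0 i (all_map_ord ds)).
  have KK : 0 <= 2 * K * (2 / del) by rewrite !mulr_ge0 // invr_ge0 ltW.
  rewrite /cell_osc; case: ifP => [_|/negbT]; first by rewrite lerDl mulr_ge0.
  rewrite -ltNge /cell_error {1}size_map size_tuple => h.
  have h1 : del / 2 <= stick_rest (cell_fraction R D (map val ds)) (size (map val ds)) by lra.
  have h2 : 2 * K <= 2 * K * (2 / del) * stick_rest (cell_fraction R D (map val ds)) (size (map val ds)).
    apply: (@le_trans _ _ (2 * K * (2 / del) * (del / 2))); last by rewrite ler_wpM2l.
    by rewrite le_eqVlt; apply/orP; left; apply/eqP; field; rewrite gt_eqF.
  by rewrite (le_trans h2) // lerDr.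
rewrite big_split /= -!big_distrr /= !sum_tuple_prod sum_cell_prob expr1n mulr1 lerD2l.
apply: ler_wpM2l; first by rewrite !mulr_ge0 // invr_ge0 ltW.
apply: lerXn2r; rewrite ?nnegrE; last exact: mean_rest_le.
- apply: sumr_ge0 => k _; rewrite mulr_ge0 ?cell_prob_ge0 // subr_ge0.
  by rewrite ler_pdivrMr // mul1r ler_nat ltnW.
- by rewrite addr_ge0.
Qed.

End CellSums.

(** * The mapping side *)

Section MappingSide.
Variables (R : realType) (p : R).
Hypotheses (p_gt0 : 0 < p) (p_lt1 : p < 1).
Variables (m : nat) (g : 'rV[R]_m -> R) (K e del : R).
Hypotheses (g_bound : forall v, `|g v| <= K) (e_ge0 : 0 <= e).
Hypothesis g_unif : forall x y : 'rV[R]_m, (forall j, 0 <= x ord0 j <= 1) ->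
    (forall j, `|x ord0 j - y ord0 j| <= del) -> `|g y - g x| <= e.
Variables (D J : nat).
Hypothesis D_gt0 : (0 < D)%N.

Notation val_ ds := (map val (ds : J.-tuple 'I_D)).

Lemma mapping_value_close n (f : {ffun 'I_n -> 'I_n}) (ds : J.-tuple 'I_D) : (0 < n)%N ->
  cell_law R D (val_ ds) (component_sizes f) != 0 ->
  `|g (\row_(j < m) ((component_size f j)%:R / n%:R)) - cell_value g D (val_ ds)|
    <= cell_osc K e del D (val_ ds).
Proof.
move=> n0 /(cell_law_path D_gt0)[s' [b [ps b01 bd bh bt]]].
rewrite sumn_component_sizes in bh bt.
have nR : n%:R != 0 :> R by rewrite pnatr_eq0 -lt0n.
apply: (cell_value_close g_bound g_unif D_gt0 (X := fun j => (component_size f j)%:R / n%:R)).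
  exact: all_map_ord.
move=> j; apply: (@cell_point_close _ _ D_gt0 _ (fun i => (nth 0%N s' i)%:R / n%:R) b
  (fun j => (component_size f j)%:R / n%:R) j (all_map_ord ds) _ b01 bd).
- by apply: (component_size_rearrangement (c := n%:R^-1)) ps; rewrite invr_ge0.
- by move=> i ids; rewrite bh // mulrAC divff // mul1r.
- move=> i ids; rewrite divr_ge0 //= ler_pdivrMr ?ltr0n // mulrC; exact: bt.
Qed.

(** The analogue of [expectation_cells].  Here the probabilities of the ds may
add up to less than 1, because a mapping may have fewer than J components; the
last term is the trivial bound on the missing mass. *)
Lemma mapping_mean_cells n : (0 < n)%N -> total_weight n p != 0 ->
  `|mapping_mean p (fun f : {ffun 'I_n -> 'I_n} =>
      g (\row_(j < m) ((component_size f j)%:R / n%:R))) -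
    \sum_(ds : J.-tuple 'I_D) cell_value g D (val_ ds) * cell_mean p D (val_ ds) n|
  <= \sum_(ds : J.-tuple 'I_D) cell_osc K e del D (val_ ds) * cell_mean p D (val_ ds) n
     + K * (1 - \sum_(ds : J.-tuple 'I_D) cell_mean p D (val_ ds) n).
Proof.
move=> n0 W0; have Wpos : 0 < total_weight n p.
  by rewrite lt0r W0 total_weight_ge0.
pose F (f : {ffun 'I_n -> 'I_n}) := g (\row_(j < m) ((component_size f j)%:R / n%:R)).
pose c (f : {ffun 'I_n -> 'I_n}) (ds : J.-tuple 'I_D) := cell_law R D (val_ ds) (component_sizes f).
have meanE (c' : J.-tuple 'I_D -> R) : \sum_(ds : J.-tuple 'I_D) c' ds * cell_mean p D (val_ ds) n =
    mapping_mean p (fun f => \sum_(ds : J.-tuple 'I_D) c' ds * c f ds).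
  rewrite /mapping_mean; under [RHS]eq_bigr => x _ do rewrite big_distrr /=.
  rewrite exchange_big /=; apply: eq_bigr => ds _.
  rewrite /cell_mean -(mapping_meanE p n (cell_law R D (val_ ds))) /mapping_mean big_distrr /=.
  by apply: eq_bigr => x _; rewrite /c; ring.
have mean1 : mapping_mean p (fun f : {ffun 'I_n -> 'I_n} => 1) = 1.
  by rewrite (mapping_meanE p n (fun=> 1)) -total_weightE divff.
have -> : \sum_(ds : J.-tuple 'I_D) cell_mean p D (val_ ds) n =
    \sum_(ds : J.-tuple 'I_D) 1 * cell_mean p D (val_ ds) n by apply: eq_bigr => ds _; rewrite mul1r.
rewrite !meanE -[X in K * (X - _)]mean1.
have -> (u v : {ffun 'I_n -> 'I_n} -> R) :
    mapping_mean p u - mapping_mean p v = mapping_mean p (fun f => u f - v f).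
  by rewrite /mapping_mean -sumrB; apply: eq_bigr => x _; rewrite mulrBr.
rewrite /mapping_mean -sumrB big_distrr -big_split /=.
apply: le_trans (ler_norm_sum _ _ _) _; apply: ler_sum => -[S f] /= _.
have w0 : 0 <= mapping_weight p S / total_weight n p.
  by rewrite divr_ge0 ?mapping_weight_ge0 ?ltW.
rewrite normrM (ger0_norm w0) -mulrBr mulrCA -mulrDr ler_wpM2l //.
rewrite -/(F f); under [X in _ <= _ + _ * (_ - X)]eq_bigr do rewrite mul1r.
have cs1 : \sum_ds c f ds <= 1 by exact: sum_cell_law_le.
have -> : F f - \sum_ds cell_value g D (val_ ds) * c f ds =
    \sum_ds (F f - cell_value g D (val_ ds)) * c f ds + F f * (1 - \sum_ds c f ds).
  by under [in RHS]eq_bigr do rewrite mulrBl; rewrite sumrB -big_distrr /=; ring.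
apply: le_trans (ler_normD _ _) _; apply: lerD; last first.
  have d0 : 0 <= 1 - \sum_ds c f ds by rewrite subr_ge0.
  by rewrite normrM (ger0_norm d0) ler_wpM2r //; exact: g_bound.
apply: le_trans (ler_norm_sum _ _ _) _; apply: ler_sum => ds _.
have c0 : 0 <= c f ds by exact: cell_law_ge0.
rewrite normrM (ger0_norm c0).
have [->|nz] := eqVneq (c f ds) 0; first by rewrite !mulr0.
by apply: ler_wpM2r; [exact: cell_law_ge0|exact: (mapping_value_close n0 nz)].
Qed.

End MappingSide.

Unset Implicit Arguments.

Theorem corollary3p13 (R : realType) (p : R) (p_gt0 : 0 < p) (p_lt1 : p < 1)
    (d : measure_display) (T : measurableType d) (P : probability T R)
    (X : nat -> {RV P >-> R}) (X_PD : poisson_dirichlet (2^-1 : R) X)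
    (m : nat) (g : 'rV[R]_m -> R) (g_cont : continuous g)
    (g_bounded : exists K : R, forall v : 'rV[R]_m, `|g v| <= K) :
  (mapping_mean p (fun f : {ffun 'I_n -> 'I_n} =>
     g (\row_(j < m) ((component_size f j)%:R / n%:R))))%:E @[n --> \oo]
  --> 'E_P[fun w => g (\row_(j < m) X j w)]%E.
Proof.
have [K g_bound] := g_bounded.
have K0 : 0 <= K by apply: le_trans (g_bound 0).
have [t [t01 dt]] := saddle_exists p.
have [c c0 Mc] := scaled_weight_cvg p_gt0 p_lt1 t01 dt.
have Efin : 'E_P[fun w => g (\row_(j < m) X j w)]%E \is a fin_num.
  have [del _ g_unif] := uniformly_continuous_box g_cont ltr01.
  by have [] := expectation_cells g_cont g_bound ler01 g_unif (ltn0Sn 0) X_PD 0.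
rewrite -(fineK Efin); apply: cvg_EFin; first by apply: nearW.
apply/cvgrPdist_le => eta eta0.
(* The bounds add up to 6 e: 2 e for the Poisson-Dirichlet side, e for the
   convergence of the sum over cells and 3 e for the mapping side. *)
pose e := eta / 8.
have e0 : 0 < e by rewrite divr_gt0.
have [del del0 g_unif] := uniformly_continuous_box g_cont e0.
have [J hJ] : exists J, 2 * K * (2 / del) * (2 / 3) ^+ J <= e.
  have h : 2 * K * (2 / del) * (2 / 3) ^+ n @[n --> \oo] --> 2 * K * (2 / del) * 0.
    apply: cvgMr; apply: cvg_expr; rewrite ger0_norm; lra.
  rewrite mulr0 in h; move/cvgr0Pnorm_le: h => /(_ _ e0) [N _ hN].
  by exists N; apply: le_trans (ler_norm _) _; apply: hN => /=.
(* D >= 3 turns the factor 1/3 + 1/D of a break into at most 2/3. *)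
pose D := (Num.truncn (2 * J%:R / del) + 3)%N.
have D_gt0 : (0 < D)%N by rewrite /D addn3.
have D0R : 0 < D%:R :> R by rewrite ltr0n.
have JD : J%:R / D%:R <= del / 2.
  rewrite ler_pdivrMr //.
  have : 2 * J%:R / del < D%:R.
    by apply: lt_le_trans (truncnS_gt _) _; rewrite ler_nat /D -addn1 leq_add2l.
  by rewrite ltr_pdivrMr //; lra.
have DV : D%:R^-1 <= 3^-1 :> R by rewrite lef_pV2 ?posrE // ler_nat /D leq_addl.
have [_ PDside] := expectation_cells g_cont g_bound (ltW e0) g_unif D_gt0 X_PD J.
have Ole := @sum_osc_le R D D_gt0 J K e del K0 del0 (ltW e0) JD.
set E := fine _ in PDside *.
set O := \sum_(ds : J.-tuple 'I_D) cell_osc K e del D (map val ds) * _ in PDside Ole.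
set S := \sum_(ds : J.-tuple 'I_D) cell_value g D (map val ds) * _ in PDside.
have {}Ole : O <= 2 * e.
  apply: le_trans Ole _.
  have : 2 * K * (2 / del) * (3^-1 + D%:R^-1) ^+ J <= 2 * K * (2 / del) * (2 / 3) ^+ J.
    apply: ler_wpM2l; first by rewrite !mulr_ge0 // invr_ge0 ltW.
    apply: lerXn2r; rewrite ?nnegrE ?addr_ge0 // ?divr_ge0 //.
    by move: DV; move: (D%:R^-1) => u; lra.
  lra.
have thc (ds : J.-tuple 'I_D) : cell_mean p D (map val ds) n @[n --> \oo] -->
    \prod_(k <- map val ds) cell_prob R D k.
  by apply: (cell_mean_cvg p_gt0 p_lt1 t01 dt); exact: all_map_ord.
pose Sn n := \sum_(ds : J.-tuple 'I_D) cell_value g D (map val ds) * cell_mean p D (map val ds) n.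
pose Rn n := \sum_(ds : J.-tuple 'I_D) cell_osc K e del D (map val ds) * cell_mean p D (map val ds) n
   + K * (1 - \sum_(ds : J.-tuple 'I_D) cell_mean p D (map val ds) n).
have Scv : Sn n @[n --> \oo] --> S.
  by apply: cvg_sum_seq => ds; apply: cvgMr.
have Rcv : Rn n @[n --> \oo] --> O + K * (1 - 1).
  apply: cvgD; first by apply: cvg_sum_seq => ds; apply: cvgMr.
  apply: cvgMr; apply: cvgB; first exact: cvg_cst.
  have -> : 1 = \sum_(ds : J.-tuple 'I_D) \prod_(k <- map val ds) cell_prob R D k.
    by rewrite sum_tuple_prod sum_cell_prob ?expr1n.
  exact: cvg_sum_seq.
rewrite subrr mulr0 addr0 in Rcv.
near=> n.
have n0 : (0 < n)%N by near: n; exists 1%N.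
have W0 : total_weight n p != 0.
  have : 0 < n%:R * scaled_weight p t n by near: n; exact: near_weight_gt0 c0 Mc.
  rewrite /scaled_weight => h; apply/eqP => W0.
  by move: h; rewrite W0 !(mul0r, mulr0) ltxx.
pose G := mapping_mean p (fun f : {ffun 'I_n -> 'I_n} =>
  g (\row_(j < m) ((component_size f j)%:R / n%:R))).
have main : `|G - Sn n| <= Rn n by exact: mapping_mean_cells.
have hS : `|S - Sn n| <= e by near: n; move/cvgrPdist_le: Scv => /(_ _ e0).
have hR : `|O - Rn n| <= e by near: n; move/cvgrPdist_le: Rcv => /(_ _ e0).
rewrite /= -/G; move: main PDside hS hR; move: (Sn n) (Rn n) => s r; clearbody G S O E.
rewrite !ler_norml => /andP[a1 a2] /andP[a3 a4] /andP[a5 a6] /andP[a7 a8].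
have e8 : eta = 8 * e by rewrite /e; field.
by rewrite e8; apply/andP; split; lra.
Unshelve. all: end_near. Qed.
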